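(* Let $p\ge2$, let $\alpha,\kappa>0$, and suppose the assumption on data stated in the context holds. Let $\{\boldsymbol m_h^j\}_{j=0}^J$ be an adapted solution of the mass-lumped midpoint scheme (as defined in the context). Then there exists a constant $C_{p,T,\alpha,\kappa,\Gamma}>0$, independent of $h$ and $k$, such that $$ \begin{aligned} &\mathbb E\Big[\max_{0\le j\le J}\|\partial_x\boldsymbol m_h^j\|_{\mathbb L^2}^{2p}\Big] +\mathbb E\Big[\Big(\sum_{j=0}^{J-1}\|\partial_x(\boldsymbol m_h^{j+1}-\boldsymbol m_h^j)\|_{\mathbb L^2}^2\Big)^p\Big] +\mathbb E\Big[\Big(\sum_{j=0}^{J-1}k\,\|\boldsymbol m_h^{j+\frac12}\times\Delta_h\boldsymbol m_h^{j+1}\|_h^2\Big)^p\Big]\\ &\qquad\le C_{p,T,\alpha,\kappa,\Gamma}\Big(1+\mathbb E\big[\|\partial_x\boldsymbol m_h^0\|_{\mathbb L^2}^{2p}\big]\Big). \end{aligned} $$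
   Context: **Domain and function spaces.** $D=(0,L)$ is a bounded interval, $T>0$, $(\Omega,\mathcal F,\{\mathcal F_t\}_{t\in[0,T]},\mathbb P)$ is a filtered probability space satisfying the usual conditions, $\mathbb S^2\subset\mathbb R^3$ is the unit sphere. $\mathbb L^p=L^p(D;\mathbb R^3)$, $\mathbb W^{s,p}=W^{s,p}(D;\mathbb R^3)$, $\mathbb H^s=\mathbb W^{s,2}$; $\langle\cdot,\cdot\rangle$ is the $\mathbb L^2$ inner product; $\times$ is the cross product in $\mathbb R^3$, applied pointwise. **Assumption on data (standing).** $\boldsymbol m_0\in H^3(D;\mathbb S^2)$ with $\partial_x\boldsymbol m_0=\boldsymbol 0$ on $\partial D$. $W(t)=\sum_{\ell\ge1}\boldsymbol g_\ell\beta_\ell(t)$, where $\beta_\ell$ are independent standard $\{\mathcal F_t\}$-Brownian motions and $\boldsymbol g_\ell\in\mathbb H^3$ are deterministic with $\Gamma:=\sum_{\ell\ge1}\|\boldsymbol g_\ell\|_{\mathbb H^3}<\infty$ and $\partial_x\boldsymbol g_\ell=\boldsymbol 0$ on $\partial D$ for all $\ell$. **Finite elements.** $\{\mathcal T_h\}_{h>0}$ is a family of shape-regular, quasi-uniform partitions of $D$ into intervals with maximal mesh size $h$, node set $\mathcal N_h$; $\mathbb V_h$ is the space of continuous functions $\overline D\to\mathbb R^3$ that are affine on each element; $\varphi_z$ ($z\in\mathcal N_h$) are the scalar nodal basis (hat) functions and $I_h$ is nodal interpolation (scalar or vector). For continuous $\boldsymbol u,\boldsymbol v$: $\langle\boldsymbol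 u,\boldsymbol v\rangle_h:=\int_D I_h(\boldsymbol u\cdot\boldsymbol v)\,\mathrm dx=\sum_{z\in\mathcal N_h}\beta_z\,\boldsymbol u(z)\cdot\boldsymbol v(z)$, $\beta_z=\int_D\varphi_z\,\mathrm dx$, and $\|\boldsymbol v\|_h^2:=\langle\boldsymbol v,\boldsymbol v\rangle_h$. The discrete Laplacian $\Delta_h:\mathbb V_h\to\mathbb V_h$ is defined by $\langle\Delta_h\boldsymbol v_h,\boldsymbol\chi_h\rangle_h=-\langle\partial_x\boldsymbol v_h,\partial_x\boldsymbol\chi_h\rangle$ for all $\boldsymbol\chi_h\in\mathbb V_h$. **Scheme.** $t_j=jk$, $j=0,\dots,J$, $k=T/J\in(0,1]$. $\boldsymbol g_{\ell,h}:=I_h\boldsymbol g_\ell$, $\hat\Delta_j\beta_\ell:=\beta_\ell(t_{j+1})-\beta_\ell(t_j)$, $\hat\Delta_jW_h:=\sum_\ell\boldsymbol g_{\ell,h}\hat\Delta_j\beta_\ell$. An adapted solution of the mass-lumped midpoint scheme is a sequence of $\mathbb V_h$-valued, $\mathcal F_{t_j}$-measurable $\boldsymbol m_h^j$ with $\boldsymbol m_h^0=I_h\boldsymbol m_0$ and, with $\boldsymbol m_h^{j+\frac12}:=\frac12(\boldsymbol m_h^{j+1}+\boldsymbol m_h^j)$, for all $\boldsymbol\phi_h\in\mathbb V_h$ and $j=0,\dots,J-1$, $$\langle\boldsymbol m_h^{j+1}-\boldsymbol m_h^j,\boldsymbol\phi_h\rangle_h+\alpha\kappa k\langle\boldsymbol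 m_h^{j+\frac12}\times[\boldsymbol m_h^{j+\frac12}\times\Delta_h\boldsymbol m_h^{j+1}],\boldsymbol\phi_h\rangle_h-\kappa k\langle\boldsymbol m_h^{j+\frac12}\times\Delta_h\boldsymbol m_h^{j+1},\boldsymbol\phi_h\rangle_h=\langle\boldsymbol m_h^{j+\frac12}\times\hat\Delta_jW_h,\boldsymbol\phi_h\rangle_h .$$ Constants may also depend on the domain length $L$ and the mesh-regularity constants. *)

(* Defs.v *)
From HB Require Import structures.
From mathcomp Require Import all_boot all_order all_algebra.
From mathcomp Require Import all_classical all_reals all_analysis.

Set Implicit Arguments.
Unset Strict Implicit.
Unset Printing Implicit Defensive.

Import Order.TTheory GRing.Theory Num.Theory.
Import numFieldNormedType.Exports.

Local Open Scope classical_set_scope.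
Local Open Scope ring_scope.

Definition dot (R : realType) (u v : 'rV[R]_3) : R :=
  \sum_(i < 3) u 0 i * v 0 i.

(* The indices are taken modulo 3, in the additive group 'I_3. *)
Definition cross (R : realType) (u v : 'rV[R]_3) : 'rV[R]_3 :=
  \row_(i < 3) (u 0 (i + 1) * v 0 (i + 1 + 1) - u 0 (i + 1 + 1) * v 0 (i + 1)).

(* D is the interval (0, L). A function on D (or on its closure) is represented
   by a function on R, of which only the values on D (or on its closure)
   matter. *)

Definition L2inner (R : realType) (L : R) (u v : R -> 'rV[R]_3) : R :=
  \int[lebesgue_measure]_(x in `]0, L[) dot (u x) (v x).

Definition L2norm (R : realType) (L : R) (u : R -> 'rV[R]_3) : R :=
  Num.sqrt (L2inner L u u).

Definition in_L2 (R : realType) (L : R) (u : R -> 'rV[R]_3) : Prop :=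
  (forall c : 'I_3, measurable_fun `]0, L[ (fun x => u x 0 c)) /\
  (\int[lebesgue_measure]_(x in `]0%R, L[) (dot (u x) (u x))%:E < +oo)%E.

Definition test_function (R : realType) (L : R) (phi : R -> R) : Prop :=
  (forall (n : nat) (x : R), derivable (derive1n n phi) x 1) /\
  exists a b : R, [/\ 0 < a, b < L &
    forall x, phi x != 0 -> x \in `[a, b]].

Definition weak_derivative (R : realType) (L : R) (n : nat)
    (u v : R -> 'rV[R]_3) : Prop :=
  forall phi : R -> R, test_function L phi -> forall c : 'I_3,
    \int[lebesgue_measure]_(x in `]0, L[) (u x 0 c * derive1n n phi x) =
    (-1) ^+ n * \int[lebesgue_measure]_(x in `]0, L[) (v x 0 c * phi x).

Definition in_H (R : realType) (L : R) (s : nat) (u : R -> 'rV[R]_3) : Prop :=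
  in_L2 L u /\
  forall n, (1 <= n <= s)%N -> exists2 v, in_L2 L v & weak_derivative L n u v.

(* A chosen L^2 representative of the n-th weak derivative. *)
Definition wderiv (R : realType) (L : R) (n : nat) (u : R -> 'rV[R]_3) :
    R -> 'rV[R]_3 :=
  xget (fun=> 0) [set v | in_L2 L v /\ weak_derivative L n u v].

Definition Hnorm (R : realType) (L : R) (s : nat) (u : R -> 'rV[R]_3) : R :=
  Num.sqrt (L2norm L u ^+ 2 + \sum_(1 <= n < s.+1) L2norm L (wderiv L n u) ^+ 2).

(* The boundary values of the weak derivative are those of its continuous
   representative. *)
Definition neumann (R : realType) (L : R) (u : R -> 'rV[R]_3) : Prop :=
  exists v : R -> 'rV[R]_3,
    [/\ weak_derivative L 1 u v, {within `[0, L], continuous v},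
        v 0 = 0 & v L = 0].

(* Fields of H^3 with vanishing normal derivative, given by their continuous
   representative, so that their nodal values make sense. *)
Definition smooth_datum (R : realType) (L : R) (u : R -> 'rV[R]_3) : Prop :=
  [/\ {within `[0, L], continuous u}, in_H L 3 u & neumann L u].

Record mesh (R : realType) (L : R) := Mesh {
  nelt : nat;
  node : nat -> R;
  node_first : node 0%N = 0;
  node_last : node nelt = L;
  node_lt : forall i, (i < nelt)%N -> node i < node i.+1 }.

Definition mesh_size (R : realType) (L : R) (Th : mesh L) : R :=
  \big[Num.max/0]_(i < nelt Th) (node Th i.+1 - node Th i).

(* In dimension one every partition into intervals is shape-regular. *)
Definition quasi_uniform (R : realType) (L : R) (rho : R) (Th : mesh L) : Prop :=
  forall i, (i < nelt Th)%N ->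
    mesh_size Th <= rho * (node Th i.+1 - node Th i).

Definition hat (R : realType) (L : R) (Th : mesh L) (i : nat) (x : R) : R :=
  if (0 < i)%N && (node Th i.-1 <= x <= node Th i)
  then (x - node Th i.-1) / (node Th i - node Th i.-1)
  else if (i < nelt Th)%N && (node Th i <= x <= node Th i.+1)
  then (node Th i.+1 - x) / (node Th i.+1 - node Th i)
  else 0.

Definition interp (R : realType) (L : R) (Th : mesh L) (V : lmodType R)
    (u : R -> V) (x : R) : V :=
  \sum_(i < (nelt Th).+1) hat Th i x *: u (node Th i).

Definition in_Vh (R : realType) (L : R) (Th : mesh L) (v : R -> 'rV[R]_3) : Prop :=
  {within `[0, L], continuous v} /\
  forall i, (i < nelt Th)%N -> exists a b : 'rV[R]_3,
    forall x, x \in `[node Th i, node Th i.+1] -> v x = a + x *: b.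

Definition hinner (R : realType) (L : R) (Th : mesh L) (u v : R -> 'rV[R]_3) : R :=
  \int[lebesgue_measure]_(x in `]0, L[)
    interp Th (fun y => dot (u y) (v y) : R^o) x.

Definition hnorm (R : realType) (L : R) (Th : mesh L) (v : R -> 'rV[R]_3) : R :=
  Num.sqrt (hinner Th v v).

(* On V_h the weak derivative is the classical one, which exists off the nodes. *)
Definition is_discrete_laplacian (R : realType) (L : R) (Th : mesh L)
    (v w : R -> 'rV[R]_3) : Prop :=
  in_Vh Th w /\
  forall chi, in_Vh Th chi -> hinner Th w chi = - L2inner L (derive1 v) (derive1 chi).

(* The defining property determines the values on [0, L]. *)
Definition discrete_laplacian (R : realType) (L : R) (Th : mesh L)
    (v : R -> 'rV[R]_3) : R -> 'rV[R]_3 :=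
  xget (fun=> 0) [set w | is_discrete_laplacian Th v w].

Definition rv_measurable (R : realType) (Omega : Type)
    (G : set (set Omega)) (X : Omega -> R) : Prop :=
  forall B : set R, measurable B -> G (X @^-1` B).

Definition filtration (R : realType) (d : measure_display)
    (Omega : measurableType d) (T : R) (F : R -> set (set Omega)) : Prop :=
  (forall t, t \in `[0, T] ->
     sigma_algebra setT (F t) /\ F t `<=` measurable) /\
  (forall s t, 0 <= s -> s <= t -> t <= T -> F s `<=` F t).

Definition usual_conditions (R : realType) (d : measure_display)
    (Omega : measurableType d) (P : probability Omega R) (T : R)
    (F : R -> set (set Omega)) : Prop :=
  (forall N, P.-negligible N -> F 0 N) /\
  (forall t, t \in `[0, T[ ->
     \bigcap_(s in [set s | t < s <= T]) F s = F t).

Definition increment (R : realType) (Omega : Type) (X : R -> Omega -> R)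
    (s t : R) (w : Omega) : R := X t w - X s w.

Definition brownian_motion (R : realType) (d : measure_display)
    (Omega : measurableType d) (P : probability Omega R) (T : R)
    (F : R -> set (set Omega)) (beta : R -> Omega -> R) : Prop :=
  [/\ forall t, t \in `[0, T] -> rv_measurable (F t) (beta t),
      {ae P, forall w, beta 0 w = 0},
      {ae P, forall w, {within `[0, T], continuous (fun t => beta t w)}},
      forall (s t : R) (B : set R), 0 <= s -> s < t -> t <= T -> measurable B ->
        P (increment beta s t @^-1` B) =
        normal_prob 0 (Num.sqrt (t - s)) B
    & forall (s t : R) (A : set Omega) (B : set R),
        0 <= s -> s < t -> t <= T -> F s A -> measurable B ->
        P (A `&` increment beta s t @^-1` B) =
        (P A * P (increment beta s t @^-1` B))%E].

Definition process_sigma_algebra (R : realType) (Omega : Type) (T : R)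
    (X : R -> Omega -> R) : set (set Omega) :=
  <<s [set A | exists t (B : set R),
         [/\ t \in `[0, T], measurable B & A = X t @^-1` B]] >>.

Definition independent_processes (R : realType) (d : measure_display)
    (Omega : measurableType d) (P : probability Omega R) (T : R)
    (X : nat -> R -> Omega -> R) : Prop :=
  forall (s : seq nat) (A : nat -> set Omega), uniq s ->
    (forall l, l \in s -> process_sigma_algebra T (X l) (A l)) ->
    P (\bigcap_(l in [set` s]) A l) = (\prod_(l <- s) P (A l))%E.

(* Increment over [t, t'] of the interpolated noise; the series converges almost
   surely. *)
Definition noise_increment (R : realType) (L : R) (Th : mesh L) (Omega : Type)
    (g : nat -> R -> 'rV[R]_3) (beta : nat -> R -> Omega -> R) (t t' : R)
    (w : Omega) (x : R) : 'rV[R]_3 :=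
  limn (fun n => \sum_(0 <= l < n)
    increment (beta l) t t' w *: interp Th (g l) x).

Definition midpoint (R : realType) (Omega : Type)
    (m : nat -> Omega -> R -> 'rV[R]_3) (j : nat) (w : Omega) (x : R) : 'rV[R]_3 :=
  2^-1 *: (m j.+1 w x + m j w x).

Definition midpoint_torque (R : realType) (L : R) (Th : mesh L) (Omega : Type)
    (m : nat -> Omega -> R -> 'rV[R]_3) (j : nat) (w : Omega) (x : R) : 'rV[R]_3 :=
  cross (midpoint m j w x) (discrete_laplacian Th (m j.+1 w) x).

Definition midpoint_solution (R : realType) (d : measure_display)
    (Omega : measurableType d) (P : probability Omega R) (L T : R)
    (alpha kappa : R) (F : R -> set (set Omega))
    (beta : nat -> R -> Omega -> R) (g : nat -> R -> 'rV[R]_3)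
    (m0 : R -> 'rV[R]_3) (Th : mesh L) (J : nat)
    (m : nat -> Omega -> R -> 'rV[R]_3) : Prop :=
  let k := T / J%:R in
  [/\ forall j w, (j <= J)%N -> in_Vh Th (m j w),
      (* the evaluations generate the Borel sigma-algebra of V_h *)
      forall j x (c : 'I_3), (j <= J)%N -> x \in `[0, L] ->
        rv_measurable (F (j%:R * k)) (fun w => m j w x 0 c),
      {ae P, forall w, forall x, x \in `[0, L] -> m 0%N w x = interp Th m0 x}
    & {ae P, forall w, forall j, (j < J)%N -> forall phi, in_Vh Th phi ->
        hinner Th (fun x => m j.+1 w x - m j w x) phi
        + alpha * kappa * k *
          hinner Th
            (fun x => cross (midpoint m j w x) (midpoint_torque Th m j w x)) phi
        - kappa * k * hinner Th (midpoint_torque Th m j w) phi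
        = hinner Th
            (fun x => cross (midpoint m j w x)
              (noise_increment Th g beta (j%:R * k) (j.+1%:R * k) w x)) phi}].

(* Main.v *)
Require Import Defs.
From HB Require Import structures.
From mathcomp Require Import all_boot all_order all_algebra.
From mathcomp Require Import all_classical all_reals all_analysis.
From mathcomp Require Import measurable_realfun.
From mathcomp Require Import ring lra.

(** Testing the scheme with the discrete Laplacian of m^{j+1} gives, for
    X_j = |d_x m^j|^2 and M_j the part of the noise term that is linear in the noise
    and evaluated at time t_j,
      X_{j+1} + |d_x (m^{j+1} - m^j)|^2 / 2 + alpha kappa k |m x Lap m|_h^2
        <= X_j + 2 M_j + C eta_j^2 (1 + X_j),
    where eta_j = sum_l c_l |beta_l(t_{j+1}) - beta_l(t_j)| and c_l bounds the values
    and the Dirichlet norm of g_l. Everything is linear in the single increments, so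
    only the independence of each increment from the past is needed. Let R_j be
    1 + X_0 plus the accumulated right-hand sides and S_j its running maximum. In
    place of the Burkholder-Davis-Gundy inequality, the potential
      S^p - a S^(p-1) R + K R^p,   a = p / (p - 1),
    which dominates S^p / 2, has expectation growing at most by a factor 1 + B k per
    step; since X_0 is deterministic this bounds E S_J^p, and S_J controls the three
    quantities of the statement. *)

Set Implicit Arguments.
Unset Strict Implicit.
Unset Printing Implicit Defensive.

Import Order.TTheory GRing.Theory Num.Theory.
Import numFieldNormedType.Exports.

Local Open Scope classical_set_scope.
Local Open Scope ring_scope.

(** * Cross products and nodal forms *)

(** The obstacle: the energy is tested at the new time and the noise is multiplied by the midpoint,
    so the noise term is not a martingale increment; d = m^{j+1} - m^j is driven by the same noise.
    Expanding around t_j leaves three remainders containing both d and the noise. Two are absorbed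
    by the implicit dissipation |d_x d|^2. The third, d x (noise)_x . (m^j)_x, requires the supremum
    of d. In dimension one this is bounded by |d_x d| and the L^2 norm of d, and the latter is read
    off from the scheme: d is of order k |m x Lap m| plus noise. The damping supplies this square
    with weight k, which is where alpha > 0 and k <= 1 enter.

    The errors that are left are multiples of eta_j^2 (1 + X_j) with eta_j unbounded, so the p-th
    power cannot be expanded for small increments only. Increments are measured relative to R_j, and
    the Taylor remainder of the power is bounded by the powers 2 and 2N of the relative increment, N
    >= p an integer. Even Gaussian moments and k <= 1 then make each such term O(k) times the
    potential. *)

Lemma sqr_le_mul_of_quadratic (R : realFieldType) (A B S : R) :
  0 <= A -> 0 <= B -> (forall s, 0 <= A + 2 * s * S + s ^+ 2 * B) ->
  S ^+ 2 <= A * B.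
Proof.
move=> A0 B0 H; have [B1|B1] := eqVneq B 0.
  have [->|S0] := eqVneq S 0; first by rewrite expr0n/= mulr_ge0.
  (* With [B = 0] the polynomial is affine in [s]; at this [s] it takes the value -1. *)
  have := H (- (A + 1) / (2 * S)); rewrite B1 mulr0 addr0.
  have -> : 2 * (- (A + 1) / (2 * S)) * S = - (A + 1) by field; rewrite S0.
  lra.
have B2 : 0 < B by rewrite lt_neqAle eq_sym B1.
have := H (- S / B).
have -> : A + 2 * (- S / B) * S + (- S / B) ^+ 2 * B = (A * B - S ^+ 2) / B.
  by field.
by rewrite pmulr_lge0 ?invr_gt0// subr_ge0.
Qed.

(** Young's inequality: the square of the right side is [P * Q] plus the square of
    [l * P - Q / (4 * l)]. The weight [l] fixes how much is to be absorbed through [P]. *)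
Lemma ler_weighted_AGM (R : realFieldType) (T P Q l : R) :
  0 <= P -> 0 <= Q -> 0 < l -> T ^+ 2 <= P * Q -> T <= l * P + Q / (4 * l).
Proof.
move=> P0 Q0 l0 H.
have l1 : l != 0 by rewrite gt_eqF.
have Z : 0 <= l * P + Q / (4 * l).
  by rewrite addr_ge0// ?mulr_ge0// ?invr_ge0 ?mulr_ge0// ltW.
have [T0|T0] := leP T 0; first exact: le_trans T0 Z.
rewrite -(@ler_pXn2r _ 2)// ?nnegrE//; last exact: ltW.
apply: (le_trans H).
have -> : (l * P + Q / (4 * l)) ^+ 2 =
  P * Q + (l * P - Q / (4 * l)) ^+ 2 by field.
by rewrite lerDl sqr_ge0.
Qed.

Section vector3.
Context {R : realType}.
Implicit Types u v w : 'rV[R]_3.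

Lemma dotE u v :
  dot u v = u 0 0 * v 0 0 + u 0 1 * v 0 1 + u 0 (1 + 1) * v 0 (1 + 1).
Proof.
rewrite /dot !big_ord_recl big_ord0 addr0 addrA.
by congr (_ + _ + _); congr (u 0 _ * v 0 _); apply/val_inj.
Qed.

Let ord3_3 : 1 + 1 + 1 = 0 :> 'I_3. Proof. exact/val_inj. Qed.

Lemma cross_coord0 u v :
  cross u v 0 0 = u 0 1 * v 0 (1 + 1) - u 0 (1 + 1) * v 0 1.
Proof. by rewrite mxE !add0r. Qed.

Lemma cross_coord1 u v :
  cross u v 0 1 = u 0 (1 + 1) * v 0 0 - u 0 0 * v 0 (1 + 1).
Proof. by rewrite mxE ord3_3. Qed.

Lemma cross_coord2 u v :
  cross u v 0 (1 + 1) = u 0 0 * v 0 1 - u 0 1 * v 0 0.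
Proof. by rewrite mxE ord3_3 add0r. Qed.

Definition coordE :=
  (dotE, cross_coord0, cross_coord1, cross_coord2).

Lemma rV3_ext u v : u 0 0 = v 0 0 -> u 0 1 = v 0 1 ->
  u 0 (1 + 1) = v 0 (1 + 1) -> u = v.
Proof.
move=> e0 e1 e2; apply/rowP => i.
have : [|| i == 0, i == 1 | i == 1 + 1] by case: i => [[|[|[|//]]] ?].
by case/or3P => /eqP ->.
Qed.

Lemma dotC u v : dot u v = dot v u.
Proof. by rewrite !coordE; ring. Qed.

Lemma dotDl u v w : dot (u + v) w = dot u w + dot v w.
Proof. by rewrite !coordE !mxE; ring. Qed.

Lemma dotZl (c : R) u w : dot (c *: u) w = c * dot u w.
Proof. by rewrite !coordE !mxE; ring. Qed.

Lemma dotNl u w : dot (- u) w = - dot u w.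
Proof. by rewrite !coordE !mxE; ring. Qed.

Lemma dotBl u v w : dot (u - v) w = dot u w - dot v w.
Proof. by rewrite dotDl dotNl. Qed.

Lemma dotDr u v w : dot w (u + v) = dot w u + dot w v.
Proof. by rewrite !(dotC w) dotDl. Qed.

Lemma dotZr (c : R) u w : dot w (c *: u) = c * dot w u.
Proof. by rewrite !(dotC w) dotZl. Qed.

Lemma dotNr u w : dot w (- u) = - dot w u.
Proof. by rewrite !(dotC w) dotNl. Qed.

Lemma dotBr u v w : dot w (u - v) = dot w u - dot w v.
Proof. by rewrite dotDr dotNr. Qed.

Lemma dot0l u : dot 0 u = 0.
Proof. by rewrite -(scale0r u) dotZl mul0r. Qed.

Lemma dot_ge0 u : 0 <= dot u u.
Proof. by rewrite dotE !addr_ge0// -expr2 sqr_ge0. Qed.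

Lemma dot_cross_self u v : dot (cross u v) u = 0.
Proof. by rewrite !coordE; ring. Qed.

Lemma dot_cross_le u v : dot (cross u v) (cross u v) <= dot u u * dot v v.
Proof.
have -> : dot u u * dot v v = dot (cross u v) (cross u v) + dot u v ^+ 2.
  by rewrite !coordE; ring.
by rewrite lerDl sqr_ge0.
Qed.

Lemma dotD_le u v : dot (u + v) (u + v) <= 2 * dot u u + 2 * dot v v.
Proof.
have := dot_ge0 (u - v).
rewrite !dotBl !dotDl !dotBr !dotDr (dotC v u); lra.
Qed.

End vector3.

(* In terms of nodal values, [stiff] is the Dirichlet form, [trap] the mass-lumped
   integral, and [torque_form] the integral of (abar x u_x) . v_x with abar the
   midpoint value of a on each element. *)
Definition stiff (R : realType) (n : nat) (h : nat -> R)
    (u v : nat -> 'rV[R]_3) : R :=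
  \sum_(i < n) dot (u i.+1 - u i) (v i.+1 - v i) / h i.

Definition trap (R : realType) (n : nat) (h : nat -> R) (f : nat -> R) : R :=
  \sum_(i < n) h i * (2^-1 * (f i + f i.+1)).

Definition torque_form (R : realType) (n : nat) (h : nat -> R)
    (a u v : nat -> 'rV[R]_3) : R :=
  \sum_(i < n) dot (cross (2^-1 *: (a i + a i.+1)) (u i.+1 - u i))
                   (v i.+1 - v i) / h i.

Section nodal.
Context {R : realType}.
Variables (n : nat) (h : nat -> R).
Hypothesis h_gt0 : forall i, (i < n)%N -> 0 < h i.
Implicit Types u v w a b : nat -> 'rV[R]_3.

Local Lemma h0 (i : 'I_n) : 0 < h i. Proof. exact/h_gt0/ltn_ord. Qed.

Lemma weighted_CS (c : 'I_n -> R) (u v : 'I_n -> 'rV[R]_3) :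
  (forall i, 0 <= c i) ->
  (\sum_i dot (u i) (v i) * c i) ^+ 2 <=
  (\sum_i dot (u i) (u i) * c i) * (\sum_i dot (v i) (v i) * c i).
Proof.
move=> c0; apply: sqr_le_mul_of_quadratic.
- by apply: sumr_ge0 => i _; rewrite mulr_ge0 ?dot_ge0.
- by apply: sumr_ge0 => i _; rewrite mulr_ge0 ?dot_ge0.
move=> s.
have : 0 <= \sum_i dot (u i + s *: v i) (u i + s *: v i) * c i.
  by apply: sumr_ge0 => i _; rewrite mulr_ge0 ?dot_ge0.
rewrite !mulr_sumr -!big_split/=.
under eq_bigr => i _ do rewrite dotDl !dotDr !dotZl !dotZr (dotC (v i) (u i)).
congr (0 <= _); apply: eq_bigr => i _; ring.
Qed.

Lemma stiffC u v : stiff n h u v = stiff n h v u.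
Proof. by apply: eq_bigr => i _; rewrite dotC. Qed.

Lemma stiff_ge0 u : 0 <= stiff n h u u.
Proof. by apply: sumr_ge0 => i _; rewrite divr_ge0 ?dot_ge0 ?ltW ?h0. Qed.

Lemma stiffDl u v w : stiff n h (u \+ v) w = stiff n h u w + stiff n h v w.
Proof.
rewrite -big_split; apply: eq_bigr => i _ /=.
by rewrite -mulrDl -dotDl; congr (dot _ _ / _); rewrite opprD addrACA.
Qed.

Lemma stiffDr u v w : stiff n h w (u \+ v) = stiff n h w u + stiff n h w v.
Proof. by rewrite !(stiffC w) stiffDl. Qed.

Lemma stiffZl (s : R) u v : stiff n h (fun i => s *: u i) v = s * stiff n h u v.
Proof.
rewrite mulr_sumr; apply: eq_bigr => i _.
by rewrite -scalerBr dotZl mulrA.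
Qed.

Lemma stiffZr (s : R) u v : stiff n h v (fun i => s *: u i) = s * stiff n h v u.
Proof. by rewrite !(stiffC v) stiffZl. Qed.

(** Taking the Laplacian at the new time yields [stiff n h d d] with a positive sign; this
    dissipation later absorbs remainders of the noise term. *)
Lemma stiff_polarization a d : stiff n h (a \+ d) d =
  2^-1 * (stiff n h (a \+ d) (a \+ d) - stiff n h a a + stiff n h d d).
Proof. by rewrite !stiffDl !stiffDr (stiffC d a); field. Qed.

Lemma trap_le f g : (forall i, (i <= n)%N -> f i <= g i) ->
  trap n h f <= trap n h g.
Proof.
move=> fg; apply: ler_sum => i _; apply: ler_wpM2l; first exact/ltW/h0.
by rewrite ler_wpM2l// lerD// fg// ltnW.
Qed.

Lemma eq_trap f g : (forall i, (i <= n)%N -> f i = g i) ->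
  trap n h f = trap n h g.
Proof.
by move=> fg; apply: eq_bigr => i _; rewrite !fg// ltnW.
Qed.

Lemma trapD f g : trap n h (f \+ g) = trap n h f + trap n h g.
Proof. by rewrite -big_split; apply: eq_bigr => i _ /=; ring. Qed.

Lemma trapZ (c : R) f : trap n h (fun i => c * f i) = c * trap n h f.
Proof. by rewrite mulr_sumr; apply: eq_bigr => i _ /=; ring. Qed.

Lemma trap_cst (c : R) : trap n h (fun=> c) = c * \sum_(i < n) h i.
Proof. by rewrite mulr_sumr; apply: eq_bigr => i _ /=; field. Qed.

Lemma trap_ge0 f : (forall i, (i <= n)%N -> 0 <= f i) -> 0 <= trap n h f.
Proof.
move=> f0; have -> : 0 = trap n h (fun=> 0) by rewrite trap_cst mul0r.
exact: trap_le.
Qed.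

(** Discrete Sobolev embedding in dimension one: a difference of nodal values telescopes into
    increments over elements, to which Cauchy-Schwarz applies. *)
Lemma dot_nodal_diff_le u i j : (j <= i <= n)%N ->
  dot (u i - u j) (u i - u j) <= (\sum_(l < n) h l) * stiff n h u u.
Proof.
move=> /andP[ji iN]; set D := u i - u j.
(* The factor [h l] cancels the weight [(h l)^-1], so that the pairing with the increments of [u]
   telescopes to [dot D D]. *)
pose v l := if (j <= l < i)%N then h l *: D else 0.
have S1 : \sum_(l < n) dot (u l.+1 - u l) (v l) * (h l)^-1 = dot D D.
  rewrite -(big_mkord xpredT (fun l => dot (u l.+1 - u l) (v l) * (h l)^-1)).
  rewrite (big_cat_nat _ (n := i))//= [X in _ + X]big1_seq ?addr0; last first.
    move=> l; rewrite mem_index_iota => /andP[_ /andP[il ln]].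
    by rewrite /v ltnNge il andbF dotC dot0l mul0r.
  rewrite (big_cat_nat _ (n := j))//= big1_seq ?add0r; last first.
    move=> l; rewrite mem_index_iota => /andP[_ /andP[_ lj]].
    by rewrite /v leqNgt lj dotC dot0l mul0r.
  rewrite (eq_big_nat _ _ (F2 := fun l => dot (u l.+1 - u l) D)); last first.
    move=> l /andP[jl li]; rewrite /v jl li dotZr mulrAC divff ?mul1r//.
    by rewrite gt_eqF// h_gt0// (leq_trans li).
  under eq_bigr => l _ do rewrite dotBl.
  by rewrite (telescope_sumr (fun l => dot (u l) D))// -dotBl.
have S2 : \sum_(l < n) dot (v l) (v l) * (h l)^-1 <= dot D D * \sum_(l < n) h l.
  rewrite mulr_sumr; apply: ler_sum => l _; rewrite /v; case: ifP => _.
    rewrite dotZl dotZr mulrC !mulrA mulVf ?mul1r 1?mulrC//.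
    by rewrite gt_eqF// h0.
  by rewrite dot0l mul0r mulr_ge0 ?dot_ge0// ltW// h0.
have H : dot D D ^+ 2 <= stiff n h u u * (dot D D * \sum_(l < n) h l).
  rewrite -{1}S1; apply: (le_trans (weighted_CS _ _ _)) => [l|].
    by rewrite invr_ge0 ltW// h0.
  by rewrite ler_wpM2l// stiff_ge0.
have [->|D0] := eqVneq (dot D D) 0.
  by rewrite mulr_ge0 ?stiff_ge0// sumr_ge0// => l _; rewrite ltW// h0.
have D1 : 0 < dot D D by rewrite lt_neqAle eq_sym D0 dot_ge0.
by rewrite -(ler_pM2l D1) -expr2 (le_trans H)// mulrCA [_ * stiff _ _ _ _]mulrC.
Qed.

(** The value at [i] is compared with the value at every node [j], and the comparison is averaged
    over [j] with the trapezoidal weights, of total mass [L]. Neither constant depends on the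
    mesh. *)
Lemma dot_nodal_le (L : R) u i : (i <= n)%N -> \sum_(l < n) h l = L -> 0 < L ->
  dot (u i) (u i) <= 2 / L * trap n h (fun i => dot (u i) (u i))
                     + 2 * L * stiff n h u u.
Proof.
move=> iN hL L0.
have P j : (j <= n)%N ->
    dot (u i) (u i) <= 2 * dot (u j) (u j) + 2 * (L * stiff n h u u).
  move=> jN; have -> : u i = u j + (u i - u j) by rewrite addrC subrK.
  apply: (le_trans (dotD_le _ _)); rewrite lerD2l ler_wpM2l// -hL.
  have [ji|/ltnW ij] := leqP j i; first by rewrite dot_nodal_diff_le// ji.
  rewrite -opprB dotNl dotC dotNl opprK.
  by rewrite dot_nodal_diff_le// ij.
have := trap_le P; rewrite trap_cst hL.
rewrite (_ : trap n h _ = 2 * trap n h (fun j => dot (u j) (u j)) +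
  2 * (L * stiff n h u u) * L); last first.
  by rewrite -hL -trap_cst -trapZ -trapD.
rewrite -ler_pdivlMr// => /le_trans; apply.
rewrite mulrDl mulfK ?gt_eqF// mulrA lerD2r le_eqVlt; apply/orP; left.
by apply/eqP; ring.
Qed.

Lemma torque_formDl a u v w :
  torque_form n h a (u \+ v) w = torque_form n h a u w + torque_form n h a v w.
Proof.
rewrite -big_split; apply: eq_bigr => i _ /=.
rewrite -mulrDl; congr (_ / _); rewrite !coordE !mxE; ring.
Qed.

Lemma torque_formZl a (s : R) u w :
  torque_form n h a (fun i => s *: u i) w = s * torque_form n h a u w.
Proof.
rewrite mulr_sumr; apply: eq_bigr => i _.
rewrite [RHS]mulrA; congr (_ / _); rewrite !coordE !mxE; ring.
Qed.

Lemma dot_mean_le u (D : R) i : (i < n)%N ->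
  (forall i, (i <= n)%N -> dot (u i) (u i) <= D) ->
  dot (2^-1 *: (u i + u i.+1)) (2^-1 *: (u i + u i.+1)) <= D.
Proof.
move=> iN uD; rewrite dotZl dotZr.
have := dotD_le (u i) (u i.+1); have := uD i (ltnW iN); have := uD i.+1 iN.
lra.
Qed.

Lemma torque_form_le a u v (D : R) : 0 <= D ->
  (forall i, (i <= n)%N -> dot (a i) (a i) <= D) ->
  torque_form n h a u v ^+ 2 <= D * stiff n h u u * stiff n h v v.
Proof.
move=> D0 aD; apply: (le_trans (weighted_CS _ _ _)) => [i|].
  by rewrite invr_ge0 ltW// h0.
rewrite ler_wpM2r ?stiff_ge0// /stiff mulr_sumr; apply: ler_sum => i _.
rewrite mulrA ler_wpM2r ?invr_ge0//; first exact/ltW/h0.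
apply: (le_trans (dot_cross_le _ _)); rewrite ler_wpM2r ?dot_ge0//.
exact: dot_mean_le.
Qed.

(** Discrete product rule for the increment of the midpoint times the noise: mean times increment
    plus increment times mean. In the second part the triple product with [a' - a] repeated
    vanishes, and antisymmetry merges the two mixed terms into one with factor one half. Every term
    except the first contains [d]. *)
Lemma cross_element_identity (a a' d d' u u' : 'rV[R]_3) :
  let c x x' := 2^-1 *: (x + x') : 'rV[R]_3 in
  let q x y z := cross (x + 2^-1 *: y) z in
  dot (q a' d' u' - q a d u) ((a' + d') - (a + d)) =
  dot (cross (c a a') (u' - u)) (a' - a) +
  2^-1 * dot (cross (c u u') (d' - d)) (a' - a) +
  dot (cross (c a a' + 2^-1 *: c d d') (u' - u)) (d' - d) +
  2^-1 * dot (cross (c d d') (u' - u)) (a' - a).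
Proof. by rewrite /= dotBl !coordE !mxE; field. Qed.

End nodal.

(** * One step of the midpoint scheme *)

Section midpoint_step.
Context {R : realType}.
Variables (n : nat) (h : nat -> R) (L alpha kappa k : R).
Hypothesis h_gt0 : forall i, (i < n)%N -> 0 < h i.
Hypotheses (sum_h : \sum_(i < n) h i = L) (L_gt0 : 0 < L).
Hypotheses (alpha_gt0 : 0 < alpha) (kappa_gt0 : 0 < kappa).
Hypotheses (k_gt0 : 0 < k) (k_le1 : k <= 1).
(** [a] and [b] are the nodal values before and after the step, [w] those of the discrete Laplacian
    of [b], [u] those of the noise increment, whose size [eta] will bound. *)
Variables (a b w u : nat -> 'rV[R]_3) (eta : R).
Let mid i := 2^-1 *: (b i + a i).
Let t i := cross (mid i) (w i).
Let d i := b i - a i.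
Hypothesis discrete_lap : forall chi : nat -> 'rV[R]_3,
  trap n h (fun i => dot (w i) (chi i)) = - stiff n h b chi.
Hypothesis scheme : forall i, (i <= n)%N ->
  d i + (alpha * kappa * k) *: cross (mid i) (t i) - (kappa * k) *: t i
  = cross (mid i) (u i).
Hypothesis a_unit : forall i, (i <= n)%N -> dot (a i) (a i) = 1.

(** All terms of the scheme except [d i] are orthogonal to [mid i], and [dot (d i) (mid i)] is half
    the difference of the squared lengths. *)
Lemma midpoint_unit i : (i <= n)%N -> dot (b i) (b i) = 1.
Proof.
move=> iN; have /(congr1 (fun x => dot x (mid i))) := scheme iN.
rewrite dotBl dotDl !dotZl !dot_cross_self !mulr0 subr0 addr0.
rewrite /d /mid dotZr dotBl !dotDr (dotC (b i) (a i)).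
have := a_unit iN; lra.
Qed.

Let mid_le1 i : (i <= n)%N -> dot (mid i) (mid i) <= 1.
Proof.
move=> iN; rewrite /mid dotZl dotZr.
have := dotD_le (b i) (a i); rewrite (a_unit iN) (midpoint_unit iN); lra.
Qed.

(* Test the scheme against the discrete Laplacian of b; the alpha term becomes
   |t|^2 because t is orthogonal to mid. *)
Lemma midpoint_energy_identity :
  stiff n h b b - stiff n h a a + stiff n h d d
    + 2 * (alpha * kappa * k) * trap n h (fun i => dot (t i) (t i))
  = 2 * stiff n h b (fun i => cross (mid i) (u i)).
Proof.
have H : stiff n h b d + (alpha * kappa * k) * trap n h (fun i => dot (t i) (t i))
  = stiff n h b (fun i => cross (mid i) (u i)).
  apply: oppr_inj; rewrite opprD -!discrete_lap -mulNr -trapZ -trapD.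
  apply: eq_trap => i iN; rewrite -scheme// dotBr dotDr !dotZr /=.
  have -> : dot (w i) (t i) = 0 by rewrite /t !coordE; ring.
  have -> : dot (w i) (cross (mid i) (t i)) = - dot (t i) (t i).
    by rewrite {2 3}/t !coordE; ring.
  by ring.
rewrite -H; suff -> : stiff n h b d =
  2^-1 * (stiff n h b b - stiff n h a a + stiff n h d d) by field.
have bE : b = a \+ d by apply/funext => i; rewrite /d/= addrC subrK.
by rewrite {1}bE stiff_polarization -bE.
Qed.

(** Only the first term is free of [d]: it is linear in the noise, with coefficients known before
    the step. The other three are products of the noise with [d]. *)
Let stiff_noise :
  stiff n h b (fun i => cross (mid i) (u i)) =
  torque_form n h a u a + 2^-1 * torque_form n h u d a
  + torque_form n h mid u d + 2^-1 * torque_form n h d u a.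
Proof.
rewrite /torque_form !mulr_sumr -!big_split/=; apply: eq_bigr => i _.
have bE j : b j = a j + d j by rewrite /d addrC subrK.
have midE j : mid j = a j + 2^-1 *: d j.
  by rewrite /mid /d; apply/rowP => l; rewrite !mxE; field.
rewrite !mulrA -!mulrDl; congr (_ / _).
rewrite [LHS]dotC !midE !bE cross_element_identity; congr (_ + _ + _ + _).
congr (dot (cross _ _) _).
by apply/rowP => l; rewrite !mxE; field.
Qed.

Hypotheses (eta_ge0 : 0 <= eta)
  (u_le : forall i, (i <= n)%N -> dot (u i) (u i) <= eta ^+ 2)
  (stiff_u_le : stiff n h u u <= eta ^+ 2).

(** The scheme is solved for [d]; since [t] and [mid x t] are orthogonal, their squared lengths add
    up. The factor [k ^+ 2] leaves one power of [k] to spare against the damping. *)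
Let d_le i : (i <= n)%N -> dot (d i) (d i) <=
  2 * (kappa * k) ^+ 2 * (1 + alpha ^+ 2) * dot (t i) (t i) + 2 * eta ^+ 2.
Proof.
move=> iN; have -> : d i = (kappa * k) *: (t i - alpha *: cross (mid i) (t i))
    + cross (mid i) (u i).
  by rewrite -scheme//; apply/rowP => l; rewrite !mxE; ring.
apply: (le_trans (dotD_le _ _)); rewrite dotZl dotZr; apply: lerD; last first.
  rewrite ler_wpM2l//; apply: (le_trans (dot_cross_le _ _)).
  rewrite -[leRHS]mul1r; apply: ler_pM; rewrite ?dot_ge0//.
    exact: mid_le1.
  exact: u_le.
have -> : 2 * (kappa * k) ^+ 2 * (1 + alpha ^+ 2) * dot (t i) (t i) =
  2 * (kappa * k * (kappa * k * (dot (t i) (t i) + alpha ^+ 2 * dot (t i) (t i)))).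
  by ring.
rewrite !ler_pM2l ?mulr_gt0//.
have -> : dot (t i - alpha *: cross (mid i) (t i)) (t i - alpha *: cross (mid i) (t i))
  = dot (t i) (t i) + alpha ^+ 2 * dot (cross (mid i) (t i)) (cross (mid i) (t i)).
  have := dot_cross_self (t i) (mid i).
  have -> : cross (t i) (mid i) = - cross (mid i) (t i).
    by apply: rV3_ext; rewrite [RHS]mxE !coordE; ring.
  rewrite dotNl => /eqP; rewrite oppr_eq0 => /eqP H.
  by rewrite dotBl !dotBr !dotZl !dotZr H (dotC (t i)) H; ring.
rewrite lerD2l ler_pM2l ?exprn_gt0//.
apply: (le_trans (dot_cross_le _ _)); rewrite -[leRHS]mul1r.
by rewrite ler_wpM2r ?dot_ge0// mid_le1.
Qed.

(* The remainder of the noise term containing d is absorbed partly by stiff d d and,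
   through the Sobolev bound on d, partly by the damping; energy_eps is the weight
   of the Young inequality that makes both absorptions possible. *)
Definition energy_eps : R :=
  (32 * L + 8 * kappa * (1 + alpha ^+ 2) / (L * alpha))^-1.

(** 10 is 2 + 8, the Young constants of the two remainders absorbed by [stiff n h d d] alone; the
    other two terms come from the remainder that needs the supremum of [d]. *)
Definition energy_const : R := 10 + 8 * energy_eps + (8 * energy_eps)^-1.

Lemma midpoint_energy_step :
  stiff n h b b + 2^-1 * stiff n h d d
    + alpha * kappa * k * trap n h (fun i => dot (t i) (t i))
  <= stiff n h a a + 2 * torque_form n h a u a
    + energy_const * eta ^+ 2 * (1 + stiff n h a a).
Proof.
set X := stiff n h a a; set Y := stiff n h d d; set tau := trap n h _.
have X0 : 0 <= X by exact: stiff_ge0.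
have Y0 : 0 <= Y by exact: stiff_ge0.
have tau0 : 0 <= tau by apply: trap_ge0 => // i _; exact: dot_ge0.
have q0 : 0 <= 1 + alpha ^+ 2 by rewrite addr_ge0 ?sqr_ge0.
pose f := 8 * kappa * (1 + alpha ^+ 2) / (L * alpha).
have f0 : 0 <= f by rewrite /f !mulr_ge0 ?invr_ge0 ?mulr_ge0// ltW.
have e0 : 0 < energy_eps.
  by rewrite invr_gt0 ltr_pwDl ?mulr_gt0.
(* The two summands of the inverse of [energy_eps] serve separate absorptions: [32 * L] the one in
   [Y], [f] the one in the damping. *)
have eL : energy_eps * (32 * L) <= 1.
  by rewrite mulrC ler_pdivrMr ?ltr_pwDl ?mulr_gt0// mul1r lerDl.
have ef : energy_eps * f <= 1.
  by rewrite mulrC ler_pdivrMr ?ltr_pwDl ?mulr_gt0// mul1r lerDr ?mulr_ge0// ltW.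
move: midpoint_energy_identity; rewrite stiff_noise -/X -/Y -/tau => E.
set D := 2 / L * trap n h (fun i => dot (d i) (d i)) + 2 * L * Y.
have eta2 : 0 <= eta ^+ 2 by exact: sqr_ge0.
have td0 : 0 <= trap n h (fun i => dot (d i) (d i)).
  by apply: trap_ge0 => // i _; exact: dot_ge0.
have D0 : 0 <= D.
  by apply: addr_ge0; rewrite !mulr_ge0// ?invr_ge0 ltW.
(* The weights are such that, with the factor 2 of the energy identity, each of the three remainders
   costs an eighth of [Y]; half of [Y] is available. *)
have T1 : torque_form n h u d a <= 8^-1 * Y + eta ^+ 2 * X / (4 * 8^-1).
  apply: ler_weighted_AGM; rewrite ?mulr_ge0 ?invr_ge0//.
  by rewrite mulrCA mulrA; exact: torque_form_le.
have T2 : torque_form n h mid u d <= 16^-1 * Y + eta ^+ 2 / (4 * 16^-1).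
  apply: ler_weighted_AGM => //.
  rewrite mulrC; apply: (le_trans (torque_form_le h_gt0 _ _ ler01 mid_le1)).
  by rewrite mul1r ler_wpM2r.
have T3 : torque_form n h d u a <=
    2 * energy_eps * D + eta ^+ 2 * X / (4 * (2 * energy_eps)).
  apply: ler_weighted_AGM; rewrite ?mulr_ge0 ?mulr_gt0//.
  apply: (le_trans (torque_form_le h_gt0 _ _ D0 (fun i iN => dot_nodal_le h_gt0 _ iN sum_h L_gt0))).
  rewrite mulrA ler_wpM2r// ler_wpM2l//.
have td : trap n h (fun i => dot (d i) (d i)) <=
    2 * (kappa * k) ^+ 2 * (1 + alpha ^+ 2) * tau + 2 * eta ^+ 2 * L.
  apply: (le_trans (trap_le h_gt0 d_le)).
  by rewrite -sum_h -trap_cst -trapZ -trapD.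
have eD : energy_eps * D <= 2^-1 * (alpha * kappa * k * tau) + 4 * energy_eps * eta ^+ 2
    + 16^-1 * Y.
  rewrite mulrDr; apply: lerD; last first.
    have -> : energy_eps * (2 * L * Y) = 16^-1 * (energy_eps * (32 * L)) * Y by field.
    by rewrite ler_wpM2r// ger_pMr.
  apply: (@le_trans _ _ (energy_eps * (2 / L * (2 * (kappa * k) ^+ 2 *
      (1 + alpha ^+ 2) * tau + 2 * eta ^+ 2 * L)))).
    by rewrite ler_pM2l// ler_pM2l// divr_gt0.
  have -> : energy_eps * (2 / L * (2 * (kappa * k) ^+ 2 *
      (1 + alpha ^+ 2) * tau + 2 * eta ^+ 2 * L)) =
    2^-1 * (alpha * kappa * k * tau) * (energy_eps * f * k) + 4 * energy_eps * eta ^+ 2.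
    by rewrite /f; field; rewrite !gt_eqF.
  (* The bound on [d] carries [k ^+ 2], the damping only [k]; the surplus factor [k] is at most
     1. *)
  rewrite lerD2r; apply: ler_piMr.
    by rewrite !mulr_ge0// ltW.
  have ef0 : 0 <= energy_eps * f by rewrite mulr_ge0// ltW.
  by apply: mulr_ile1 => //; exact: ltW.
have T3' : 2^-1 * torque_form n h d u a <=
    energy_eps * D + eta ^+ 2 * X * (2^-1 * (8 * energy_eps)^-1).
  have -> : energy_eps * D + eta ^+ 2 * X * (2^-1 * (8 * energy_eps)^-1) =
    2^-1 * (2 * energy_eps * D + eta ^+ 2 * X / (4 * (2 * energy_eps))).
    by field; rewrite gt_eqF.
  by rewrite ler_pM2l.
have zX : 0 <= eta ^+ 2 * X by rewrite mulr_ge0.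
have ee : 0 <= energy_eps * eta ^+ 2 by rewrite mulr_ge0// ltW.
have eX : 0 <= energy_eps * (eta ^+ 2 * X) by rewrite mulr_ge0// ltW.
have ie : 0 <= (8 * energy_eps)^-1 * eta ^+ 2.
  by rewrite mulr_ge0// invr_ge0 mulr_ge0// ltW.
rewrite /energy_const; move: T1 T2 T3' eD E zX ee eX ie eta2.
move: (eta ^+ 2) ((8 * energy_eps)^-1) => e2 r T1 T2 T3' eD E zX ee eX ie eta2.
have -> : (10 + 8 * energy_eps + r) * e2 * (1 + X) = 10 * e2 + 10 * (e2 * X)
  + 8 * (energy_eps * e2) + 8 * (energy_eps * (e2 * X)) + r * e2 + e2 * X * r by ring.
lra.
Qed.
End midpoint_step.

(** * Piecewise affine functions *)

Section piecewise.
Context {R : realType}.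
Notation mu := (@lebesgue_measure R).

Lemma integral_affine (a b A B : R) : a < b ->
  (\int[mu]_(x in `[a, b]) (A + x * B)%:E =
   ((b - a) * (A + 2^-1 * (a + b) * B))%:E)%E.
Proof.
move=> ab.
have dF (x : R) : is_derive x (1 : R) (fun x : R => A * x + 2^-1 * B * x ^+ 2 : R) (A + x * B).
  by apply: is_derive_eq; rewrite /GRing.scale/=; field.
have cF : continuous (fun x : R => A * x + 2^-1 * B * x ^+ 2 : R).
  by move=> x; apply: differentiable_continuous; apply/derivable1_diffP; case: (dF x).
rewrite (@continuous_FTC2 _ _ (fun x => A * x + 2^-1 * B * x ^+ 2))//.
- by rewrite -EFinB; congr EFin; field.
- apply: continuous_subspaceT => x.
  by apply: cvgD; [exact: cvg_cst | apply: cvgM; [exact: cvg_id|exact: cvg_cst]].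
- split.
  + by move=> x _; case: (dF x).
  + exact/cvg_at_right_filter/cF.
  + exact/cvg_at_left_filter/cF.
- by move=> x _; rewrite derive1E; have [_ ->] := dF x.
Qed.

Lemma integral_affine_oo (f : R -> R) (a b A B : R) : a < b ->
  (forall x, a < x < b -> f x = A + x * B) ->
  measurable_fun `]a, b[ f /\
  (\int[mu]_(x in `]a, b[) (f x)%:E =
   ((b - a) * (A + 2^-1 * (a + b) * B))%:E)%E.
Proof.
move=> ab fE.
have mA (D : set R) : measurable_fun D (fun x : R => A + x * B).
  apply: (measurable_funS measurableT) => //.
  by apply: measurable_funD => //; exact: measurable_funM.
split.
  apply: (eq_measurable_fun (fun x : R => A + x * B)) => // x.
  by rewrite inE/= in_itv/= => /fE.
rewrite -integral_affine//.
rewrite -integral_itv_bndo_bndc; last by apply/measurable_EFinP; exact: mA.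
rewrite -integral_itv_obnd_cbnd; last by apply/measurable_EFinP; exact: mA.
by apply: eq_integral => x; rewrite inE/= in_itv/= => /fE ->.
Qed.

Variables (n : nat) (z : nat -> R).
Hypothesis z_lt : forall i, (i < n)%N -> z i < z i.+1.

Lemma node_le i j : (i <= j <= n)%N -> z i <= z j.
Proof.
move=> /andP[]; elim: j => [|j IH]; first by rewrite leqn0 => /eqP ->.
rewrite leq_eqVlt => /predU1P[->//|ij jn].
by apply: le_trans (IH ij (ltnW jn)) _; exact/ltW/z_lt.
Qed.

Lemma integral_mesh (f : R -> R) (m : nat) : (m <= n)%N ->
  (forall i, (i < n)%N -> measurable_fun `]z i, z i.+1[ f) ->
  measurable_fun `[z 0%N, z m[ f /\
  (\int[mu]_(x in `[z 0%N, z m[) (f x)%:E =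
   \sum_(i < m) \int[mu]_(x in `]z i, z i.+1[) (f x)%:E)%E.
Proof.
move=> mn mf; elim: m mn => [|m IH] mn.
  rewrite set_itvco0 big_ord0 integral_set0; split => //; exact: measurable_fun_set0.
have [mI eI] := IH (ltnW mn).
have mJ : measurable_fun `[z m, z m.+1[ f.
  by apply/measurable_fun_itv_obnd_cbndP; exact: mf.
have U : `[z 0%N, z m.+1[%classic = `[z 0%N, z m[ `|` `[z m, z m.+1[.
  by apply: itv_bndbnd_setU; rewrite bnd_simp node_le// ?leq0n ?leqnSn// ltnW.
have mU : measurable_fun (`[z 0%N, z m[ `|` `[z m, z m.+1[) f.
  by apply/measurable_funU => //; split.
split; first by rewrite U.
rewrite U integral_setU//=; last 2 first.
- exact/measurable_EFinP.
- apply/disj_setPS => x [] /=; rewrite !in_itv/= => /andP[_ xm] /andP[mx _].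
  by move: (lt_le_trans xm mx); rewrite ltxx.
rewrite big_ord_recr/= eI; congr (_ + _)%E.
by rewrite -integral_itv_obnd_cbnd//; apply/measurable_EFinP; exact: mf.
Qed.

(** [fl i] and [fr i] are the one-sided limits on element [i]. Keeping them separate allows jumps
    and arbitrary values at the nodes, so that the formula covers both continuous interpolants and
    piecewise constant derivatives. *)
Lemma integral_piecewise_affine (f : R -> R) (fl fr : nat -> R) :
  (forall i, (i < n)%N -> forall x, z i < x < z i.+1 ->
    f x = fl i + (x - z i) / (z i.+1 - z i) * (fr i - fl i)) ->
  measurable_fun `]z 0%N, z n[ f /\
  (\int[mu]_(x in `]z 0%N, z n[) (f x)%:E =
   (\sum_(i < n) (z i.+1 - z i) * (2^-1 * (fl i + fr i)))%:E)%E.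
Proof.
move=> fE.
have H i : (i < n)%N -> measurable_fun `]z i, z i.+1[ f /\
    (\int[mu]_(x in `]z i, z i.+1[) (f x)%:E =
     ((z i.+1 - z i) * (2^-1 * (fl i + fr i)))%:E)%E.
  move=> iN; have zi := z_lt iN.
  have zi0 : z i.+1 - z i != 0 by rewrite subr_eq0 gt_eqF.
  have [||mf ->] := @integral_affine_oo f (z i) (z i.+1)
      (fl i - z i / (z i.+1 - z i) * (fr i - fl i))
      ((fr i - fl i) / (z i.+1 - z i)) => //.
    by move=> x /(fE _ iN) ->; field.
  by split=> //; congr EFin; field.
have [mf fI] := integral_mesh (leqnn n) (fun i iN => (H i iN).1).
have mf' : measurable_fun `]z 0%N, z n[ f by apply/measurable_fun_itv_obnd_cbndP.
split=> //; rewrite integral_itv_obnd_cbnd ?fI; last exact/measurable_EFinP.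
by rewrite -sumEFin; apply: eq_bigr => i _; rewrite (H i _).2.
Qed.

End piecewise.

Section derivative.
Context {R : realType}.

Lemma derive1_locally_affine (V : normedModType R) (v : R -> V) (a b : R) (A B : V) (x : R) :
  a < x < b -> (forall y, a < y < b -> v y = A + y *: B) -> derive1 v x = B.
Proof.
move=> xab vE; rewrite /derive1; apply: cvg_lim => //.
apply: cvg_near_cst.
have /andP[ax xb] := xab.
have e0 : 0 < Num.min (x - a) (b - x) by rewrite lt_min !subr_gt0 ax.
near=> h.
have h0 : h != 0 by near: h; exact: nbhs_dnbhs_neq.
have he : `|h| < Num.min (x - a) (b - x).
  by near: h; apply: dnbhs0_lt.
rewrite !vE//; last first.
  move: he; rewrite lt_min => /andP[]; rewrite !ltr_norml => /andP[h1 h2] /andP[h3 h4].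
  by apply/andP; split; lra.
rewrite opprD addrACA subrr add0r -scalerBl addrK scalerA mulVf// scale1r//.
Unshelve. all: by end_near.
Qed.
End derivative.

(** * Lumped masses and the nodal discrete Laplacian *)

Section nodal_basis.
Context {R : realType}.
Variables (n : nat) (h : nat -> R).
Hypothesis n_gt0 : (0 < n)%N.
Hypothesis h_gt0 : forall i, (i < n)%N -> 0 < h i.

(** The integral of the hat function of node [i], the diagonal entry of the lumped mass matrix. *)
Definition nodal_mass (i : nat) : R := trap n h (fun j => (j == i)%:R).

Lemma nodal_mass_gt0 i : (i <= n)%N -> 0 < nodal_mass i.
Proof.
move=> iN; rewrite /nodal_mass /trap.
have pos (j : 'I_n) : true -> 0 <= h j * (2^-1 * (((j : nat) == i)%:R + (j.+1 == i)%:R)).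
  by move=> _; rewrite !mulr_ge0// ?addr_ge0// ltW// h_gt0.
have [e ei] : exists e : 'I_n, (e == i :> nat) || (e.+1 == i).
  case: (ltnP i n) => [lt_in|ni]; first by exists (Ordinal lt_in); rewrite eqxx.
  have e : (n.-1 < n)%N by rewrite prednK.
  by exists (Ordinal e); rewrite /= prednK// (eqP (_ : n == i)) ?eqxx ?orbT// eqn_leq ni.
rewrite lt_neqAle sumr_ge0// andbT eq_sym psumr_neq0//.
apply/hasP; exists e; rewrite ?mem_index_enum//=.
rewrite !mulr_gt0// ?h_gt0//.
by case/orP: ei => /eqP ->; rewrite eqxx; [rewrite ltr_pwDl|rewrite ltr_wpDl].
Qed.

Lemma stiff_sumr (m : nat) (v : nat -> 'rV[R]_3) (f : nat -> nat -> 'rV[R]_3) :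
  stiff n h v (fun j => \sum_(i < m) f i j) = \sum_(i < m) stiff n h v (f i).
Proof.
elim: m => [|m IH].
  rewrite big_ord0 /stiff big1// => i _.
  by rewrite !big_ord0 subr0 dotC dot0l mul0r.
rewrite big_ord_recr/= -IH -stiffDr; congr (stiff _ _ _ _).
by apply/funext => j /=; rewrite big_ord_recr.
Qed.

Lemma trap_sum (m : nat) (f : nat -> nat -> R) :
  trap n h (fun j => \sum_(i < m) f i j) = \sum_(i < m) trap n h (f i).
Proof.
elim: m => [|m IH].
  by rewrite big_ord0 /trap big1// => i _; rewrite !big_ord0 addr0 !mulr0.
rewrite big_ord_recr/= -IH -trapD; congr (trap _ _ _).
by apply/funext => j /=; rewrite big_ord_recr.
Qed.

Lemma trapE f : trap n h f = \sum_(i < n.+1) nodal_mass i * f i.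
Proof.
transitivity (trap n h (fun j => \sum_(i < n.+1) f i * (j == i :> nat)%:R)).
  apply: eq_trap => j jn; rewrite (bigD1 (Ordinal (jn : (j < n.+1)%N)))//=.
  rewrite eqxx mulr1 big1 ?addr0// => i; rewrite eq_sym -val_eqE/= => /negbTE ->.
  by rewrite mulr0.
rewrite (trap_sum n.+1 (fun i j => f i * (j == i)%:R)); apply: eq_bigr => i _.
by rewrite trapZ mulrC.
Qed.

Definition nodal_unit (i : nat) (c : 'I_3) (j : nat) : 'rV[R]_3 :=
  (j == i)%:R *: delta_mx 0 c.

Lemma dot_delta_mx (u : 'rV[R]_3) c : dot u (delta_mx 0 c) = u 0 c.
Proof.
rewrite /dot (bigD1 c)//= big1 ?addr0 ?mxE ?eqxx ?mulr1// => i ic.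
by rewrite mxE (negbTE ic) andbF mulr0.
Qed.

Definition nodal_laplacian (v : nat -> 'rV[R]_3) (i : nat) : 'rV[R]_3 :=
  \row_c (- stiff n h v (nodal_unit i c) / nodal_mass i).

Lemma nodal_laplacianP (v chi : nat -> 'rV[R]_3) :
  trap n h (fun i => dot (nodal_laplacian v i) (chi i)) = - stiff n h v chi.
Proof.
rewrite trapE.
(* The identity is linear in [chi], so it is enough to expand [chi] in nodal unit vectors. [inord]
   makes the summand a function of a natural number, as [stiff_sumr] expects. *)
have -> : stiff n h v chi = stiff n h v (fun j => \sum_(i < n.+1)
    \sum_(c < 3) chi i 0 (inord c) *: nodal_unit i (inord c) j).
  have E j : (j <= n)%N -> chi j = \sum_(i < n.+1)
    \sum_(c < 3) chi i 0 (inord c) *: nodal_unit i (inord c) j.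
    move=> jn; rewrite (bigD1 (Ordinal (jn : (j < n.+1)%N)))//= [X in _ + X]big1 ?addr0.
      rewrite [LHS]row_sum_delta; apply: eq_bigr => c _.
      by rewrite inord_val /nodal_unit eqxx scale1r.
    move=> i; rewrite eq_sym -val_eqE/= => /negbTE ij; rewrite big1// => c _.
    by rewrite /nodal_unit ij scale0r scaler0.
  by apply: eq_bigr => i _; rewrite -!E// ltnW.
rewrite (stiff_sumr n.+1 v
  (fun i j => \sum_(c < 3) chi i 0 (inord c) *: nodal_unit i (inord c) j)).
rewrite -sumrN; apply: eq_bigr => i _.
rewrite (stiff_sumr 3 v (fun c j => chi i 0 (inord c) *: nodal_unit i (inord c) j)).
rewrite /dot mulr_sumr -sumrN; apply: eq_bigr => c _.
have m0 : nodal_mass i != 0 by rewrite gt_eqF// nodal_mass_gt0// -ltnS.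
by rewrite stiffZr inord_val mxE; field.
Qed.

Lemma trap_nodal_unit (f : nat -> 'rV[R]_3) i c : (i <= n)%N ->
  trap n h (fun j => dot (f j) (nodal_unit i c j)) = nodal_mass i * f i 0 c.
Proof.
move=> iN; rewrite trapE (bigD1 (Ordinal (iN : (i < n.+1)%N)))//= big1 ?addr0.
  by rewrite /nodal_unit eqxx scale1r dot_delta_mx.
move=> j; rewrite -val_eqE/= => /negbTE ij.
by rewrite /nodal_unit ij scale0r dotC dot0l mulr0.
Qed.

(** Mass lumping makes the form diagonal with positive entries, so that testing reaches each node
    separately. This turns the variational scheme into an identity at every node. *)
Lemma eq_nodal (f g : nat -> 'rV[R]_3) :
  (forall chi, trap n h (fun i => dot (f i) (chi i)) =
    trap n h (fun i => dot (g i) (chi i))) ->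
  forall i, (i <= n)%N -> f i = g i.
Proof.
move=> fg i iN; apply/rowP => c; have := fg (nodal_unit i c).
rewrite !trap_nodal_unit// => /mulfI; apply.
by rewrite gt_eqF// nodal_mass_gt0.
Qed.

End nodal_basis.

(** * Finite element functions in terms of nodal values *)

Section mesh_functions.
Context {R : realType} (L : R) (L_gt0 : 0 < L) (Th : mesh L).
Notation n := (nelt Th).
Notation z := (node Th).
Notation h := (fun i : nat => node Th i.+1 - node Th i).

Lemma nelt_gt0 : (0 < n)%N.
Proof.
rewrite lt0n; apply/eqP => n0; have := node_last Th.
by rewrite n0 node_first => L0; move: L_gt0; rewrite -L0 ltxx.
Qed.

Lemma elt_gt0 i : (i < n)%N -> 0 < h i.
Proof. by move=> iN; rewrite subr_gt0 node_lt. Qed.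

Lemma sum_elt : \sum_(i < n) h i = L.
Proof.
by rewrite -(big_mkord xpredT h) telescope_sumr// node_last node_first subr0.
Qed.

Lemma node_in i : (i <= n)%N -> z i \in `[0, L].
Proof.
move=> iN; rewrite in_itv/=; apply/andP; split.
  by have := @node_le _ n z (@node_lt _ _ Th) 0%N i iN; rewrite node_first.
have := @node_le _ n z (@node_lt _ _ Th) i n.
by rewrite node_last; apply; rewrite iN leqnn.
Qed.

Lemma node_lt_lt i j : (i < j <= n)%N -> z i < z j.
Proof.
move=> /andP[ij jn]; apply: (lt_le_trans (node_lt (leq_trans ij jn))).
by rewrite (node_le (@node_lt _ _ Th))// ij.
Qed.

(** The element is closed, so [x] may be a node, where the definition of [hat] can select the
    formula of a neighbouring element; the case analysis checks that the formulas agree there. *)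
Lemma hatE i e x : (i <= n)%N -> (e < n)%N -> z e <= x <= z e.+1 ->
  hat Th i x = if i == e then (z e.+1 - x) / h e
               else if i == e.+1 then (x - z e) / h e else 0.
Proof.
move=> iN eN /andP[ex xe]; rewrite /hat.
have he : z e.+1 - z e != 0 by rewrite gt_eqF// (elt_gt0 eN).
case: ifPn => [/andP[i0 /andP[ix xi]]|].
  have [ie|ie] := eqVneq i e.
    subst i; have -> : x = z e by apply/eqP; rewrite eq_le xi.
    rewrite !divff// gt_eqF// subr_gt0 node_lt_lt// prednK ?leqnn//=; exact: ltnW.
  have [->//|ie1] := eqVneq i e.+1.
  case: (ltngtP i e) ie => // ie _.
    by have := lt_le_trans (node_lt_lt (introT andP (conj ie (ltnW eN)))) ex; rewrite ltNge xi.
  have e1 : (e.+1 < i)%N by rewrite ltn_neqAle eq_sym ie1.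
  have ei : (e.+1 <= i.-1)%N by rewrite -ltnS prednK.
  have h1 : z e.+1 <= z i.-1.
    by rewrite (node_le (@node_lt _ _ Th))// ei (leq_trans (leq_pred _)).
  have -> : x = z i.-1 by apply/eqP; rewrite eq_le ix (le_trans xe h1).
  by rewrite subrr mul0r.
rewrite negb_and -leqNgt leqn0 negb_and -!ltNge => H.
case: ifPn => [/andP[i1 /andP[ix xi]]|].
  have [->//|ie] := eqVneq i e.
  have [ie1|ie1] := eqVneq i e.+1.
    subst i; move: H => /= /orP[]; rewrite ltNge ?ex// => /negP.
    by rewrite xe.
  case: (ltngtP i e) ie => // ie _.
    have h1 : z i.+1 <= z e by rewrite (node_le (@node_lt _ _ Th))// ie ltnW.
    have -> : x = z i.+1 by apply/eqP; rewrite eq_le xi (le_trans h1 ex).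
    by rewrite subrr mul0r.
  have e1 : (e.+1 < i)%N by rewrite ltn_neqAle eq_sym ie1.
  have := lt_le_trans (node_lt_lt (introT andP (conj e1 iN))) ix.
  by rewrite ltNge xe.
have [->|ie] := eqVneq i e; first by rewrite eN ex xe.
have [ie1|//] := eqVneq i e.+1.
by subst i; move: H => /= /orP[]; rewrite ltNge ?ex// => /negP; rewrite xe.
Qed.

Lemma interpE (V : lmodType R) (u : R -> V) e x : (e < n)%N ->
  z e <= x <= z e.+1 ->
  interp Th u x = ((z e.+1 - x) / h e) *: u (z e) + ((x - z e) / h e) *: u (z e.+1).
Proof.
move=> eN ex; rewrite /interp.
rewrite (bigD1 (Ordinal (ltnW eN : (e < n.+1)%N)))//=.
rewrite (bigD1 (Ordinal (eN : (e.+1 < n.+1)%N)))/=; last by rewrite -val_eqE/= gtn_eqF.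
rewrite !(@hatE _ e)// ?eqxx; last exact: ltnW.
rewrite gtn_eqF// big1 ?addr0// => i; rewrite -!val_eqE/= => /andP[ie ie1].
have iN : (i <= n)%N by rewrite -ltnS.
by rewrite (hatE iN eN ex) (negbTE ie) (negbTE ie1) scale0r.
Qed.

Lemma interp_node (V : lmodType R) (u : R -> V) i : (i <= n)%N ->
  interp Th u (z i) = u (z i).
Proof.
rewrite leq_eqVlt => /predU1P[->|iN].
  have e : (n.-1 < n)%N by rewrite prednK// nelt_gt0.
  have E : z n = z n.-1.+1 by rewrite prednK// nelt_gt0.
  have hn : z n.-1.+1 - z n.-1 != 0 by rewrite gt_eqF// (elt_gt0 e).
  rewrite E (@interpE _ _ n.-1)//; last by rewrite lexx ltW// node_lt.
  by rewrite subrr mul0r scale0r add0r divff// scale1r.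
have hn : z i.+1 - z i != 0 by rewrite gt_eqF// (elt_gt0 iN).
rewrite (@interpE _ _ i)//; last by rewrite lexx ltW// node_lt.
by rewrite subrr mul0r scale0r addr0 divff// scale1r.
Qed.

Lemma interp_in_Vh (u : R -> 'rV[R]_3) : in_Vh Th (interp Th u).
Proof.
split; last first.
  move=> i iN; exists ((z i.+1 / h i) *: u (z i) - (z i / h i) *: u (z i.+1)).
  exists ((h i)^-1 *: (u (z i.+1) - u (z i))) => x; rewrite in_itv/= => xi.
  by rewrite (interpE u iN xi); apply/rowP => c; rewrite !mxE; ring.
have W m : (m <= n)%N -> {within `[z 0%N, z m], continuous (interp Th u)}.
  elim: m => [|m IH] mn.
    rewrite set_itv1; exact: continuous_subspace1.
  have -> : `[z 0%N, z m.+1]%classic = `[z 0%N, z m] `|` `[z m, z m.+1].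
    apply/seteqP; split => x /=; rewrite !in_itv/=.
      move=> /andP[zx xm]; have [xz|zmx] := leP x (z m); [left|right].
        by rewrite zx.
      by rewrite ltW.
    case=> /andP[x1 x2].
      by rewrite x1 (le_trans x2)//; exact/ltW/node_lt.
    rewrite x2 andbT (le_trans _ x1)// (node_le (@node_lt _ _ Th))// leq0n/=.
    exact: ltnW.
  apply: withinU_continuous; [exact: itv_closed|exact: itv_closed|exact/IH/ltnW|].
  have H : {within `[z m, z m.+1], continuous (fun x =>
     ((z m.+1 - x) / h m) *: u (z m) + ((x - z m) / h m) *: u (z m.+1))}.
    apply: continuous_subspaceT => x; apply: cvgD; apply: cvgZr_tmp; apply: cvgMr_tmp.
      by apply: cvgB; [exact: cvg_cst|exact: cvg_id].
    by apply: cvgB; [exact: cvg_id|exact: cvg_cst].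
  apply: subspace_eq_continuous H => x; rewrite inE/= in_itv/= => xm.
  exact/esym/(interpE u mn).
by have := W n (leqnn n); rewrite node_first node_last.
Qed.

Lemma hinnerE u v :
  hinner Th u v = trap n h (fun i => dot (u (z i)) (v (z i))).
Proof.
rewrite /hinner /Rintegral.
have -> : `]0, L[%classic = `]z 0%N, z n[%classic by rewrite node_first node_last.
have [|_ ->//] := @integral_piecewise_affine _ n z (@node_lt _ _ Th)
  (interp Th (fun y => dot (u y) (v y) : R^o))
  (fun i => dot (u (z i)) (v (z i))) (fun i => dot (u (z i.+1)) (v (z i.+1))).
move=> i iN x /andP[ix xi]; rewrite (@interpE _ _ i)//; last by rewrite !ltW.
have hn : z i.+1 - z i != 0 by rewrite gt_eqF// (elt_gt0 iN).
by rewrite /GRing.scale/=; field.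
Qed.

Lemma derive1_Vh v i x : in_Vh Th v -> (i < n)%N -> z i < x < z i.+1 ->
  derive1 v x = (h i)^-1 *: (v (z i.+1) - v (z i)).
Proof.
move=> [_ /(_ i)] /[swap] iN /(_ iN) [a [b ab]] xi.
have zi : z i < z i.+1 by rewrite node_lt.
rewrite !ab ?in_itv/= ?lexx ?ltW//.
rewrite opprD addrACA subrr add0r -scalerBl scalerA mulVf ?scale1r; last first.
  by rewrite gt_eqF// (elt_gt0 iN).
apply: (derive1_locally_affine xi (A := a)) => y /andP[y1 y2].
by rewrite ab// in_itv/= !ltW.
Qed.

Lemma L2inner_derive1 u v : in_Vh Th u -> in_Vh Th v ->
  L2inner L (derive1 u) (derive1 v) = stiff n h (u \o z) (v \o z).
Proof.
move=> Vu Vv; rewrite /L2inner /Rintegral.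
have -> : `]0, L[%classic = `]z 0%N, z n[%classic by rewrite node_first node_last.
pose c i := dot ((h i)^-1 *: (u (z i.+1) - u (z i))) ((h i)^-1 *: (v (z i.+1) - v (z i))).
have [|_ ->/=] := @integral_piecewise_affine _ n z (@node_lt _ _ Th)
  (fun x => dot (derive1 u x) (derive1 v x)) c c.
  by move=> i iN x xi; rewrite !(@derive1_Vh _ i)// subrr mulr0 addr0.
apply: eq_bigr => i _; rewrite /c dotZl dotZr/=.
have hn : z i.+1 - z i != 0 by rewrite gt_eqF// (elt_gt0 (ltn_ord i)).
by field.
Qed.

Lemma in_VhB u v : in_Vh Th u -> in_Vh Th v -> in_Vh Th (fun x => u x - v x).
Proof.
move=> [cu au] [cv av]; split; first by move=> x; apply: cvgB; [exact: cu|exact: cv].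
move=> i iN; have [a [b ab]] := au i iN; have [a' [b' ab']] := av i iN.
exists (a - a'), (b - b') => x xi; rewrite ab// ab'//.
by rewrite scalerBr opprD addrACA.
Qed.

(** A mere carrier of nodal values, zero off the nodes and not continuous; its interpolant is the
    member of V_h that gets used. *)
Definition nodal_lift (c : nat -> 'rV[R]_3) (x : R) : 'rV[R]_3 :=
  \sum_(i < n.+1) (x == z i)%:R *: c i.

Lemma nodal_liftE c i : (i <= n)%N -> nodal_lift c (z i) = c i.
Proof.
move=> iN; rewrite /nodal_lift (bigD1 (Ordinal (iN : (i < n.+1)%N)))//=.
rewrite eqxx scale1r big1 ?addr0// => j; rewrite -val_eqE/= => ji.
suff /negbTE -> : z i != z j by rewrite scale0r.
case: (ltngtP (j : nat) i) ji => // ij _.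
  by rewrite gt_eqF// node_lt_lt// ij.
by rewrite lt_eqF// node_lt_lt// ij -ltnS/=.
Qed.

(** The interpolant of the nodal Laplacian is a witness, so [xget] does not fall back on its default
    value. *)
Lemma discrete_laplacianP v : in_Vh Th v ->
  is_discrete_laplacian Th v (discrete_laplacian Th v).
Proof.
move=> Vv; rewrite /discrete_laplacian; case: xgetP => [w _ //|].
move=> /(_ (interp Th (nodal_lift (nodal_laplacian n h (v \o z))))) [].
split; first exact: interp_in_Vh.
move=> chi Vchi; rewrite hinnerE L2inner_derive1//.
rewrite -(nodal_laplacianP nelt_gt0 elt_gt0); apply: eq_trap => i iN.
by rewrite interp_node// nodal_liftE.
Qed.

(** The lumped product determines nodal values, so the choice made by [xget] disappears at the
    nodes. The explicit formula is also what makes the torque measurable in the outcome. *)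
Lemma discrete_laplacian_node v i : in_Vh Th v -> (i <= n)%N ->
  discrete_laplacian Th v (z i) = nodal_laplacian n h (v \o z) i.
Proof.
move=> Vv; have [Vw H] := discrete_laplacianP Vv.
apply: (eq_nodal nelt_gt0 elt_gt0 (f := discrete_laplacian Th v \o z)) => chi.
rewrite (nodal_laplacianP nelt_gt0 elt_gt0).
have := H (interp Th (nodal_lift chi)) (interp_in_Vh _).
rewrite hinnerE L2inner_derive1//; last exact: interp_in_Vh.
move=> E; transitivity (- stiff n h (v \o z) (interp Th (nodal_lift chi) \o z)).
  rewrite -E; apply: eq_trap => j jN /=.
  by rewrite interp_node// nodal_liftE.
congr (- _); apply: eq_bigr => j _ /=.
by rewrite !interp_node ?nodal_liftE// ltnW.
Qed.

End mesh_functions.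

(** * Smooth cut-off functions *)

Section smooth.
Context {R : realType}.
Implicit Types f g : R -> R.

(** The first derivative is peeled off, not the last one as in [derive1n]; closure under sums,
    products and affine substitutions is then a plain induction. *)
Fixpoint diff_upto (n : nat) f : Prop :=
  if n is n'.+1 then (forall x, derivable f x 1) /\ diff_upto n' (derive1 f)
  else True.

Lemma diff_uptoW n f : diff_upto n.+1 f -> diff_upto n f.
Proof.
by elim: n f => // n IH f [df [ddf d]]; split=> //; apply: IH; split.
Qed.

Lemma diff_upto_derivable f : (forall n, diff_upto n f) ->
  forall n x, derivable (derive1n n f) x 1.
Proof.
move=> Df n; elim: n f Df => [|n IH] f Df x; first exact: (Df 1%N).1.
by rewrite derive1Sn; apply: IH => m; exact: (Df m.+1).2.
Qed.

Lemma derive1_intro f df : (forall x : R, is_derive x (1 : R) (f : R -> R) (df x)) ->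
  (forall x, derivable f x 1) /\ derive1 f = df.
Proof.
move=> H; split; first by move=> x; case: (H x).
by apply/funext => x; rewrite derive1E; case: (H x).
Qed.

Lemma derivable1_is_derive f x : derivable f x 1 -> is_derive x (1 : R) f (derive1 f x).
Proof. by move=> df; rewrite derive1E; exact: DeriveDef. Qed.

Lemma diff_uptoD n f g : diff_upto n f -> diff_upto n g -> diff_upto n (f \+ g).
Proof.
elim: n f g => // n IH f g [df dfn] [dg dgn].
have H (x : R) : is_derive x (1 : R) (f \+ g) (derive1 f x + derive1 g x).
  by apply: is_deriveD; exact: derivable1_is_derive.
have [dH E] := derive1_intro H; split=> //.
by rewrite E; exact: IH.
Qed.

Lemma diff_uptoN n f : diff_upto n f -> diff_upto n (\- f).
Proof.
elim: n f => // n IH f [df dfn].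
have H (x : R) : is_derive x (1 : R) (\- f) (- derive1 f x).
  by apply: is_deriveN; exact: derivable1_is_derive.
have [dH E] := derive1_intro H; split=> //.
by rewrite E; exact: IH.
Qed.

Lemma diff_uptoM n f g : diff_upto n f -> diff_upto n g -> diff_upto n (f \* g).
Proof.
elim: n f g => // n IH f g Hf Hg.
have [df dfn] := Hf; have [dg dgn] := Hg.
have H (x : R) : is_derive x (1 : R) (f \* g) (f x * derive1 g x + g x * derive1 f x).
  by apply: is_deriveM; exact: derivable1_is_derive.
have [dH E] := derive1_intro H; split=> //.
rewrite E; apply: (@diff_uptoD n (f \* derive1 g) (g \* derive1 f)).
  by apply: IH => //; exact: diff_uptoW.
by apply: IH => //; exact: diff_uptoW.
Qed.

Lemma diff_upto_cst n (c : R) : diff_upto n (fun=> c).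
Proof.
elim: n c => // n IH c.
have H (x : R) : is_derive x (1 : R) (fun=> c) (0 : R) by exact: is_derive_cst.
by have [dH E] := derive1_intro H; split=> //; rewrite E.
Qed.

Lemma diff_upto_affine n f (s c : R) : diff_upto n f -> diff_upto n (fun x => f (s * x + c)).
Proof.
elim: n f => // n IH f [df dfn].
have H (x : R) : is_derive x (1 : R) (fun x => f (s * x + c)) (derive1 f (s * x + c) * s).
  apply: (@is_derive1_comp _ f (fun x => s * x + c)).
    exact: derivable1_is_derive.
  by apply: is_derive_eq; rewrite /GRing.scale/= addr0 mulr1.
have [dH E] := derive1_intro H; split=> //.
rewrite E; apply: (@diff_uptoM n (fun x => derive1 f (s * x + c)) (fun=> s)).
  exact: IH.
exact: diff_upto_cst.
Qed.

(* p(1/x) exp(-1/x): a family stable under differentiation. *)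
Definition flat (p : {poly R}) (x : R) : R :=
  if 0 < x then p.[x^-1] * expR (- x^-1) else 0.

(** The decay [y ^- 2] is what differentiability of [flat p] at 0 requires: with [y] the inverse of
    x it reads |flat p x| <= C x^2. Each monomial is dominated by a single term of the exponential
    series. *)
Lemma poly_expR_bound (p : {poly R}) :
  exists2 C : R, 0 <= C & forall y : R, 0 < y -> `|p.[y] * expR (- y)| <= C / y ^+ 2.
Proof.
have mono i (y : R) : 0 < y -> y ^+ i * expR (- y) <= (i.+2)`!%:R / y ^+ 2.
  move=> y0; rewrite ler_pdivlMr ?exprn_gt0// mulrAC -exprD addn2.
  have f0 : (0 : R) < (i.+2)`!%:R by rewrite ltr0n fact_gt0.
  rewrite expRN ler_pdivrMr ?expR_gt0// -ler_pdivrMl// mulrC.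
  apply: le_trans (expR_ge1Dxn i.+1 (ltW y0)); first by rewrite lerDr.
exists (\sum_(i < size p) `|p`_i| * (i.+2)`!%:R).
  by apply: sumr_ge0 => i _; rewrite mulr_ge0.
move=> y y0; rewrite horner_coef !mulr_suml; apply: (le_trans (ler_norm_sum _ _ _)).
apply: ler_sum => i _; rewrite -!mulrA normrM ler_wpM2l//.
by rewrite ger0_norm ?mono// mulr_ge0 ?expR_ge0// exprn_ge0// ltW.
Qed.

Lemma flat_is_derive p (x : R) :
  is_derive x (1 : R) (flat p) (flat ('X^2 * (p - p^`())) x).
Proof.
have [x0|x0|->] := ltgtP x 0.
- rewrite /flat ltNge (ltW x0)/=.
  apply: (@near_eq_is_derive _ _ _ (fun=> 0 : R)).
  near=> y; rewrite /flat ltNge ltW//.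
  by near: y; exact: lt_nbhsl.
- rewrite /flat x0.
  apply: (@near_eq_is_derive _ _ _ (fun y : R => p.[y^-1] * expR (- y^-1))).
    near=> y; suff -> : 0 < y by [].
    by near: y; exact: lt_nbhsr.
  have dV : is_derive x (1 : R) (fun y : R => y^-1) (- x ^- 2 *: 1 : R).
    by apply: is_deriveV; rewrite gt_eqF.
  have d1 : is_derive x (1 : R) (fun y => p.[y^-1]) (p^`().[x^-1] * (- x ^- 2 *: 1)).
    exact: (@is_derive1_comp _ (horner p) (fun y : R => y^-1)).
  have d2 : is_derive x (1 : R) (fun y : R => expR (- y^-1)) (expR (- x^-1) * (- (- x ^- 2 *: 1))).
    exact: (@is_derive1_comp _ expR (fun y : R => - y^-1)).
  have E : ('X^2 * (p - p^`())).[x^-1] = x^-1 ^+ 2 * (p.[x^-1] - p^`().[x^-1]).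
    by rewrite !hornerE.
  apply: is_derive_eq; rewrite /GRing.scale/= E; field.
  by rewrite gt_eqF.
- rewrite {2}/flat ltxx.
  have [C C0 bC] := poly_expR_bound p.
  have H : h^-1 *: (flat p (h *: 1 + 0) - flat p 0) @[h --> (0:R)^'] --> (0 : R).
    have E : (fun h : R => C * `|h|) @ (0:R)^' --> (0 : R).
      rewrite -[X in _ --> X](mulr0 C) -[X in _ * X](normr0 R).
      apply: cvgMl_tmp; apply: cvg_within_filter; apply: cvg_norm; exact: cvg_id.
    apply/cvgr0Pnorm_le => e e0.
    move/cvgr0Pnorm_le : E => /(_ e e0); apply: filterS => h.
    rewrite (ger0_norm (mulr_ge0 C0 (normr_ge0 h))) => /(le_trans _); apply.
    rewrite addr0 /flat ltxx subr0 /GRing.scale/= mulr1.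
    case: ifPn => h0; last by rewrite mulr0 normr0 mulr_ge0.
    have := bC h^-1; rewrite invr_gt0 => /(_ h0) B.
    rewrite normrM (ger0_norm (_ : 0 <= h^-1)) ?invr_ge0; last exact: ltW.
    rewrite (gtr0_norm h0) ler_pdivrMl//; apply: (le_trans B).
    rewrite le_eqVlt; apply/orP; left; apply/eqP; field.
    by rewrite gt_eqF.
  apply: DeriveDef; first by apply/cvg_ex; exists 0.
  exact/cvg_lim.
Unshelve. all: by end_near. Qed.

Lemma diff_upto_flat n p : diff_upto n (flat p).
Proof.
elim: n p => // n IH p.
by have [dH E] := derive1_intro (flat_is_derive p); split=> //; rewrite E.
Qed.

Definition cbump (a b x : R) : R := flat 1 (x - a) * flat 1 (b - x).

Lemma flat1_ge0 x : 0 <= flat 1 x.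
Proof. by rewrite /flat; case: ifP => // _; rewrite hornerE mul1r expR_ge0. Qed.

Lemma flat1_gt0 x : 0 < x -> 0 < flat 1 x.
Proof. by move=> x0; rewrite /flat x0 hornerE mul1r expR_gt0. Qed.

Lemma cbump_ge0 a b x : 0 <= cbump a b x.
Proof. by rewrite mulr_ge0 ?flat1_ge0. Qed.

Lemma cbump_gt0 a b x : a < x < b -> 0 < cbump a b x.
Proof. by move=> /andP[ax xb]; rewrite mulr_gt0 ?flat1_gt0 ?subr_gt0. Qed.

Lemma cbump_eq0 a b x : ~~ (a < x < b) -> cbump a b x = 0.
Proof.
rewrite negb_and -!leNgt /cbump /flat => /orP[] H.
  by rewrite subr_gt0 ltNge H mul0r.
by rewrite !subr_gt0 [x < b]ltNge H mulr0.
Qed.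

Lemma diff_upto_cbump n a b : diff_upto n (cbump a b).
Proof.
have -> : cbump a b = (fun x => flat 1 (1 * x + (- a))) \* (fun x => flat 1 (-1 * x + b)).
  apply/funext => x; rewrite /cbump/= mul1r mulN1r.
  by congr (_ * flat 1 _); rewrite addrC.
by apply: diff_uptoM; apply: diff_upto_affine; exact: diff_upto_flat.
Qed.

Lemma continuous_cbump a b : continuous (cbump a b).
Proof.
move=> x; apply: differentiable_continuous; apply/derivable1_diffP.
exact: (diff_upto_cbump 1 a b).1.
Qed.

End smooth.

(** * Mollifiers and smooth steps *)

Section mollifier.
Context {R : realType}.
Notation mu := (@lebesgue_measure R).

Lemma integrable_continuous_itv (f : R -> R) (a b : R) :
  {within `[a, b], continuous f} -> mu.-integrable `[a, b] (EFin \o f).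
Proof. by move=> cf; apply: continuous_compact_integrable => //; exact: segment_compact. Qed.

Lemma integrable_cbump (D : set R) (a b : R) : measurable D ->
  mu.-integrable D (EFin \o cbump a b).
Proof.
move=> mD; apply: (@integrableS _ _ _ _ setT) => //.
have -> : EFin \o cbump a b = (EFin \o cbump a b) \_ `[a, b].
  apply/funext => x; rewrite patchE; case: ifPn => //.
  rewrite notin_setE/= in_itv/= => H.
  rewrite cbump_eq0//; apply: contra_notN H => /andP[ax xb].
  by rewrite !ltW.
apply: (integrable_mkcond _ _).1 => //.
by apply: integrable_continuous_itv; apply: continuous_subspaceT; exact: continuous_cbump.
Qed.

(** A vanishing integral would make the nonnegative bump zero almost everywhere, against its
    positivity on an interval of positive measure. *)
Lemma cbump_integral_gt0 (a b : R) : a < b -> 0 < \int[mu]_x cbump a b x.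
Proof.
move=> ab; rewrite lt_neqAle Rintegral_ge0 ?andbT; last by move=> x _; exact: cbump_ge0.
apply/eqP => /esym I0.
have ib := integrable_cbump a b measurableT.
have I1 : (\int[mu]_(x in setT) `|(EFin \o cbump a b) x| = 0)%E.
  under eq_integral => x _ do rewrite /= ger0_norm ?cbump_ge0//.
  rewrite -[LHS]fineK; first by rewrite -/(Rintegral _ _ _) I0.
  exact: (integrable_fin_num measurableT ib).
have := (ae_eq_integral_abs mu measurableT (measurable_int _ ib)).1 I1.
move=> [N [mN N0 HN]].
have : (mu `]a, b[ <= mu N)%E.
  apply: le_measure; rewrite ?inE// => x /=; rewrite in_itv/= => xab.
  apply: HN => /= /(_ Logic.I) [H].
  by have := cbump_gt0 xab; rewrite H ltxx.
rewrite N0 lebesgue_measure_itv/= lte_fin ab leNgt => /negP; apply.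
by rewrite -EFinD lte_fin subr_gt0.
Qed.

Definition moll (a b x : R) : R := (\int[mu]_x cbump a b x)^-1 * cbump a b x.

Definition mollstep (a b x : R) : R := \int[mu]_(t in `]-oo, x]) moll a b t.

Variables (a b : R).
Hypothesis ab : a < b.

Lemma moll_ge0 x : 0 <= moll a b x.
Proof. by rewrite mulr_ge0 ?cbump_ge0// invr_ge0 ltW// cbump_integral_gt0. Qed.

Lemma moll_eq0 x : ~~ (a < x < b) -> moll a b x = 0.
Proof. by move=> H; rewrite /moll cbump_eq0// mulr0. Qed.

Lemma continuous_moll : continuous (moll a b).
Proof. by move=> x; apply: cvgMl_tmp; exact: continuous_cbump. Qed.

Lemma diff_upto_moll n : diff_upto n (moll a b).
Proof.
apply: (@diff_uptoM _ n (fun=> _) (cbump a b)); first exact: diff_upto_cst.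
exact: diff_upto_cbump.
Qed.

Lemma integrable_moll (D : set R) : measurable D -> mu.-integrable D (EFin \o moll a b).
Proof.
by move=> mD; apply: (integrableZl _ (\int[mu]_x cbump a b x)^-1 (integrable_cbump a b mD)).
Qed.

Lemma integral_moll (D : set R) : measurable D -> `]a, b[ `<=` D ->
  \int[mu]_(x in D) moll a b x = 1.
Proof.
move=> mD abD.
transitivity (\int[mu]_x moll a b x).
  rewrite Rintegral_mkcond; apply: eq_Rintegral => x _.
  rewrite patchE; case: ifPn => //; rewrite notin_setE => H.
  by rewrite moll_eq0//; apply: contra_notN H => H; apply: abD; rewrite /= in_itv.
rewrite /moll RintegralZl//; last exact: integrable_cbump.
by rewrite mulVf// gt_eqF// cbump_integral_gt0.
Qed.

Lemma mollstep_derive (x : R) : is_derive x (1 : R) (mollstep a b) (moll a b x).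
Proof.
have xx : x < x + 1 by rewrite ltrDl.
have xy : (-oo < x%:E)%E by exact: ltNyr.
have := @continuous_FTC1 R (moll a b) -oo%O x (x + 1) xx
  (integrable_moll (measurable_itv _)) xy (@continuous_moll x).
case=> dF FE; rewrite -FE derive1E; exact: DeriveDef.
Qed.

Lemma diff_upto_mollstep n : diff_upto n (mollstep a b).
Proof.
case: n => // n; have [dH E] := derive1_intro mollstep_derive.
by split=> //; rewrite E; exact: diff_upto_moll.
Qed.

Lemma mollstep_left x : x <= a -> mollstep a b x = 0.
Proof.
move=> xa; rewrite /mollstep; transitivity (\int[mu]_(t in `]-oo, x]) (0 : R)).
  apply: eq_Rintegral => t; rewrite inE/= in_itv/= => tx.
  by rewrite moll_eq0// negb_and -leNgt (le_trans tx xa).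
by rewrite Rintegral_cst// mul0r.
Qed.

Lemma mollstep_right x : b <= x -> mollstep a b x = 1.
Proof.
move=> bx; apply: integral_moll => // t /=; rewrite !in_itv/= => /andP[_ tb].
by rewrite ltW// (lt_le_trans tb).
Qed.

Lemma mollstep_itv x : 0 <= mollstep a b x <= 1.
Proof.
rewrite Rintegral_ge0 => [|t _]; last exact: moll_ge0.
rewrite -(@integral_moll setT)// /mollstep Rintegral_mkcond.
apply: le_Rintegral => //.
- have -> : EFin \o (moll a b \_ `]-oo, x]) = (EFin \o moll a b) \_ `]-oo, x].
    by apply/funext => t /=; rewrite !patchE/=; case: ifP.
  by apply: (integrable_mkcond _ _).1 => //; exact: integrable_moll.
- exact: integrable_moll.
by move=> t _; rewrite patchE; case: ifP => // _; exact: moll_ge0.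
Qed.

End mollifier.

(** * Nodal values of Sobolev functions *)

Section real_integrable.
Context d {T : measurableType d} {R : realType} (mu : {measure set T -> \bar R}).
Variables (D : set T) (mD : measurable D).
Implicit Types f g : T -> R.

Lemma integrable_realD f g : mu.-integrable D (EFin \o f) ->
  mu.-integrable D (EFin \o g) -> mu.-integrable D (EFin \o (fun x => f x + g x)).
Proof.
move=> fi gi; have := integrableD mD fi gi.
by apply: eq_integrable => // x _ /=; rewrite EFinD.
Qed.

Lemma integrable_realB f g : mu.-integrable D (EFin \o f) ->
  mu.-integrable D (EFin \o g) -> mu.-integrable D (EFin \o (fun x => f x - g x)).
Proof.
move=> fi gi; have := integrableB mD fi gi.
by apply: eq_integrable => // x _ /=; rewrite EFinB.
Qed.

Lemma integrable_realZ c f : mu.-integrable D (EFin \o f) ->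
  mu.-integrable D (EFin \o (fun x => c * f x)).
Proof.
move=> fi; have := integrableZl mD c fi.
by apply: eq_integrable => // x _ /=; rewrite EFinM.
Qed.

Lemma integrable_real_norm f : mu.-integrable D (EFin \o f) ->
  mu.-integrable D (EFin \o (fun x => `|f x|)).
Proof. exact: integrable_abse. Qed.

End real_integrable.

Section sobolev.
Context {R : realType} (L : R) (L_gt0 : 0 < L).
Notation mu := (@lebesgue_measure R).

Lemma within_itv_continuous_near (G : R -> R) (c e : R) : {within `[0, L], continuous G} ->
  c \in `[0, L] -> 0 < e ->
  exists2 r : R, 0 < r & forall x, x \in `[0, L] -> `|x - c| < r -> `|G x - G c| <= e.
Proof.
move=> /subspace_continuousP cG cL e0; have := cG c cL.
move=> /cvgr_dist_le /(_ e e0) /nbhs_ballP[r /= r0 H]; exists r => // x xL xc.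
by rewrite distrC; apply: H => //=; rewrite /ball/= distrC.
Qed.

(** [g0] is not tied to []a, b[]: it will be the value of [G] at a nearby point outside this
    interval. *)
Lemma moll_approx (G : R -> R) (g0 a b e : R) : {within `[0, L], continuous G} ->
  0 <= a -> a < b -> b <= L -> 0 <= e ->
  (forall x, a < x < b -> `|G x - g0| <= e) ->
  mu.-integrable `]0, L[ (EFin \o (fun x => G x * moll a b x)) /\
  `|\int[mu]_(x in `]0, L[) (G x * moll a b x) - g0| <= e.
Proof.
move=> cG a0 ab bL e0 H.
have mL : measurable (`]0, L[%classic : set R) by exact: measurable_itv.
have iG : mu.-integrable `]0, L[ (EFin \o (fun x => G x * moll a b x)).
  apply: (@integrableS _ _ _ mu `[0, L]%classic) => //; first exact: subset_itv_oo_cc.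
  have cm : {within `[0, L], continuous (moll a b)}.
    by apply: continuous_subspaceT; exact: continuous_moll.
  by apply: integrable_continuous_itv => x; apply: cvgM; [exact: cG|exact: cm].
have im := integrable_moll a b mL.
split=> //.
have I1 : \int[mu]_(x in `]0, L[) moll a b x = 1.
  apply: integral_moll => // x /=; rewrite !in_itv/= => /andP[ax xb].
  by rewrite (le_lt_trans a0)// (lt_le_trans xb).
have ic (c : R) : mu.-integrable `]0, L[ (EFin \o (fun x => c * moll a b x)).
  exact: integrable_realZ.
have -> : \int[mu]_(x in `]0, L[) (G x * moll a b x) - g0 =
    \int[mu]_(x in `]0, L[) (G x * moll a b x - g0 * moll a b x).
  by rewrite RintegralB// RintegralZl// I1 mulr1.
apply: (le_trans (le_normr_Rintegral _ _)) => //.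
  exact: integrable_realB.
rewrite -[leRHS]mulr1 -I1 -RintegralZl//; apply: le_Rintegral => //.
  by apply: integrable_real_norm; exact: integrable_realB.
move=> x _; rewrite -mulrBl normrM (ger0_norm (moll_ge0 ab x)).
have [xab|/(moll_eq0) ->] := boolP (a < x < b); last by rewrite !mulr0.
by rewrite ler_wpM2r ?moll_ge0// H.
Qed.

Lemma ler_of_weighted (x A Q : R) : 0 < A -> 0 <= Q -> 0 <= x ->
  (forall l, 0 < l -> x <= (l * A + Q / l) / 2) -> x ^+ 2 <= A * Q.
Proof.
move=> A0 Q0; rewrite le_eqVlt => /predU1P[<- _|x0 H].
  by rewrite expr0n/= mulr_ge0// ltW.
(* In the case of equality this is the weight that minimizes the bound. *)
have := H (x / A) (divr_gt0 x0 A0).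
have -> : (x / A * A + Q / (x / A)) / 2 = (x ^+ 2 + A * Q) / x / 2.
  by field; rewrite !gt_eqF.
rewrite ler_pdivlMr// ler_pdivlMr// expr2; lra.
Qed.

(* Test with the antiderivative of the difference of two mollifiers concentrated near
   a and near b. Young's inequality with a free weight l stands in for
   Cauchy-Schwarz, which is recovered by optimizing over l. *)
Lemma weak_derivative_increment (G V : R -> R) (a b l : R) :
  {within `[0, L], continuous G} ->
  measurable_fun `]0, L[ V -> mu.-integrable `]0, L[ (EFin \o (fun x => V x ^+ 2)) ->
  (forall phi, test_function L phi ->
    \int[mu]_(x in `]0, L[) (G x * derive1 phi x) =
    - \int[mu]_(x in `]0, L[) (V x * phi x)) ->
  0 <= a -> a < b -> b <= L -> 0 < l ->
  `|G b - G a| <= (l * (b - a) + (\int[mu]_(x in `]a, b[) V x ^+ 2) / l) / 2.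
Proof.
move=> cG mV iV wV a0 ab bL l0; apply/ler_addgt0Pl => e e0.
have e2 : 0 < e / 2 by rewrite divr_gt0.
have aL : a \in `[0, L] by rewrite in_itv/= a0 (le_trans (ltW ab)).
have bL' : b \in `[0, L] by rewrite in_itv/= bL (le_trans a0)// ltW.
have [ra ra0 Ha] := within_itv_continuous_near cG aL e2.
have [rb rb0 Hb] := within_itv_continuous_near cG bL' e2.
(* The denominator leaves room for a + d < a + 2d < b - 2d < b - d, with each mollifier inside the
   continuity radius of its end point. *)
pose d := Num.min (Num.min ra rb) (b - a) / 8.
have d0 : 0 < d by rewrite divr_gt0// !lt_min ra0 rb0 subr_gt0.
have da : 8 * d <= ra.
  by rewrite /d mulrC divfK// !ge_min lexx.
have db : 8 * d <= rb.
  by rewrite /d mulrC divfK// !ge_min lexx orbT.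
have dab : 8 * d <= b - a.
  by rewrite /d mulrC divfK// ge_min lexx orbT.
pose a1 := a + d; pose a2 := a + 2 * d; pose b1 := b - 2 * d; pose b2 := b - d.
have a12 : a1 < a2 by rewrite /a1 /a2; lra.
have b12 : b1 < b2 by rewrite /b1 /b2; lra.
pose phi := mollstep a1 a2 \- mollstep b1 b2.
have dphi : derive1 phi = moll a1 a2 \- moll b1 b2.
  apply: (derive1_intro _).2 => x; apply: is_deriveB; exact: mollstep_derive.
have supp x : ~~ (a < x < b) -> phi x = 0.
  rewrite negb_and -!leNgt => /orP[] H; rewrite /phi/=.
    by rewrite !mollstep_left ?subrr// /a1 /b1; lra.
  by rewrite !mollstep_right ?subrr// /a2 /b2; lra.
have tphi : test_function L phi.
  split.
    apply: diff_upto_derivable => n; apply: diff_uptoD; last apply: diff_uptoN;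
      exact: diff_upto_mollstep.
  exists a1, b2; split; [rewrite /a1; lra|rewrite /b2; lra|move=> x].
  apply: contra_neqT; rewrite in_itv/= negb_and -!ltNge => /orP[] /ltW H; rewrite /phi/=.
    by rewrite !mollstep_left ?subrr// (le_trans H)// /a1 /b1; lra.
  by rewrite !mollstep_right ?subrr// (le_trans _ H)// /a2 /b2; lra.
have phi1 x : `|phi x| <= 1.
  have /andP[h1 h2] := mollstep_itv a12 x; have /andP[h3 h4] := mollstep_itv b12 x.
  rewrite ler_norml /phi/=; move: h1 h2 h3 h4; clear.
  by move: (mollstep _ _ _) (mollstep _ _ _) => s t *; apply/andP; split; lra.
have mL : measurable (`]0, L[%classic : set R) by exact: measurable_itv.
have [a1_0 b2L] : 0 <= a1 /\ b2 <= L.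
  by move: a0 bL d0; rewrite /a1 /b2; clear => *; split; lra.
have [a2L b1_0] : a2 <= L /\ 0 <= b1.
  by move: a0 bL d0 dab; rewrite /a2 /b1; clear => *; split; lra.
have [|iGa Ea] := moll_approx cG a1_0 a12 a2L (ltW e2) (g0 := G a).
  move=> x; rewrite /a1 /a2 => xab; apply: Ha; rewrite ?in_itv/= ?ltr_norml;
    by move: xab d0 da dab a0 bL; clear => /andP[] *; apply/andP; split; lra.
have [|iGb Eb] := moll_approx cG b1_0 b12 b2L (ltW e2) (g0 := G b).
  move=> x; rewrite /b1 /b2 => xab; apply: Hb; rewrite ?in_itv/= ?ltr_norml;
    by move: xab d0 db dab a0 bL; clear => /andP[] *; apply/andP; split; lra.
have := wV phi tphi; rewrite dphi.
under eq_Rintegral => x _ do rewrite mulrBr.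
rewrite RintegralB// => E.
pose Y x := (l + V x ^+ 2 / l) / 2.
have sub : `]a, b[ `<=` `]0, L[.
  move=> x /=; rewrite !in_itv/= => /andP[ax xb].
  by rewrite (le_lt_trans a0)// (lt_le_trans xb).
have ic (c : R) (D : set R) : measurable D -> D `<=` `]0, L[ ->
    mu.-integrable D (EFin \o (fun=> c)).
  move=> mD DL; apply: (@integrableS _ _ _ mu `[0, L]%classic) => //.
    by apply: (subset_trans DL); exact: subset_itv_oo_cc.
  by apply: integrable_continuous_itv => x; exact: cvg_cst.
have iVab : mu.-integrable `]a, b[ (EFin \o (fun x => V x ^+ 2)).
  by apply: integrableS iV.
have iY (D : set R) : measurable D -> D `<=` `]0, L[ -> mu.-integrable D (EFin \o Y).
  move=> mD DL; have -> : Y = (fun x => 2^-1 * (l + l^-1 * V x ^+ 2)).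
    by apply/funext => x; rewrite /Y; ring.
  apply: integrable_realZ => //; apply: integrable_realD => //; first exact: ic.
  by apply: integrable_realZ => //; exact: integrableS iV.
have iYp : mu.-integrable `]0, L[ (EFin \o (Y \_ `]a, b[)).
  have -> : EFin \o (Y \_ `]a, b[) = (EFin \o Y) \_ `]a, b[.
    by apply/funext => t /=; rewrite !patchE/=; case: ifP.
  apply: (@integrableS _ _ _ _ setT) => //.
  by apply: (integrable_mkcond _ _).1 => //; exact: iY.
have Y0 x : 0 <= Y x by rewrite /Y divr_ge0// addr_ge0 ?divr_ge0 ?sqr_ge0// ltW.
have bound x : `|V x * phi x| <= (Y \_ `]a, b[) x.
  rewrite patchE; case: ifPn => [_|]; last first.
    by rewrite notin_setE/= in_itv/= => /negP H; rewrite supp ?mulr0 ?normr0.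
  rewrite normrM; apply: (@le_trans _ _ `|V x|); first by rewrite ler_piMr.
  have -> : Y x = (l + `|V x| ^+ 2 / l) / 2 by rewrite /Y real_normK ?num_real.
  have := sqr_ge0 (l - `|V x|); move: (`|V x|) => y; move: l0; clear => l0 H.
  rewrite ler_pdivlMr// -(ler_pM2r l0) mulrDl divfK ?gt_eqF//; lra.
have cstep u v : continuous (mollstep u v : R -> R).
  move=> x; apply: differentiable_continuous; apply/derivable1_diffP.
  by have [] := mollstep_derive u v x.
have cphi : continuous phi by move=> x; apply: cvgB; exact: cstep.
have mphi : measurable_fun `]0, L[ phi.
  by apply: (measurable_funS measurableT) => //; exact: continuous_measurable_fun.
have iVp : mu.-integrable `]0, L[ (EFin \o (fun x => V x * phi x)).
  apply: le_integrable iYp => //; first by apply/measurable_EFinP; exact: measurable_funM.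
  by move=> x _ /=; rewrite lee_fin (le_trans (bound x))// ler_norm.
have IV : `|\int[mu]_(x in `]0, L[) (V x * phi x)| <=
   (l * (b - a) + (\int[mu]_(x in `]a, b[) V x ^+ 2) / l) / 2.
  apply: (le_trans (le_normr_Rintegral _ _)) => //.
  apply: (@le_trans _ _ (\int[mu]_(x in `]0, L[) (Y \_ `]a, b[) x)).
    apply: le_Rintegral => //.
    exact: integrable_real_norm.
  rewrite -Rintegral_mkcondr setIidr// /Y le_eqVlt; apply/orP; left; apply/eqP.
  have mab : measurable (`]a, b[%classic : set R) by exact: measurable_itv.
  have iVl := @integrable_realZ _ _ _ mu _ mab l^-1 _ iVab.
  have icl := ic l _ mab sub.
  transitivity (\int[mu]_(x in `]a, b[) (2^-1 * (l + l^-1 * V x ^+ 2))).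
    by apply: eq_Rintegral => x _; ring.
  rewrite RintegralZl//; last exact: integrable_realD.
  rewrite RintegralD// Rintegral_cst// RintegralZl//.
  have mu_ab : fine (mu `]a, b[%classic) = b - a by rewrite lebesgue_measure_itv/= lte_fin ab.
  rewrite [fine _](mu_ab); ring.
have : \int[mu]_(x in `]0, L[) (G x * moll a1 a2 x) -
  \int[mu]_(x in `]0, L[) (G x * moll b1 b2 x) =
  - \int[mu]_(x in `]0, L[) (V x * phi x) by [].
move: IV Ea Eb; rewrite !ler_norml; move: (\int[mu]_(x in _) (V x * phi x)).
move: (\int[mu]_(x in _) (G x * moll a1 a2 x)) (\int[mu]_(x in _) (G x * moll b1 b2 x)).
move: ((_ + _) / 2) => r x y w; clear.
by move=> /andP[? ?] /andP[? ?] /andP[? ?] ?; apply/andP; split; lra.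
Qed.
End sobolev.

Section sobolev_vector.
Context {R : realType} (L : R) (L_gt0 : 0 < L).
Notation mu := (@lebesgue_measure R).
Implicit Types u v g : R -> 'rV[R]_3.

Let mL : measurable (`]0, L[%classic : set R). Proof. exact: measurable_itv. Qed.

Lemma coord_sqr_le_dot (w : 'rV[R]_3) c : w 0 c ^+ 2 <= dot w w.
Proof.
rewrite /dot (bigD1 c)//= -expr2 lerDl; apply: sumr_ge0 => i _.
by rewrite -expr2 sqr_ge0.
Qed.

Lemma measurable_dot u (D : set R) : (forall c : 'I_3, measurable_fun D (fun x => u x 0 c)) ->
  measurable_fun D (fun x => dot (u x) (u x)).
Proof.
move=> mu_; rewrite /dot; apply: measurable_sum => i.
by apply: measurable_funM.
Qed.

Lemma in_L2_integrable u : in_L2 L u ->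
  mu.-integrable `]0, L[ (EFin \o (fun x => dot (u x) (u x))).
Proof.
move=> [mu_ fu]; apply/integrableP; split.
  by apply/measurable_EFinP; exact: measurable_dot.
by under eq_integral => x _ do rewrite /= ger0_norm ?dot_ge0//.
Qed.

Lemma in_L2_integrable_coord u c : in_L2 L u ->
  mu.-integrable `]0, L[ (EFin \o (fun x => u x 0 c ^+ 2)).
Proof.
move=> Hu; apply: le_integrable (in_L2_integrable Hu) => //.
  by apply/measurable_EFinP; apply: measurable_funX; exact: Hu.1.
move=> x _ /=; rewrite lee_fin ger0_norm ?sqr_ge0// ger0_norm ?dot_ge0//.
exact: coord_sqr_le_dot.
Qed.

Lemma L2norm_sqr u : L2norm L u ^+ 2 = \int[mu]_(x in `]0, L[) dot (u x) (u x).
Proof. by rewrite sqr_sqrtr// Rintegral_ge0// => x _; exact: dot_ge0. Qed.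

Lemma Rintegral_dot u (D : set R) : measurable D -> D `<=` `]0, L[ -> in_L2 L u ->
  \int[mu]_(x in D) dot (u x) (u x) = \sum_(c < 3) \int[mu]_(x in D) u x 0 c ^+ 2.
Proof.
move=> mD DL Hu.
have ic c : mu.-integrable D (EFin \o (fun x => u x 0 c ^+ 2)).
  by apply: integrableS (in_L2_integrable_coord c Hu).
rewrite !big_ord_recl big_ord0 addr0.
transitivity (\int[mu]_(x in D) (u x 0 ord0 ^+ 2 + (u x 0 (lift ord0 ord0) ^+ 2
   + u x 0 (lift ord0 (lift ord0 ord0)) ^+ 2))).
  by apply: eq_Rintegral => x _; rewrite /dot !big_ord_recl big_ord0 addr0 -!expr2.
rewrite RintegralD//; last by apply: integrable_realD.
by rewrite RintegralD.
Qed.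

Lemma increment_le g v a b : {within `[0, L], continuous g} -> in_L2 L v ->
  weak_derivative L 1 g v -> 0 <= a -> a < b -> b <= L ->
  dot (g b - g a) (g b - g a) <= (b - a) * \int[mu]_(x in `]a, b[) dot (v x) (v x).
Proof.
move=> cg v2 wg a0 ab bL.
have sub : `]a, b[ `<=` `]0, L[.
  move=> x /=; rewrite !in_itv/= => /andP[ax xb].
  by rewrite (le_lt_trans a0)// (lt_le_trans xb).
rewrite Rintegral_dot// mulr_sumr; apply: ler_sum => c _.
rewrite -expr2 !mxE -real_normK ?num_real//.
apply: ler_of_weighted; rewrite ?subr_gt0// ?Rintegral_ge0//.
  by move=> x _; exact: sqr_ge0.
move=> l l0; apply: (@weak_derivative_increment _ L (fun x => g x 0 c) (fun x => v x 0 c)) => //.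
- move=> x; apply: (@continuous_comp (subspace `[0, L]) _ _ g (fun M : 'rV[R]_3 => M 0 c)).
    exact: cg.
  exact: coord_continuous.
- exact: v2.1.
- exact: in_L2_integrable_coord.
- move=> phi /wg /(_ c); rewrite expr1 mulN1r => <-.
  by rewrite derive1n1.
Qed.

Lemma wderivP g s n : in_H L s g -> (1 <= n <= s)%N ->
  in_L2 L (wderiv L n g) /\ weak_derivative L n g (wderiv L n g).
Proof.
move=> [_ H] /H [v v2 wv]; rewrite /wderiv; case: xgetP => [w _ //|].
by move=> /(_ v) [].
Qed.

(** [2 / L] and [2 * L] are the constants of the supremum bound. The summand 1 makes the constant at
    least 1, so that it also covers the Dirichlet bound and is at most its own square. *)
Definition sobolev_const : R := 1 + 2 / L + 2 * L.

Lemma sobolev_const_ge1 : 1 <= sobolev_const.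
Proof. by rewrite /sobolev_const -addrA lerDl addr_ge0 ?mulr_ge0 ?invr_ge0 ?ltW. Qed.

Let K2 : sobolev_const <= sobolev_const ^+ 2.
Proof. by rewrite expr2 ler_peMl// ?sobolev_const_ge1// (le_trans _ sobolev_const_ge1). Qed.

Lemma L2norm_le_Hnorm g : L2norm L g ^+ 2 + L2norm L (wderiv L 1 g) ^+ 2 <= Hnorm L 3 g ^+ 2.
Proof.
rewrite /Hnorm [leRHS]sqr_sqrtr; last first.
  by rewrite addr_ge0 ?sqr_ge0// sumr_ge0// => i _; exact: sqr_ge0.
rewrite lerD2l big_ltn// lerDl sumr_ge0// => i _; exact: sqr_ge0.
Qed.

(** Nodal interpolation does not increase the Dirichlet energy: on each element the squared
    increment divided by the length is at most the integral of the squared derivative. Hence the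
    bound is uniform in the mesh. *)
Lemma sobolev_stiff g (Th : mesh L) : smooth_datum L g ->
  stiff (nelt Th) (fun i => node Th i.+1 - node Th i) (g \o node Th) (g \o node Th)
  <= (sobolev_const * Hnorm L 3 g) ^+ 2.
Proof.
move=> [cg Hg _]; have [v2 wv] := wderivP Hg (isT : (1 <= 1 <= 3)%N).
set v := wderiv L 1 g in v2 wv.
apply: (@le_trans _ _ (L2norm L v ^+ 2)); last first.
  apply: (@le_trans _ _ (Hnorm L 3 g ^+ 2)).
    by apply: le_trans (L2norm_le_Hnorm g); rewrite lerDr sqr_ge0.
  rewrite exprMn ler_peMl ?sqr_ge0// (le_trans sobolev_const_ge1)//; exact: K2.
rewrite L2norm_sqr.
have mv : measurable_fun `]0, L[ (fun x => dot (v x) (v x)).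
  by apply: measurable_dot; exact: v2.1.
have sub i : (i < nelt Th)%N -> `]node Th i, node Th i.+1[ `<=` `]0, L[.
  move=> iN x /=; rewrite !in_itv/= => /andP[ix xi].
  have := node_in (ltnW iN); have := node_in iN; rewrite !in_itv/=.
  move=> /andP[_ h1] /andP[h2 _].
  by rewrite (le_lt_trans h2)// (lt_le_trans xi).
have ms i : (i < nelt Th)%N -> measurable_fun `]node Th i, node Th i.+1[ (fun x => dot (v x) (v x)).
  by move=> iN; apply: measurable_funS mv => //; exact: sub.
have [_ I] := integral_mesh (@node_lt _ _ Th) (leqnn _) ms.
have -> : \int[mu]_(x in `]0, L[) dot (v x) (v x) =
  \sum_(i < nelt Th) \int[mu]_(x in `]node Th i, node Th i.+1[) dot (v x) (v x).
  rewrite /Rintegral sum_fine; last first.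
    move=> i _; apply: integrable_fin_num => //.
    by apply: integrableS (in_L2_integrable v2) => //; exact: sub.
  rewrite -I node_first node_last integral_itv_obnd_cbnd//.
  exact/measurable_EFinP.
apply: ler_sum => i _; have iN := ltn_ord i.
rewrite ler_pdivrMr; last exact: elt_gt0.
rewrite mulrC; apply: increment_le => //.
- by have := node_in (ltnW iN); rewrite in_itv/= => /andP[].
- exact: node_lt.
- by have := node_in iN; rewrite in_itv/= => /andP[].
Qed.

(** The averaging argument of [dot_nodal_le] with Lebesgue measure in place of the trapezoidal
    weights. *)
Lemma sobolev_sup g x : smooth_datum L g -> x \in `[0, L] ->
  dot (g x) (g x) <= (sobolev_const * Hnorm L 3 g) ^+ 2.
Proof.
move=> [cg Hg _] xL; have [v2 wv] := wderivP Hg (isT : (1 <= 1 <= 3)%N).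
set v := wderiv L 1 g in v2 wv.
have step a b : 0 <= a -> a < b -> b <= L ->
    dot (g b - g a) (g b - g a) <= L * L2norm L v ^+ 2.
  move=> a0 ab bL; apply: (le_trans (increment_le cg v2 wv a0 ab bL)).
  apply: ler_pM; rewrite ?subr_ge0 ?(ltW ab)//.
  - by rewrite Rintegral_ge0// => y _; exact: dot_ge0.
  - by rewrite lerBlDr (le_trans bL)// lerDl.
  rewrite L2norm_sqr /Rintegral fine_le//.
  - apply: integrable_fin_num => //; apply: integrableS (in_L2_integrable v2) => //.
    move=> y /=; rewrite !in_itv/= => /andP[ay yb].
    by rewrite (le_lt_trans a0)// (lt_le_trans yb).
  - exact: integrable_fin_num (in_L2_integrable v2).
  apply: ge0_subset_integral => //.
  - by apply/measurable_EFinP; apply: measurable_dot; exact: v2.1.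
  - by move=> y _; rewrite lee_fin dot_ge0.
  move=> y /=; rewrite !in_itv/= => /andP[ay yb].
  by rewrite (le_lt_trans a0)// (lt_le_trans yb).
have Q0 : 0 <= L * L2norm L v ^+ 2 by rewrite mulr_ge0 ?sqr_ge0// ltW.
have pt y : y \in `]0, L[ ->
    dot (g x) (g x) <= 2 * dot (g y) (g y) + 2 * (L * L2norm L v ^+ 2).
  rewrite !in_itv/= => /andP[y0 yL]; move: xL; rewrite in_itv/= => /andP[x0 xL].
  have -> : g x = g y + (g x - g y) by rewrite addrC subrK.
  apply: (le_trans (dotD_le _ _)); rewrite lerD2l ler_pM2l//.
  have [xy|yx|->] := ltgtP x y.
  - by rewrite -opprB dotNl dotC dotNl opprK step// ltW.
  - by rewrite step// ltW.
  - by rewrite subrr dot0l.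
have muL : fine (mu `]0, L[%classic) = L.
  by rewrite lebesgue_measure_itv/= lte_fin L_gt0/= subr0.
have ic (c : R) : mu.-integrable `]0, L[ (EFin \o (fun=> c)).
  apply: (@integrableS _ _ _ mu `[0, L]%classic) => //; first exact: subset_itv_oo_cc.
  by apply: integrable_continuous_itv => y; exact: cvg_cst.
have ig := in_L2_integrable Hg.1.
have : \int[mu]_(y in `]0, L[) dot (g x) (g x) <=
    \int[mu]_(y in `]0, L[) (2 * dot (g y) (g y) + 2 * (L * L2norm L v ^+ 2)).
  apply: le_Rintegral => //.
  by apply: integrable_realD => //; exact: integrable_realZ.
rewrite Rintegral_cst// RintegralD//; last exact: integrable_realZ.
rewrite RintegralZl// Rintegral_cst// [fine _](muL) -L2norm_sqr => H.
have H2 : dot (g x) (g x) <= 2 / L * L2norm L g ^+ 2 + 2 * L * L2norm L v ^+ 2.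
  rewrite -(ler_pM2r L_gt0) (le_trans H)// le_eqVlt; apply/orP; left; apply/eqP.
  by field; rewrite gt_eqF.
apply: (le_trans H2); apply: (@le_trans _ _ (sobolev_const * Hnorm L 3 g ^+ 2)).
  apply: (@le_trans _ _ (sobolev_const * (L2norm L g ^+ 2 + L2norm L v ^+ 2))).
    rewrite mulrDr; apply: lerD; rewrite ler_wpM2r ?sqr_ge0// /sobolev_const.
      by rewrite -addrA addrCA lerDl addr_ge0// mulr_ge0// ltW.
    by rewrite lerDr addr_ge0// divr_ge0// ltW.
  by rewrite ler_pM2l ?L2norm_le_Hnorm// (lt_le_trans _ sobolev_const_ge1).
by rewrite exprMn ler_wpM2r ?sqr_ge0.
Qed.

End sobolev_vector.

(** * Gaussian increments *)

Section gaussian.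
Context {R : realType} (s : R) (s_gt0 : 0 < s).
Notation mu := (@lebesgue_measure R).
Let nu : probability (measurableTypeR R) R := normal_prob 0 s.

Lemma ge0_integral_normal (f : R -> \bar R) : (forall x, (0 <= f x)%E) ->
  measurable_fun setT f ->
  (\int[nu]_x f x = \int[mu]_x (f x * (normal_pdf 0 s x)%:E))%E.
Proof.
move=> f0 mf.
have dom : nu `<< mu by exact: normal_prob_dominates.
rewrite -(Radon_Nikodym_SigmaFinite.change_of_variables dom)//.
have mpdf : measurable_fun setT (fun x => (normal_pdf 0 s x)%:E).
  by apply/measurable_EFinP; exact: measurable_normal_pdf.
have iRN := Radon_Nikodym_SigmaFinite.f_integrable dom.
apply: ae_eq_integral => //.
- by apply: emeasurable_funM => //; exact: measurable_int iRN.
- exact: emeasurable_funM.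
apply: ae_eqe_mul2l; apply: integral_ae_eq => //.
by move=> A _ mA; rewrite -Radon_Nikodym_SigmaFinite.f_integral.
Qed.

Lemma ge0_integral_normalN (f : R -> \bar R) : (forall x, (0 <= f x)%E) ->
  measurable_fun setT f ->
  (\int[nu]_x f (- x)%R = \int[nu]_x f x)%E.
Proof.
move=> f0 mf.
have mN : measurable_fun setT (fun x : R => f (- x)).
  by apply: measurableT_comp => //; exact: oppr_measurable.
rewrite !ge0_integral_normal//.
transitivity (\int[mu]_x (fun y => f y * (normal_pdf 0 s y)%:E)%E (- x)%R)%E.
  apply: eq_integral => x _; congr (_ * (_)%:E)%E.
  by rewrite /normal_pdf gt_eqF// /normal_fun !subr0 sqrrN.
have mfp : measurable_fun setT (fun y : R => f y * (normal_pdf 0 s y)%:E)%E.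
  by apply: emeasurable_funM => //; apply/measurable_EFinP; exact: measurable_normal_pdf.
pose g (y : R) : \bar R := (f y * (normal_pdf 0 s y)%:E)%E.
have -> : (\int[mu]_x g (- x)%R =
    \int[mu]_(x in (-%R : _ -> measurableTypeR R) @^-1` setT) (g \o -%R) x)%E.
  by rewrite preimage_setT.
rewrite -ge0_integral_pushforward//; last first.
  by move=> x _; rewrite mule_ge0// lee_fin normal_pdf_ge0.
by apply: eq_measure_integral => A mA _; exact: lebesgue_measureN.
Qed.

(* From x^(2n) <= n! (4 s^2)^n exp (x^2 / (4 s^2)), the expectation of the
   exponential being sqrt 2. *)
Definition gauss_moment (n : nat) : R := n`!%:R * 4 ^+ n * Num.sqrt 2.

Lemma gauss_moment_ge0 n : 0 <= gauss_moment n.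
Proof. by rewrite !mulr_ge0 ?exprn_ge0 ?sqrtr_ge0. Qed.

Lemma normal_moment_le n :
  (\int[nu]_x (`|x| ^+ n.*2)%:E <= (gauss_moment n * (s ^+ 2) ^+ n)%:E)%E.
Proof.
have q2 : 0 < Num.sqrt 2 :> R by rewrite sqrtr_gt0.
have s2 : Num.sqrt 2 * s != 0 by rewrite gt_eqF// mulr_gt0.
have mX : measurable_fun setT (fun x : R => (`|x| ^+ n.*2)%:E).
  by apply/measurable_EFinP; apply: measurable_funX; exact: normr_measurable.
rewrite ge0_integral_normal//.
(* The Gaussian weight is a product of two equal exponentials: one controls the power, the other is
   the Gaussian of variance 2 s^2, whose normalization costs the factor sqrt 2. *)
apply: (@le_trans _ _ (\int[mu]_x ((gauss_moment n * (s ^+ 2) ^+ n)%:E *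
   (normal_pdf 0 (Num.sqrt 2 * s) x)%:E))%E); last first.
  rewrite integralZl//; last exact: integrable_normal_pdf.
  by rewrite integral_normal_pdf mule1.
apply: ge0_le_integral => //.
- by move=> x _; rewrite mule_ge0 ?lee_fin ?exprn_ge0 ?normal_pdf_ge0.
- by apply: emeasurable_funM => //; apply/measurable_EFinP; exact: measurable_normal_pdf.
- by apply: emeasurable_funM => //; apply/measurable_EFinP; exact: measurable_normal_pdf.
move=> x _; rewrite -!EFinM lee_fin /normal_pdf (negbTE s2) gt_eqF// /normal_peak /normal_fun.
rewrite !subr0 [(Num.sqrt 2 * s) ^+ 2]exprMn sqr_sqrtr//.
set r := s ^+ 2; have r0 : 0 < r by rewrite exprn_gt0.
have -> : 2 * r * pi *+ 2 = 2 * (r * pi *+ 2) by rewrite mulrnAr mulrA.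
have rp : 0 <= r * pi *+ 2 by rewrite mulrn_wge0// mulr_ge0 ?pi_ge0// ltW.
rewrite sqrtrM// invfM -mul2n exprM real_normK ?num_real//.
set y := x ^+ 2 / (4 * r).
have y0 : 0 <= y by rewrite divr_ge0 ?sqr_ge0 ?mulr_ge0 ?ltW.
have -> : - x ^+ 2 / (r *+ 2) = - y + - y.
  by rewrite /y -mulr_natl; field; rewrite gt_eqF.
have -> : - x ^+ 2 / (2 * r *+ 2) = - y.
  by rewrite /y -mulr_natl; field; rewrite gt_eqF.
have -> : (x ^+ 2) ^+ n = (4 * r) ^+ n * y ^+ n.
  by rewrite -exprMn /y mulrC divfK// gt_eqF// mulr_gt0.
rewrite expRD /gauss_moment [(4 * r) ^+ n]exprMn.
have yE : y ^+ n * expR (- y) <= n`!%:R.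
  rewrite expRN ler_pdivrMr ?expR_gt0// -ler_pdivrMl ?ltr0n ?fact_gt0// mulrC.
  case: n {mX} => [|n]; first by rewrite expr0 fact0 divr1 -expR0 ler_expR.
  by apply: le_trans (expR_ge1Dxn n y0); rewrite lerDr.
set c := (Num.sqrt (r * pi *+ 2))^-1.
have c0 : 0 <= c by rewrite invr_ge0 sqrtr_ge0.
have -> : 4 ^+ n * r ^+ n * y ^+ n * (c * (expR (- y) * expR (- y))) =
  (y ^+ n * expR (- y)) * (4 ^+ n * r ^+ n * c * expR (- y)) by ring.
apply: (@le_trans _ _ (n`!%:R * (4 ^+ n * r ^+ n * c * expR (- y)))).
  by rewrite ler_wpM2r// !mulr_ge0 ?expR_ge0// exprn_ge0// ltW.
rewrite le_eqVlt; apply/orP; left; apply/eqP; field.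
by rewrite gt_eqF.
Qed.

End gaussian.

Section product_law.
Context d d1 d2 (Omega : measurableType d) (T1 : measurableType d1)
  (T2 : measurableType d2) {R : realType} (P : probability Omega R).
Variables (nu : probability T2 R) (Y : Omega -> T1) (D : Omega -> T2).
Hypotheses (mY : measurable_fun setT Y) (mD : measurable_fun setT D).
Hypothesis YD : forall A B, measurable A -> measurable B ->
  (P (Y @^-1` A `&` D @^-1` B) = P (Y @^-1` A) * nu B)%E.

(** The joint law agrees with the product measure on rectangles, hence everywhere; Tonelli's theorem
    then integrates over the increment with [Y] frozen. *)
Lemma ge0_integral_product_law (h : T1 * T2 -> \bar R) : (forall z, (0 <= h z)%E) ->
  measurable_fun setT h ->
  (\int[P]_w h (Y w, D w) = \int[P]_w \int[nu]_x h (Y w, x))%E.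
Proof.
move=> h0 mh.
pose Y' : {mfun Omega >-> T1} := mfun_Sub (mem_set mY).
have mYD : measurable_fun setT (fun w => (Y w, D w)) by exact: measurable_fun_pair.
pose YD' : {mfun Omega >-> (T1 * T2)%type} := mfun_Sub (mem_set mYD).
pose m1 : probability T1 R := distribution P Y'.
have U X : measurable X -> (m1 \x nu)%E X = pushforward P YD' X.
  apply: product_measure_unique => A B mA mB; exact: YD.
transitivity (\int[pushforward P YD']_z h z)%E.
  by rewrite ge0_integral_pushforward.
transitivity (\int[(m1 \x nu)%E]_z h z)%E.
  by apply: eq_measure_integral => A mA _; exact/esym/U.
rewrite fubini_tonelli1// /m1/= ge0_integral_pushforward//.
  exact: measurable_fun_fubini_tonelli_F.
by move=> x _; apply: integral_ge0.
Qed.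

End product_law.

Section increment.
Context d (Omega : measurableType d) {R : realType} (P : probability Omega R).
Variables (F : set (set Omega)) (D : Omega -> R) (k : R).
Hypothesis k_gt0 : 0 < k.
Hypothesis mD : measurable_fun setT D.
Hypothesis lawD : forall B : set R, measurable B ->
  P (D @^-1` B) = normal_prob 0 (Num.sqrt k) B.
Hypothesis indep : forall (A : set Omega) (B : set R), F A -> measurable B ->
  (P (A `&` D @^-1` B) = P A * P (D @^-1` B))%E.
Variable Y : Omega -> R.
Hypotheses (FY : rv_measurable F Y) (mY : measurable_fun setT Y).

Let s_gt0 : 0 < Num.sqrt k. Proof. by rewrite sqrtr_gt0. Qed.

Let law (h : R * R -> \bar R) : (forall z, (0 <= h z)%E) ->
  measurable_fun setT h ->
  (\int[P]_w h (Y w, D w) =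
   \int[P]_w \int[normal_prob 0 (Num.sqrt k)]_x h (Y w, x))%E.
Proof.
move=> h0 mh.
apply: (@ge0_integral_product_law _ _ _ _ _ _ _ P (normal_prob 0 (Num.sqrt k)) Y D) => //.
move=> A B mA mB; rewrite [LHS]indep//; last exact: FY.
by congr (_ * _)%E; exact: lawD.
Qed.

Lemma increment_moment n :
  (\int[P]_w (`|Y w| * `|D w| ^+ n.*2)%:E <=
   (gauss_moment n * k ^+ n)%:E * \int[P]_w `|Y w|%:E)%E.
Proof.
have mX : measurable_fun setT (fun x : R => `|x| ^+ n.*2).
  by apply: measurable_funX; exact: normr_measurable.
pose h (z : R * R) := (`|z.1| * `|z.2| ^+ n.*2)%:E.
have -> : (\int[P]_w (`|Y w| * `|D w| ^+ n.*2)%:E = \int[P]_w h (Y w, D w))%E by [].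
rewrite law; last 2 first.
- by move=> z; rewrite lee_fin mulr_ge0// exprn_ge0.
- apply/measurable_EFinP; apply: measurable_funM.
    by apply: measurableT_comp; [exact: normr_measurable|exact: measurable_fst].
  by apply: (measurableT_comp mX); exact: measurable_snd.
have mabsY : measurable_fun setT (fun w => `|Y w|%:E).
  by apply/measurable_EFinP; apply: measurableT_comp => //; exact: normr_measurable.
have c0 : (0 <= (gauss_moment n * k ^+ n)%:E)%E.
  by rewrite lee_fin mulr_ge0 ?gauss_moment_ge0// exprn_ge0// ltW.
rewrite -ge0_integralZl//=.
have E w : (\int[normal_prob 0 (Num.sqrt k)]_x h (Y w, x) =
    `|Y w|%:E * \int[normal_prob 0 (Num.sqrt k)]_x (`|x| ^+ n.*2)%:E)%E.
  by rewrite -ge0_integralZl//=; exact/measurable_EFinP.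
under eq_integral => w _ do rewrite E.
apply: ge0_le_integral => //.
- by move=> w _; rewrite mule_ge0 ?lee_fin// integral_ge0// => x _; rewrite lee_fin exprn_ge0.
- by apply: emeasurable_funM => //; exact: measurable_cst.
- by apply: emeasurable_funM => //; exact: measurable_cst.
move=> w _; rewrite muleC lee_wpmul2r ?lee_fin//.
have := normal_moment_le s_gt0 n.
by rewrite sqr_sqrtr// ltW.
Qed.

Hypothesis iY : P.-integrable setT (EFin \o Y).

Lemma increment_integrable : P.-integrable setT (EFin \o (fun w => Y w * D w)).
Proof.
apply/integrableP; split.
  by apply/measurable_EFinP; exact: measurable_funM.
have iYfin : (\int[P]_w `|Y w|%:E < +oo)%E by have /integrableP[] := iY.
have mabsY : measurable_fun setT (fun w => `|Y w|).
  by apply: measurableT_comp => //; exact: normr_measurable.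
have mD2 : measurable_fun setT (fun w => `|Y w| * `|D w| ^+ 2).
  apply: measurable_funM => //; apply: measurable_funX.
  by apply: measurableT_comp => //; exact: normr_measurable.
apply: (@le_lt_trans _ _ (\int[P]_w (`|Y w|%:E + (`|Y w| * `|D w| ^+ 2)%:E))%E).
  apply: ge0_le_integral => //.
  - by apply/measurable_EFinP; apply: measurableT_comp; [exact: normr_measurable|exact: measurable_funM].
  - by apply: emeasurable_funD; exact/measurable_EFinP.
  move=> w _; rewrite /= -EFinD lee_fin normrM -{2}[`|Y w|]mulr1 -mulrDr.
  rewrite ler_wpM2l//; have := sqr_ge0 (`|D w| - 1); have := normr_ge0 (D w).
  by move: (`|D w|) => x; lra.
rewrite ge0_integralD//; last 2 first.
- exact/measurable_EFinP.
- exact/measurable_EFinP.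
rewrite lte_add_pinfty//; apply: (le_lt_trans (increment_moment 1)).
rewrite lte_mul_pinfty// lee_fin mulr_ge0 ?gauss_moment_ge0// exprn_ge0// ltW//.
Qed.

(** Since the product law is available for nonnegative integrands, positive and negative parts are
    treated separately: the symmetry of the normal law makes their integrals equal, and
    integrability makes them finite. *)
Lemma increment_mean0 : (\int[P]_w (Y w * D w)%:E = 0)%E.
Proof.
pose hp (z : R * R) := (Num.max (z.1 * z.2) 0)%:E.
pose hn (z : R * R) := (Num.max (- (z.1 * z.2)) 0)%:E.
have mz : measurable_fun setT (fun z : R * R => z.1 * z.2).
  by apply: measurable_funM; [exact: measurable_fst|exact: measurable_snd].
have mp : measurable_fun setT hp.
  by apply/measurable_EFinP; apply: measurable_maxr.
have mn : measurable_fun setT hn.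
  by apply/measurable_EFinP; apply: measurable_maxr => //; exact: measurable_funN.
have E : (\int[P]_w hp (Y w, D w) = \int[P]_w hn (Y w, D w))%E.
  have hp0 z : (0 <= hp z)%E by rewrite lee_fin le_max lexx orbT.
  have hn0 z : (0 <= hn z)%E by rewrite lee_fin le_max lexx orbT.
  rewrite (law hp0 mp) (law hn0 mn).
  apply: eq_integral => w _; rewrite -(ge0_integral_normalN s_gt0).
  - by apply: eq_integral => x _; rewrite /hp /hn/= mulrN.
  - by move=> x; exact: hp0.
  - by apply: (measurableT_comp mp); exact: measurable_fun_pair.
rewrite integralE.
have -> : (\int[P]_w ((fun w => (Y w * D w)%:E)^\+ w) = \int[P]_w hp (Y w, D w))%E.
  by apply: eq_integral => w _; rewrite funeposE /hp/= EFin_max.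
have -> : (\int[P]_w ((fun w => (Y w * D w)%:E)^\- w) = \int[P]_w hp (Y w, D w))%E.
  by rewrite E; apply: eq_integral => w _; rewrite funenegE /hn/= EFin_max.
rewrite subee//.
have := integrable_fin_num measurableT (integrable_funepos measurableT increment_integrable).
congr (_ \is a fin_num).
by apply: eq_integral => w _; rewrite funeposE /hp/= EFin_max.
Qed.

End increment.

(** * The size of the noise *)

Lemma exprn_tangent (R : realFieldType) (m : nat) (x y : R) : 0 <= x -> 0 <= y ->
  x ^+ m.+1 + m.+1%:R * x ^+ m * (y - x) <= y ^+ m.+1.
Proof.
move=> x0 y0; elim: m => [|m IH]; first by rewrite !expr1 expr0; lra.
rewrite [leRHS]exprS; apply: le_trans (ler_wpM2l y0 IH).
rewrite -subr_ge0.
have -> : y * (x ^+ m.+1 + m.+1%:R * x ^+ m * (y - x)) -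
  (x ^+ m.+2 + m.+2%:R * x ^+ m.+1 * (y - x)) = m.+1%:R * x ^+ m * (y - x) ^+ 2.
  by rewrite -[m.+2%:R]natr1 !exprS; ring.
by apply: mulr_ge0; [apply: mulr_ge0 => //; exact: exprn_ge0|exact: sqr_ge0].
Qed.

(** Jensen's inequality for weights of total mass at most [K]: the tangent to the power at the
    weighted mean [S / C] lies below it, and the linear terms sum to zero. *)
Lemma jensen_exprn (R : realFieldType) (n m : nat) (c a : nat -> R) (K : R) :
  (forall l, 0 <= c l) -> (forall l, 0 <= a l) -> \sum_(l < n) c l <= K ->
  (\sum_(l < n) c l * a l) ^+ m.+1 <= K ^+ m * \sum_(l < n) c l * a l ^+ m.+1.
Proof.
move=> c0 a0 cK; set S := \sum_(l < n) c l * a l; set C := \sum_(l < n) c l in cK.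
have C0 : 0 <= C by apply: sumr_ge0.
have S0 : 0 <= S by apply: sumr_ge0 => l _; rewrite mulr_ge0.
have T0 : 0 <= \sum_(l < n) c l * a l ^+ m.+1.
  by apply: sumr_ge0 => l _; rewrite mulr_ge0 ?exprn_ge0.
apply: (@le_trans _ _ (C ^+ m * \sum_(l < n) c l * a l ^+ m.+1)); last first.
  by rewrite ler_wpM2r// lerXn2r ?nnegrE// (le_trans C0).
have [C1|C1] := eqVneq C 0.
  have C1' : all (fun l : 'I_n => true ==> (c l == 0)) (index_enum 'I_n).
    by rewrite -psumr_eq0// -/C C1.
  have cl (l : 'I_n) : c l = 0.
    by have /allP/(_ l) := C1'; rewrite mem_index_enum => /(_ isT)/implyP/(_ isT)/eqP.
  have -> : S = 0 by apply: big1 => l _; rewrite cl mul0r.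
  by rewrite expr0n/= mulr_ge0// exprn_ge0.
set x := S / C; have x0 : 0 <= x by rewrite divr_ge0.
have CxS : C * x = S by rewrite /x mulrC divfK.
have H : C * x ^+ m.+1 <= \sum_(l < n) c l * a l ^+ m.+1.
  have : \sum_(l < n) c l * (x ^+ m.+1 + m.+1%:R * x ^+ m * (a l - x)) <=
      \sum_(l < n) c l * a l ^+ m.+1.
    by apply: ler_sum => l _; rewrite ler_wpM2l// exprn_tangent.
  have -> : \sum_(l < n) c l * (x ^+ m.+1 + m.+1%:R * x ^+ m * (a l - x)) =
    C * x ^+ m.+1 + m.+1%:R * x ^+ m * (S - C * x).
    rewrite /S /C mulr_suml [_ * x]mulr_suml -sumrB mulr_sumr -big_split/=.
    by apply: eq_bigr => l _; ring.
  by rewrite CxS subrr mulr0 addr0.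
have -> : S ^+ m.+1 = C ^+ m * (C * x ^+ m.+1).
  by rewrite mulrA -exprSr -exprMn CxS.
by rewrite ler_wpM2l// exprn_ge0.
Qed.

Section noise_size.
Context d (T : measurableType d) {R : realType}.
Variables (c : nat -> R) (D : nat -> T -> R).
Hypothesis c_ge0 : forall l, 0 <= c l.

Definition noise_esum (w : T) : \bar R := (\sum_(0 <= l <oo) (c l * `|D l w|)%:E)%E.

(* Junk value 0 where the series diverges. *)
Definition noise_size (w : T) : R := fine (noise_esum w).

Let cD0 l w : (0 <= (c l * `|D l w|)%:E)%E. Proof. by rewrite lee_fin mulr_ge0. Qed.

Lemma noise_esum_ge0 w : (0 <= noise_esum w)%E.
Proof. by rewrite nneseries_ge0. Qed.

Lemma noise_size_ge0 w : 0 <= noise_size w.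
Proof. by rewrite fine_ge0// noise_esum_ge0. Qed.

Lemma measurable_noise_esum : (forall l, measurable_fun setT (D l)) ->
  measurable_fun setT noise_esum.
Proof.
move=> mD; apply: ge0_emeasurable_sum => // l _; apply/measurable_EFinP.
apply: measurable_funM => //; apply: measurableT_comp => //; exact: normr_measurable.
Qed.

Lemma measurable_noise_size : (forall l, measurable_fun setT (D l)) ->
  measurable_fun setT noise_size.
Proof.
by move=> mD; apply: measurableT_comp => //; exact: measurable_noise_esum.
Qed.

Lemma noise_size_cvg w : (noise_esum w < +oo)%E ->
  (fun n => \sum_(l < n) c l * `|D l w|) @ \oo --> noise_size w.
Proof.
move=> fw; have fin : noise_esum w \is a fin_num by rewrite ge0_fin_numE// nneseries_ge0.
have /fine_cvgP[_] : (fun n => \sum_(0 <= l < n) (c l * `|D l w|)%:E)%E @ \oo -->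
   (noise_size w)%:E.
  by rewrite fineK//; exact: is_cvg_nneseries.
apply: cvg_trans; apply: near_eq_cvg; apply: nearW => n /=.
by rewrite sumEFin/= big_mkord.
Qed.

Lemma noise_size_ge w n : (noise_esum w < +oo)%E ->
  \sum_(l < n) c l * `|D l w| <= noise_size w.
Proof.
move=> fw; have fin : noise_esum w \is a fin_num by rewrite ge0_fin_numE// nneseries_ge0.
by rewrite -lee_fin fineK// -sumEFin -(big_mkord xpredT (fun l => (c l * `|D l w|)%:E)) nneseries_lim_ge.
Qed.

End noise_size.

Section noise_step.
Context d (Omega : measurableType d) {R : realType} (P : probability Omega R).
Variables (F : set (set Omega)) (c : nat -> R) (D : nat -> Omega -> R) (k K : R).
Hypotheses (sF : sigma_algebra setT F) (FM : F `<=` measurable).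
Hypotheses (c_ge0 : forall l, 0 <= c l) (K_ge0 : 0 <= K).
Hypothesis sum_c : forall n, \sum_(l < n) c l <= K.
Hypothesis k_gt0 : 0 < k.
Hypothesis mD : forall l, measurable_fun setT (D l).
Hypothesis lawD : forall l (B : set R), measurable B ->
  P (D l @^-1` B) = normal_prob 0 (Num.sqrt k) B.
Hypothesis indep : forall l (A : set Omega) (B : set R), F A -> measurable B ->
  (P (A `&` D l @^-1` B) = P A * P (D l @^-1` B))%E.

Notation esum := (noise_esum c D).
Notation eta := (noise_size c D).

Lemma rv_measurable_fun (Y : Omega -> R) : rv_measurable F Y -> measurable_fun setT Y.
Proof. by move=> FY _ B mB; rewrite setTI; apply: FM; exact: FY. Qed.

Let mabsD l : measurable_fun setT (fun w => `|D l w|).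
Proof. by apply: measurableT_comp => //; exact: normr_measurable. Qed.

Lemma nneseries_scaled_le (a : nat -> \bar R) (b : \bar R) : (forall l, (0 <= a l)%E) ->
  (0 <= b)%E -> (forall l, (a l <= (c l)%:E * b)%E) ->
  (\sum_(0 <= l <oo) a l <= K%:E * b)%E.
Proof.
move=> a0 b0 ab; apply: lime_le; first exact: is_cvg_nneseries.
apply: nearW => n; apply: (@le_trans _ _ (\sum_(0 <= l < n) (c l)%:E * b)%E).
  by apply: lee_sum => l _; exact: ab.
rewrite -ge0_sume_distrl; last by move=> l _; rewrite lee_fin.
by rewrite sumEFin big_mkord lee_wpmul2r// lee_fin.
Qed.

Let rv1 : rv_measurable F (cst 1 : Omega -> R).
Proof.
have [s0 sC _] := sF.
move=> B mB; rewrite preimage_cst; case: ifP => _ //.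
by rewrite -(setD0 setT); exact: sC.
Qed.

(** The expectation of the series is finite: |x| <= 1 + x^2 reduces each term to a second moment,
    and the weights are summable. *)
Lemma noise_esum_finite : {ae P, forall w, (esum w < +oo)%E}.
Proof.
have iE : P.-integrable setT esum.
  apply/integrableP; split; first exact: measurable_noise_esum.
  under eq_integral => w _ do rewrite gee0_abs ?noise_esum_ge0//.
  rewrite /noise_esum.
  rewrite integral_nneseries//; last 2 first.
  - by move=> l; apply/measurable_EFinP; exact: measurable_funM.
  - by move=> l w _; rewrite lee_fin mulr_ge0.
  pose b := (1 + gauss_moment 1 * k ^+ 1 : R)%:E.
  apply: (@le_lt_trans _ _ (K%:E * b)%E); last by rewrite -EFinM ltry.
  apply: nneseries_scaled_le.
  - by move=> l; apply: integral_ge0 => w _; rewrite lee_fin mulr_ge0.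
  - by rewrite lee_fin addr_ge0// mulr_ge0 ?gauss_moment_ge0// exprn_ge0// ltW.
  move=> l; under eq_integral => w _ do rewrite EFinM.
  rewrite ge0_integralZl//; last 2 first.
  - exact/measurable_EFinP.
  - by rewrite lee_fin.
  apply: lee_wpmul2l; first by rewrite lee_fin.
  have := increment_moment k_gt0 (mD l) (@lawD l) (@indep l) rv1 
    (rv_measurable_fun rv1) 1.
  rewrite [in X in (X <= _)%E](eq_integral (fun w => (`|D l w| ^+ 2)%:E)); last by move=> w _; rewrite /cst normr1 mul1r.
  rewrite [in X in (_ <= _ * X)%E](eq_integral (cst 1%E)); last by move=> w _; rewrite /cst normr1.
  rewrite integral_cst//= mul1e probability_setT mule1 => H.
  apply: (@le_trans _ _ (\int[P]_w (1 + (`|D l w| ^+ 2)%:E))%E).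
    apply: ge0_le_integral => //.
    - exact/measurable_EFinP.
    - apply: emeasurable_funD => //; apply/measurable_EFinP; exact: measurable_funX.
    move=> w _; rewrite -EFinD lee_fin.
    have := sqr_ge0 (`|D l w| - 1); have := normr_ge0 (D l w).
    by move: (`|D l w|) => x; lra.
  rewrite ge0_integralD//; last by apply/measurable_EFinP; exact: measurable_funX.
  by rewrite integral_cst//= mul1e probability_setT /b EFinD leeD2l.
have := integrable_ae measurableT iE.
apply: filterS => w /(_ Logic.I).
by rewrite ge0_fin_numE// noise_esum_ge0.
Qed.

(** [Y] stands for the potential at the beginning of the step. It vanishes where the noise series
    diverges, so that the junk value of [noise_size] is never seen. *)
Variable Y : Omega -> R.
Hypotheses (FY : rv_measurable F Y) (Y_ge0 : forall w, 0 <= Y w).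
Hypothesis Y_fin : forall w, Y w != 0 -> (esum w < +oo)%E.

Let mY : measurable_fun setT Y. Proof. exact: rv_measurable_fun. Qed.

(** Jensen's inequality with the weights [c l] moves the power inside the series, so that only
    moments of single increments occur; the bound passes from partial sums to the limit
    pointwise. *)
Lemma noise_moment n : (0 < n)%N ->
  (\int[P]_w (Y w * eta w ^+ n.*2)%:E <=
   (K ^+ n.*2 * (gauss_moment n * k ^+ n))%:E * \int[P]_w (Y w)%:E)%E.
Proof.
move=> n0; have [m mE] : exists m, n.*2 = m.+1 by exists n.*2.-1; rewrite prednK// double_gt0.
pose t l w := (c l * (Y w * `|D l w| ^+ n.*2))%:E.
have t0 l w : (0 <= t l w)%E by rewrite lee_fin !mulr_ge0// exprn_ge0.
have mt l : measurable_fun setT (t l).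
  apply/measurable_EFinP; apply: measurable_funM => //; apply: measurable_funM => //.
  exact: measurable_funX.
have pt w : ((Y w * eta w ^+ n.*2)%:E <= (K ^+ m)%:E * \sum_(0 <= l <oo) t l w)%E.
  have [->|Yw] := eqVneq (Y w) 0.
    rewrite mul0r mule_ge0 ?lee_fin ?exprn_ge0// nneseries_ge0//.
  have C : (fun N => (Y w * (\sum_(l < N) c l * `|D l w|) ^+ n.*2)%:E) @ \oo -->
     (Y w * eta w ^+ n.*2)%:E.
    apply: cvg_EFin; first exact: nearW.
    apply: cvgMl_tmp.
    apply: (@continuous_cvg _ _ _ _ _ _ (fun x : R => x ^+ n.*2)).
      exact: exprn_continuous.
    exact: noise_size_cvg (Y_fin Yw).
  rewrite -(cvg_lim _ C)//; apply: lime_le; first by apply/cvg_ex; eexists; exact: C.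
  apply: nearW => N; rewrite mE.
  apply: (@le_trans _ _ ((K ^+ m)%:E * \sum_(0 <= l < N) t l w)%E); last first.
    by apply: lee_wpmul2l; [rewrite lee_fin exprn_ge0|exact: nneseries_lim_ge].
  rewrite sumEFin -EFinM lee_fin big_mkord.
  have -> : \sum_(i < N) c i * (Y w * `|D i w| ^+ n.*2) =
    Y w * \sum_(i < N) c i * `|D i w| ^+ m.+1.
    by rewrite mulr_sumr mE; apply: eq_bigr => i _; ring.
  rewrite mulrCA ler_wpM2l//.
  exact: (@jensen_exprn _ N m c (fun l => `|D l w|)).
apply: (@le_trans _ _ (\int[P]_w ((K ^+ m)%:E * \sum_(0 <= l <oo) t l w))%E).
  apply: ge0_le_integral => //.
  - by move=> w _; rewrite lee_fin mulr_ge0// exprn_ge0// noise_size_ge0.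
  - apply/measurable_EFinP; apply: measurable_funM => //; apply: measurable_funX.
    exact: measurable_noise_size.
  - by apply: emeasurable_funM => //; apply: ge0_emeasurable_sum.
rewrite ge0_integralZl//; last 3 first.
- exact: ge0_emeasurable_sum.
- by move=> w _; exact: nneseries_ge0.
- by rewrite lee_fin exprn_ge0.
rewrite mE exprSr -mulrA EFinM -muleA; apply: lee_wpmul2l; first by rewrite lee_fin exprn_ge0.
rewrite integral_nneseries// EFinM -muleA; apply: nneseries_scaled_le.
- by move=> l; apply: integral_ge0.
- apply: mule_ge0; first by rewrite lee_fin mulr_ge0 ?gauss_moment_ge0// exprn_ge0// ltW.
  by apply: integral_ge0 => w _; rewrite lee_fin.
move=> l; under eq_integral => w _ do rewrite /t EFinM.
rewrite ge0_integralZl//; last 3 first.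
- apply/measurable_EFinP; apply: measurable_funM => //; exact: measurable_funX.
- by move=> w _; rewrite lee_fin mulr_ge0// exprn_ge0.
- by rewrite lee_fin.
apply: lee_wpmul2l; first by rewrite lee_fin.
have := increment_moment k_gt0 (mD l) (@lawD l) (@indep l) FY mY n.
have -> : (fun w => (`|Y w| * `|D l w| ^+ n.*2)%:E) = (fun w => (Y w * `|D l w| ^+ n.*2)%:E).
  by apply/funext => w; rewrite (ger0_norm (Y_ge0 w)).
by have -> : (fun w => `|Y w|%:E) = (fun w => (Y w)%:E); first
  by apply/funext => w; rewrite (ger0_norm (Y_ge0 w)).
Qed.

Hypothesis iY : P.-integrable setT (EFin \o Y).

Lemma noise_moment_integrable n : (0 < n)%N ->
  P.-integrable setT (EFin \o (fun w => Y w * eta w ^+ n.*2)).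
Proof.
move=> n0; apply/integrableP; split.
  apply/measurable_EFinP; apply: measurable_funM => //; apply: measurable_funX.
  exact: measurable_noise_size.
under eq_integral => w _.
  rewrite /= ger0_norm; last by rewrite mulr_ge0// exprn_ge0// noise_size_ge0.
  over.
apply: (le_lt_trans (noise_moment n0)); rewrite lte_mul_pinfty//.
  by rewrite lee_fin !mulr_ge0 ?gauss_moment_ge0// exprn_ge0// ltW.
have /integrableP[_] := iY.
by under eq_integral => w _ do rewrite /= ger0_norm//.
Qed.

Variables (e : nat -> Omega -> R) (M : Omega -> R) (C1 : R).
Hypotheses (Fe : forall l, rv_measurable F (e l)) (C1_ge0 : 0 <= C1).
Hypothesis e_le : forall l w, `|e l w| <= C1 * c l * Y w.
Hypothesis M_cvg : forall w, (fun n => \sum_(l < n) e l w * D l w) @ \oo --> M w.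

Let me_ l : measurable_fun setT (e l). Proof. exact: rv_measurable_fun. Qed.

Let ie l : P.-integrable setT (EFin \o e l).
Proof.
apply: le_integrable (integrable_realZ measurableT (C1 * c l) iY) => //.
  exact/measurable_EFinP.
move=> w _ /=; rewrite lee_fin (le_trans (e_le l w))// ler_norm//.
Qed.

(** The partial sums have mean zero term by term, the coefficients [e l] being known before the
    step. They are dominated by a multiple of [Y + Y * eta ^+ 2], which is integrable. *)
Lemma martingale_increment : P.-integrable setT (EFin \o M) /\
  (\int[P]_w (M w)%:E = 0)%E.
Proof.
pose f n w := (\sum_(l < n) e l w * D l w)%:E.
pose g w := (C1 * (Y w + Y w * eta w ^+ 1.*2))%:E.
have mM : measurable_fun setT M.
  apply: (measurable_fun_cvg (h := fun n w => \sum_(l < n) e l w * D l w)) => //.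
  by move=> n; apply: measurable_sum => l; exact: measurable_funM.
have mf n : measurable_fun setT (f n).
  by apply/measurable_EFinP; apply: measurable_sum => l; exact: measurable_funM.
have ig : P.-integrable setT g.
  by apply: integrable_realZ => //; apply: integrable_realD => //; exact: noise_moment_integrable.
have fM w : f ^~ w @ \oo --> (M w)%:E by apply: cvg_EFin; [exact: nearW|exact: M_cvg].
have fg n w : (`|f n w| <= g w)%E.
  rewrite /f /g abse_EFin lee_fin; apply: (le_trans (ler_norm_sum _ _ _)).
  have [Y0|Y0] := eqVneq (Y w) 0.
    rewrite Y0 mul0r addr0 mulr0 big1// => l _; apply/eqP; rewrite normrM.
    by have := e_le l w; rewrite Y0 mulr0 normr_le0 => /eqP ->; rewrite normr0 mul0r.
  apply: (@le_trans _ _ (C1 * (Y w * eta w))).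
    apply: (@le_trans _ _ (C1 * (Y w * \sum_(l < n) c l * `|D l w|))).
      rewrite !mulr_sumr; apply: ler_sum => l _; rewrite normrM.
      apply: (le_trans (ler_wpM2r _ (e_le l w))) => //.
      by rewrite le_eqVlt; apply/orP; left; apply/eqP; ring.
    by rewrite !ler_wpM2l//; apply: noise_size_ge => //; exact: Y_fin.
  rewrite ler_wpM2l// -{2}[Y w]mulr1 -mulrDr ler_wpM2l//.
  by have := sqr_ge0 (eta w - 1); have := noise_size_ge0 D c_ge0 w; move: (eta w) => x; lra.
have [iM _ cI] := dominated_convergence measurableT mf
  ((measurable_EFinP _ _).2 mM) (aeW _ (fun w _ => fM w)) ig (aeW _ (fun w n _ => fg n w)).
split=> //.
have I0 n : (\int[P]_w f n w = 0)%E.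
  rewrite /f; under eq_integral => w _ do rewrite -sumEFin.
  rewrite integral_sum//; last by move=> l; exact: (increment_integrable k_gt0 (mD l) (@lawD l) (@indep l) (Fe l) (me_ l) (ie l)).
  by rewrite big1// => l _; exact: (increment_mean0 k_gt0 (mD l) (@lawD l) (@indep l) (Fe l) (me_ l) (ie l)).
have : (fun n => (\int[P]_w f n w)%E) @ \oo --> (\int[P]_w (M w)%:E)%E by exact: cI.
under eq_cvg => n do rewrite I0.
by move=> /(cvg_lim (@ereal_hausdorff R)) <-; rewrite lim_cst.
Qed.

Lemma expectation_step (Y' : Omega -> R) (C2 : R) (n : nat) : k <= 1 -> (0 < n)%N -> 0 <= C2 ->
  measurable_fun setT Y' -> (forall w, 0 <= Y' w) ->
  (forall w, Y' w <= Y w + M w + C2 * (Y w * (eta w ^+ 2 + eta w ^+ n.*2))) ->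
  (\int[P]_w (Y' w)%:E <=
    (1 + C2 * (K ^+ 2 * gauss_moment 1 + K ^+ n.*2 * gauss_moment n) * k)%:E * \int[P]_w (Y w)%:E)%E.
Proof.
move=> k1 n0 C20 mY' Y'0 H.
have [iM M0] := martingale_increment.
have i1 := noise_moment_integrable (isT : (0 < 1)%N); have in_ := noise_moment_integrable n0.
have iR : P.-integrable setT (EFin \o (fun w => C2 * (Y w * eta w ^+ 1.*2 + Y w * eta w ^+ n.*2))).
  by apply: integrable_realZ => //; exact: integrable_realD.
apply: (@le_trans _ _ (\int[P]_w ((Y w)%:E + (M w)%:E +
   C2%:E * ((Y w * eta w ^+ 1.*2)%:E + (Y w * eta w ^+ n.*2)%:E)))%E).
  apply: ge0_le_integral => //.
  - by move=> w _; rewrite lee_fin.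
  - exact/measurable_EFinP.
  - apply: emeasurable_funD.
      by apply: emeasurable_funD; [exact: measurable_int iY|exact: measurable_int iM].
    apply: emeasurable_funM => //; apply: emeasurable_funD.
      exact: measurable_int i1.
    exact: measurable_int in_.
  by move=> w _; rewrite -!(EFinD, EFinM) lee_fin (le_trans (H w))// -mulrDr.
have iYM := integrableD measurableT iY iM.
have i1n := integrableD measurableT i1 in_.
have iZ := integrableZl measurableT C2 i1n.
rewrite (integralD measurableT iYM iZ) (integralD measurableT iY iM) M0 adde0.
rewrite (integralZl measurableT i1n) (integralD measurableT i1 in_).
have fY : (\int[P]_w (Y w)%:E)%E \is a fin_num by exact: integrable_fin_num iY.
have e0 : 0 <= fine (\int[P]_w (Y w)%:E) by rewrite fine_ge0// integral_ge0// => w _; rewrite lee_fin.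
have m1 := noise_moment (isT : (0 < 1)%N); have mn := noise_moment n0.
apply: (@le_trans _ _ (\int[P]_w (Y w)%:E + C2%:E * (
   (K ^+ 1.*2 * (gauss_moment 1 * k ^+ 1))%:E * \int[P]_w (Y w)%:E +
   (K ^+ n.*2 * (gauss_moment n * k ^+ n))%:E * \int[P]_w (Y w)%:E))%E).
  by rewrite leeD2l// lee_wpmul2l ?lee_fin// leeD.
rewrite -(fineK fY) -!(EFinM, EFinD) lee_fin.
(* Here [k <= 1] turns the higher moment into a contribution linear in the step size. *)
have kn : k ^+ n <= k by rewrite -[leRHS]expr1 ler_wiXn2l// ltW.
have g0 : 0 <= K ^+ n.*2 * gauss_moment n :> R by rewrite mulr_ge0 ?gauss_moment_ge0 ?exprn_ge0.
set E := fine _ in e0 *.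
apply: (@le_trans _ _ (E + C2 * (K ^+ 2 * gauss_moment 1 * k * E + K ^+ n.*2 * gauss_moment n * k * E))).
  rewrite lerD2l ler_wpM2l//; apply: lerD; first by rewrite expr1 mulrA.
  by rewrite mulrA; apply: ler_wpM2r => //; exact: ler_wpM2l.
by rewrite le_eqVlt; apply/orP; left; apply/eqP; ring.
Qed.

End noise_step.

(** * A potential for the running maximum *)

Section potential.
Context {R : realType} (p : R) (N : nat).
Hypotheses (p_ge2 : 2 <= p) (p_leN : p <= N%:R).

Let p_gt0 : 0 < p. Proof. exact: lt_le_trans p_ge2. Qed.
Let N_ge2 : (2 <= N)%N. Proof. by rewrite -(ler_nat R) (le_trans p_ge2). Qed.

Lemma expR_le_quadratic (u : R) : `|u| <= 2^-1 -> expR u <= 1 + u + 2 * u ^+ 2.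
Proof.
rewrite ler_norml => /andP[u1 u2].
have h : 0 < 1 - u by lra.
have : expR u <= (1 - u)^-1.
  rewrite -[u]opprK expRN lef_pV2 ?posrE ?expR_gt0//; last by rewrite opprK.
  by have := expR_ge1Dx (- u); rewrite opprK.
move=> /le_trans; apply; rewrite -[leLHS]mul1r ler_pdivrMr//.
have := sqr_ge0 u; have := mulr_ge0 (sqr_ge0 u) (_ : 0 <= 1 - 2 * u); nra.
Qed.

(** The first summand is the quadratic error of exp (p x) for small p x; the second covers large
    x. *)
Definition powR_taylor : R := 2 * p ^+ 2 + (2 * p + 1) ^+ N.

Lemma exprn_le_ends (x : R) (i j k : nat) : 0 <= x -> (i <= j <= k)%N ->
  x ^+ j <= x ^+ i + x ^+ k.
Proof.
move=> x0 /andP[ij jk]; have [x1|/ltW x1] := leP x 1.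
  by apply: (@le_trans _ _ (x ^+ i)); [rewrite ler_wiXn2l|rewrite lerDl exprn_ge0].
by apply: (@le_trans _ _ (x ^+ k)); [rewrite ler_weXn2l|rewrite lerDr exprn_ge0].
Qed.

(** For |p x| <= 1/2 the power is at most exp (p x). Otherwise 1 + |x| <= (2 p + 1) |x|, and the
    power is at most the N-th power of the right side. The even exponents 2 and 2N on the right are
    those for which Gaussian moments are at hand. *)
Lemma powR1D_le (x : R) : -1 <= x ->
  (1 + x) `^ p <= 1 + p * x + powR_taylor * (x ^+ 2 + x ^+ N.*2).
Proof.
move=> x1.
have xN : 0 <= x ^+ N.*2 by rewrite -mul2n exprM exprn_ge0// sqr_ge0.
have c0 : 0 <= (2 * p + 1) ^+ N by rewrite exprn_ge0// addr_ge0// mulr_ge0// ltW.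
have q0 : 0 <= 2 * p ^+ 2 by rewrite mulr_ge0 ?sqr_ge0.
have x2 := sqr_ge0 x.
have [xs|xl] := leP `|p * x| 2^-1.
  apply: (@le_trans _ _ (expR (p * x))).
    rewrite /powR; case: ifPn => _; first by rewrite gt_eqF//= expR_ge0.
    rewrite ler_expR ler_wpM2l ?(ltW p_gt0)// le_ln1Dx//.
    rewrite lt_neqAle x1 andbT; apply/eqP => xE; move: xs.
    rewrite -xE mulrN1 normrN gtr0_norm//; apply/negP; rewrite -ltNge.
    by apply: lt_le_trans p_ge2; lra.
  apply: (le_trans (expR_le_quadratic xs)); rewrite lerD2l exprMn /powR_taylor.
  have := mulr_ge0 q0 xN; have := mulr_ge0 c0 x2; have := mulr_ge0 c0 xN; lra.
have ax : 1 <= 2 * p * `|x|.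
  by move: xl; rewrite normrM (gtr0_norm p_gt0) => ?; rewrite -mulrA; lra.
apply: (@le_trans _ _ ((2 * p + 1) ^+ N * (x ^+ 2 + x ^+ N.*2))); last first.
  (* For large x the affine part may be negative, but part of the quadratic term outweighs it. *)
  have : 0 <= 1 + p * x + 2 * p ^+ 2 * x ^+ 2.
    have : p * `|x| <= 2 * p ^+ 2 * x ^+ 2.
      rewrite -[x ^+ 2]real_normK ?num_real//.
      have -> : 2 * p ^+ 2 * `|x| ^+ 2 = (2 * p * `|x|) * (p * `|x|) by ring.
      by rewrite ler_peMl// mulr_ge0// ltW.
    have : - (p * `|x|) <= p * x by rewrite -mulrN ler_pM2l// lerNl -normrN ler_norm.
    lra.
  have := mulr_ge0 q0 xN; rewrite /powR_taylor; nra.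
apply: (@le_trans _ _ ((2 * p + 1) ^+ N * `|x| ^+ N)); last first.
  rewrite ler_wpM2l//; apply: (le_trans (exprn_le_ends (normr_ge0 x) (_ : 2 <= N <= N.*2)%N)).
    by rewrite N_ge2 -addnn leq_addr.
  by rewrite -mul2n !exprM real_normK ?num_real.
rewrite -exprMn; have y1 : 1 <= 1 + `|x| by rewrite lerDl.
apply: (@le_trans _ _ ((1 + `|x|) `^ N%:R)).
  apply: (@le_trans _ _ ((1 + `|x|) `^ p)); last exact: ler_powR.
  apply: ge0_ler_powR; rewrite ?nnegrE ?(ltW p_gt0)//; first lra.
  by rewrite lerD2l ler_norm.
have y2 : 1 + `|x| <= (2 * p + 1) * `|x| by rewrite mulrDl mul1r lerD2r.
have y0 : 0 <= 1 + `|x| by exact: le_trans y1.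
rewrite powR_mulrn//; apply: lerXn2r => //; rewrite nnegrE//.
exact: le_trans y2.
Qed.

(** The exponent conjugate to [p], which is also the constant in Doob's maximal inequality. *)
Definition pot_a : R := p / (p - 1).

Definition pot_K : R := pot_a * (2 * pot_a) `^ (p - 1).

(* The potential for s the running maximum of r. The first two terms do not
   increase when a new maximum is reached, which is Doob's inequality in pathwise
   form; the last one makes [pot] comparable to s^p. *)
Definition pot (s r : R) : R := s `^ p - pot_a * s `^ (p - 1) * r + pot_K * r `^ p.

(** The derivative of [pot s r] in [r] at fixed [s], hence the coefficient of the martingale
    increment. *)
Definition pot_coef (s r : R) : R := pot_K * p * r `^ (p - 1) - pot_a * s `^ (p - 1).

Let p1_gt0 : 0 < p - 1. Proof. by rewrite subr_gt0; apply: lt_le_trans p_ge2; rewrite ltr1n. Qed.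

Let a_gt0 : 0 < pot_a. Proof. exact: divr_gt0. Qed.

Let K_ge0 : 0 <= pot_K. Proof. by rewrite mulr_ge0 ?powR_ge0// ltW. Qed.

Lemma powRB1M (x : R) : 0 <= x -> x `^ (p - 1) * x = x `^ p.
Proof. by move=> x0; rewrite mulrC mulr_powRB1. Qed.

Lemma pot_ge (s r : R) : 0 < r -> r <= s -> s `^ p / 2 <= pot s r.
Proof.
move=> r0 rs; have s0 : 0 < s by exact: lt_le_trans rs.
have sp := powR_ge0 s p; have rp := powR_ge0 r p.
have [H|H] := leP (2 * pot_a * r) s.
  have : pot_a * s `^ (p - 1) * r <= s `^ p / 2.
    rewrite -(powRB1M (ltW s0)).
    have -> : pot_a * s `^ (p - 1) * r = s `^ (p - 1) * (2 * pot_a * r) / 2 by field.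
    by rewrite ler_pM2r// ler_wpM2l ?powR_ge0.
  rewrite /pot; have := mulr_ge0 K_ge0 rp; lra.
have : pot_a * s `^ (p - 1) * r <= pot_K * r `^ p.
  rewrite -(powRB1M (ltW r0)).
  have -> : pot_K * (r `^ (p - 1) * r) =
    pot_a * ((2 * pot_a) `^ (p - 1) * r `^ (p - 1)) * r by rewrite /pot_K; ring.
  have a20 : 0 <= 2 * pot_a by rewrite mulr_ge0// ltW.
  rewrite ler_pM2r// ler_pM2l// -powRM// ?(ltW r0)//.
  apply: ge0_ler_powR; rewrite ?nnegrE ?(ltW p1_gt0) ?(ltW s0) ?(ltW H)//.
  exact: mulr_ge0 a20 (ltW r0).
rewrite /pot; lra.
Qed.

(** Only a new maximum r > s needs an argument. There the left side equals - r^p / (p - 1), and the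
    claim is Young's inequality p s^(p-1) r <= r^p + (p - 1) s^p. *)
Lemma doob_potential (s r : R) : 0 < r -> 0 < s ->
  Num.max s r `^ p - pot_a * Num.max s r `^ (p - 1) * r <=
  s `^ p - pot_a * s `^ (p - 1) * r.
Proof.
move=> r0 s0; have [//|sr] := leP r s.
rewrite -mulrA (powRB1M (ltW r0)).
have := @conjugate_powR _ r (s `^ (p - 1)) p pot_a (ltW r0) (powR_ge0 _ _) p_gt0 a_gt0.
rewrite -powRrM {2}/pot_a mulrCA mulfV ?mulr1 ?gt_eqF//.
have -> : p^-1 + pot_a^-1 = 1 by rewrite /pot_a; field; rewrite !gt_eqF.
move=> /(_ erefl).
have -> : s `^ p / pot_a = (1 - p^-1) * s `^ p by rewrite /pot_a; field; rewrite !gt_eqF.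
have -> : pot_a = p * (p - 1)^-1 by [].
set x := r * _ => H; have {}H : p * x <= r `^ p + (p - 1) * s `^ p.
  rewrite -(ler_pM2l p_gt0) in H; apply: (le_trans H); rewrite le_eqVlt; apply/orP; left.
  by apply/eqP; field; rewrite gt_eqF.
rewrite -(ler_pM2l p1_gt0).
have -> : (p - 1) * (r `^ p - p * (p - 1)^-1 * r `^ p) = - r `^ p by field; rewrite gt_eqF.
have -> : (p - 1) * (s `^ p - p * (p - 1)^-1 * s `^ (p - 1) * r) = (p - 1) * s `^ p - p * x.
  by rewrite /x; field; rewrite gt_eqF.
lra.
Qed.

(** Bounding the martingale coefficient by the potential itself gives the domination that makes the
    stochastic term integrable. *)
Lemma pot_coef_le (s r : R) : 0 < r -> r <= s ->
  `|pot_coef s r| * r <= 2 * (pot_K * p + pot_a) * pot s r.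
Proof.
move=> r0 rs; have s0 : 0 < s by exact: lt_le_trans rs.
have ps := pot_ge r0 rs.
apply: (@le_trans _ _ ((pot_K * p + pot_a) * s `^ p)); last first.
  have H : s `^ p <= 2 * pot s r by lra.
  have -> : 2 * (pot_K * p + pot_a) * pot s r = (pot_K * p + pot_a) * (2 * pot s r) by ring.
  by apply: ler_wpM2l => //; apply: addr_ge0; [exact: mulr_ge0 K_ge0 (ltW p_gt0)|exact: ltW].
have mono : r `^ (p - 1) <= s `^ (p - 1).
  by apply: ge0_ler_powR; rewrite ?nnegrE ?(ltW p1_gt0) ?(ltW s0) ?(ltW r0).
rewrite -(powRB1M (ltW s0)) mulrA; apply: ler_pM => //; first exact: ltW.
apply: (le_trans (ler_normB _ _)); rewrite mulrDl.
have Kp0 : 0 <= pot_K * p by exact: mulr_ge0 K_ge0 (ltW p_gt0).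
rewrite (ger0_norm (mulr_ge0 Kp0 (powR_ge0 r _))).
rewrite (ger0_norm (mulr_ge0 (ltW a_gt0) (powR_ge0 s _))).
by rewrite lerD2r; apply: ler_wpM2l.
Qed.

(** The leading 2 comes from r^p <= s^p <= 2 [pot s r]. Inside, the first term is the drift seen by
    [pot_coef], the second the Taylor remainder, with powers of [2 * (2 + C)] from the size of the
    relative increment. *)
Definition pot_const (C : R) : R :=
  2 * (pot_K * p * C + pot_K * powR_taylor *
    ((2 * (2 + C)) ^+ 2 + (2 * (2 + C)) ^+ N.*2)).

(** Everything is measured by x, the increment of [r] divided by [r]; as [z <= r], it is at most a
    multiple of [eta + eta ^+ 2]. The part linear in [M] is kept exactly because its mean will
    vanish; the rest is of second order in [eta] and proportional to the potential. *)
Lemma pot_step (C s r z M eta : R) : 0 <= C -> 0 < z -> z <= r -> r <= s ->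
  0 <= eta -> `|M| <= eta * z -> 0 < r + 2 * M + C * eta ^+ 2 * z ->
  pot (Num.max s (r + 2 * M + C * eta ^+ 2 * z)) (r + 2 * M + C * eta ^+ 2 * z) <=
  pot s r + pot_coef s r * (2 * M)
    + pot_const C * (pot s r * (eta ^+ 2 + eta ^+ (N.*2).*2)).
Proof.
move=> C0 z0 zr rs eta0 Mz; set r' := r + 2 * M + _ => r'0.
have r0 : 0 < r by exact: lt_le_trans zr.
have s0 : 0 < s by exact: lt_le_trans rs.
set mu := 2 * M + C * eta ^+ 2 * z.
have r'E : r' = r + mu by rewrite /r' /mu addrA.
set x := mu / r.
have xr : r' = r * (1 + x) by rewrite r'E /x; field; rewrite gt_eqF.
have x1 : -1 <= x.
  by rewrite -subr_ge0 opprK addrC -(pmulr_rge0 _ r0) -xr ltW.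
have xB : `|x| <= (2 + C) * (eta + eta ^+ 2).
  rewrite /x normrM (gtr0_norm (_ : 0 < r^-1)) ?invr_gt0// ler_pdivrMr//.
  apply: (le_trans (ler_normD _ _)).
  have ez : eta * z <= eta * r by rewrite ler_wpM2l.
  have e2z : eta ^+ 2 * z <= eta ^+ 2 * r by rewrite ler_wpM2l ?sqr_ge0.
  have e0 : 0 <= eta * z by rewrite mulr_ge0// ltW.
  have e20 : 0 <= eta ^+ 2 * z by rewrite mulr_ge0 ?sqr_ge0// ltW.
  rewrite normrM ger0_norm// [X in _ + X]ger0_norm; last by rewrite -mulrA mulr_ge0.
  have := ler_wpM2l C0 e2z; have := mulr_ge0 C0 (le_trans e0 ez).
  move: Mz ez e2z e0 e20; rewrite mulrDr !mulrDl !mulrA; nra.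
(* The bound on |x| is of order eta for eta <= 1 and of order eta^2 beyond; in the second regime
   x^(2N) reaches eta^(4N), the highest moment required. *)
have xx : x ^+ 2 + x ^+ N.*2 <= ((2 * (2 + C)) ^+ 2 + (2 * (2 + C)) ^+ N.*2) *
    (eta ^+ 2 + eta ^+ (N.*2).*2).
  have dbl m : (m <= m.*2)%N by rewrite -addnn leq_addr.
  have B0 : 0 <= 2 * (2 + C) by rewrite mulr_ge0// addr_ge0.
  have gen (j : nat) : (2 <= j <= N.*2)%N -> `|x| ^+ j <=
      (2 * (2 + C)) ^+ j * (eta ^+ 2 + eta ^+ (N.*2).*2).
    move=> /andP[j2 jN].
    have B1 : 0 <= 2 + C by rewrite addr_ge0.
    have [e1|/ltW e1] := leP eta 1.
      apply: (@le_trans _ _ ((2 * (2 + C) * eta) ^+ j)).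
        apply: lerXn2r; rewrite ?nnegrE ?mulr_ge0//; apply: (le_trans xB).
        have -> : 2 * (2 + C) * eta = (2 + C) * (2 * eta) by ring.
        apply: ler_wpM2l => //; have := ler_wpM2l eta0 e1; rewrite -expr2; lra.
      rewrite exprMn; apply: ler_wpM2l; first exact: exprn_ge0.
      by apply: exprn_le_ends => //; rewrite j2 (leq_trans jN (dbl _)).
    apply: (@le_trans _ _ ((2 * (2 + C) * eta ^+ 2) ^+ j)).
      have e2 := sqr_ge0 eta.
      apply: lerXn2r; rewrite ?nnegrE ?mulr_ge0//; apply: (le_trans xB).
      have -> : 2 * (2 + C) * eta ^+ 2 = (2 + C) * (2 * eta ^+ 2) by ring.
      apply: ler_wpM2l => //; have := ler_wpM2l eta0 e1; rewrite -expr2; lra.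
    rewrite exprMn -exprM; apply: ler_wpM2l; first exact: exprn_ge0.
    apply: exprn_le_ends => //; rewrite mul2n leq_double jN andbT.
    exact: leq_trans j2 (dbl _).
  rewrite mulrDl; apply: lerD.
    rewrite -[x ^+ 2]real_normK ?num_real//; apply: gen.
    by rewrite leqnn/= (leq_trans N_ge2 (dbl _)).
  have -> : x ^+ N.*2 = `|x| ^+ N.*2 by rewrite -mul2n !exprM real_normK ?num_real.
  by apply: gen; rewrite leqnn andbT (leq_trans N_ge2 (dbl _)).
set tau := (2 * (2 + C)) ^+ 2 + _ in xx.
set E := eta ^+ 2 + _ in xx *.
have tau0 : 0 <= tau.
  by rewrite addr_ge0// exprn_ge0// mulr_ge0// addr_ge0.
have E0 : 0 <= E by rewrite addr_ge0// exprn_ge0.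
have eE : eta ^+ 2 <= E by rewrite lerDl exprn_ge0.
have rp0 := powR_ge0 r p; have rp10 := powR_ge0 r (p - 1); have sp10 := powR_ge0 s (p - 1).
have T0 : 0 <= powR_taylor.
  apply: addr_ge0; first by apply: mulr_ge0 => //; exact: sqr_ge0.
  by apply: exprn_ge0; apply: addr_ge0 => //; apply: mulr_ge0 => //; exact: ltW.
have U := doob_potential r'0 s0.
have W : r' `^ p <= r `^ p + p * r `^ (p - 1) * mu + powR_taylor * tau * E * r `^ p.
  rewrite xr powRM ?(ltW r0)//; last by rewrite -lerBlDl sub0r.
  apply: (le_trans (ler_wpM2l rp0 (powR1D_le x1))).
  have -> : p * r `^ (p - 1) * mu = r `^ p * (p * x).
    by rewrite -(powRB1M (ltW r0)) /x; field; rewrite gt_eqF.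
  have := ler_wpM2l T0 xx; move: (x ^+ 2 + _) => y H.
  have := ler_wpM2l rp0 H; move: (p * x) (powR_taylor * y) => u v.
  rewrite !mulrA; lra.
have rs' : r `^ p <= s `^ p.
  by apply: ge0_ler_powR; rewrite ?nnegrE; [exact: ltW|exact: ltW|exact: ltW|].
have rpot : r `^ p <= 2 * pot s r by have := pot_ge r0 rs; lra.
have cz : pot_coef s r * (C * eta ^+ 2 * z) <= pot_K * p * C * E * r `^ p.
  have w0 : 0 <= C * eta ^+ 2 * z by rewrite !mulr_ge0 ?sqr_ge0// ltW.
  apply: (@le_trans _ _ (pot_K * p * r `^ (p - 1) * (C * eta ^+ 2 * z))).
    apply: ler_wpM2r => //; rewrite lerBlDr lerDl; exact: mulr_ge0 (ltW a_gt0) sp10.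
  have -> : pot_K * p * C * E * r `^ p = pot_K * p * r `^ (p - 1) * (C * E * r).
    by rewrite -(powRB1M (ltW r0)); ring.
  apply: ler_wpM2l; first exact: mulr_ge0 (mulr_ge0 K_ge0 (ltW p_gt0)) rp10.
  apply: ler_pM => //; [by rewrite mulr_ge0 ?sqr_ge0|exact: ltW|].
  exact: ler_wpM2l.
have KW := ler_wpM2l K_ge0 W.
have main : pot (Num.max s r') r' <= pot s r + pot_coef s r * mu
    + pot_K * (powR_taylor * tau * E * r `^ p).
  apply: (le_trans (lerD U KW)); rewrite le_eqVlt; apply/orP; left; apply/eqP.
  by rewrite r'E /pot /pot_coef; ring.
apply: (le_trans main).
have -> : pot_coef s r * mu = pot_coef s r * (2 * M) + pot_coef s r * (C * eta ^+ 2 * z).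
  by rewrite -mulrDr.
rewrite -!addrA !lerD2l.
apply: (@le_trans _ _ ((pot_K * p * C + pot_K * powR_taylor * tau) * E * r `^ p)).
  apply: (@le_trans _ _ (pot_K * p * C * E * r `^ p + pot_K * (powR_taylor * tau * E * r `^ p))).
    by rewrite lerD2r.
  by rewrite le_eqVlt; apply/orP; left; apply/eqP; ring.
have -> : pot_const C * (pot s r * E) = (pot_K * p * C + pot_K * powR_taylor * tau) * E * (2 * pot s r).
  by rewrite /pot_const -/tau; ring.
apply: ler_wpM2l => //; apply: mulr_ge0 => //; apply: addr_ge0.
  exact: mulr_ge0 (mulr_ge0 K_ge0 (ltW p_gt0)) C0.
exact: mulr_ge0 (mulr_ge0 K_ge0 T0) tau0.
Qed.

End potential.

(** * Limits and measurability of nodal quantities *)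

(** The form is abstract and only semidefinite, so that one statement serves both [dot] at a node
    and the Dirichlet form [stiff]. *)
Lemma minkowski_sum (R : realFieldType) (V : lmodType R) (q : V -> V -> R)
    (qC : forall u v, q u v = q v u)
    (qD : forall u v w, q (u + v) w = q u w + q v w)
    (qZ : forall s u v, q (s *: u) v = s * q u v)
    (q_ge0 : forall u, 0 <= q u u)
    (N : nat) (s c : nat -> R) (g : nat -> V) :
  (forall l, 0 <= c l) -> (forall l, q (g l) (g l) <= c l ^+ 2) ->
  q (\sum_(l < N) s l *: g l) (\sum_(l < N) s l *: g l)
    <= (\sum_(l < N) c l * `|s l|) ^+ 2.
Proof.
move=> c0 gc.
have qDr u v w : q w (u + v) = q w u + q w v by rewrite !(qC w) qD.
have qZr t u v : q v (t *: u) = t * q v u by rewrite !(qC v) qZ.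
have CS u v : q u v ^+ 2 <= q u u * q v v.
  apply: sqr_le_mul_of_quadratic => // t; have := q_ge0 (u + t *: v).
  rewrite qD !qDr !qZ !qZr (qC v u); congr (_ <= _); ring.
have q00 : q 0 0 = 0 by rewrite -{1}(scale0r 0) qZ mul0r.
elim: N => [|N IH]; first by rewrite !big_ord0 q00 expr0n.
rewrite !big_ord_recr/=; set u := \sum_(l < N) s l *: g l in IH *.
set b := \sum_(l < N) c l * `|s l| in IH *.
have b0 : 0 <= b by apply: sumr_ge0 => l _; rewrite mulr_ge0.
set v := s N *: g N; have d0 : 0 <= c N * `|s N| by rewrite mulr_ge0.
have vd : q v v <= (c N * `|s N|) ^+ 2.
  rewrite /v qZ qZr mulrA -expr2 exprMn mulrC real_normK ?num_real//.
  by rewrite ler_wpM2r ?sqr_ge0.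
have uv : q u v <= b * (c N * `|s N|).
  apply: le_trans (ler_norm _) _.
  rewrite -(@ler_pXn2r _ 2)// ?nnegrE// ?mulr_ge0// real_normK ?num_real//.
  by apply: (le_trans (CS u v)); rewrite exprMn; apply: ler_pM.
rewrite qD !qDr (qC v u) sqrrD; lra.
Qed.

Section limits.
Context {R : realType}.

Lemma cvg_sumr (I : Type) (r : seq I) (f : I -> nat -> R) (l : I -> R) :
  (forall i, f i @ \oo --> l i) ->
  (fun N => \sum_(i <- r) f i N) @ \oo --> \sum_(i <- r) l i.
Proof.
move=> fl; elim: r => [|i r IH].
  by rewrite big_nil; under eq_cvg do rewrite big_nil; exact: cvg_cst.
rewrite big_cons; under eq_cvg do rewrite big_cons.
by apply: cvgD.
Qed.

Lemma cvg_rV3 (u : nat -> 'rV[R]_3) (v : 'rV[R]_3) :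
  (forall c, (fun N => u N 0 c) @ \oo --> v 0 c) -> u @ \oo --> v.
Proof.
move=> uv A [P HP PA].
have H : \forall N \near \oo, forall c, P 0 c (u N 0 c).
  by apply: filter_forall => c; exact: (uv c _ (HP 0 c)).
apply: filterS H => N H; apply: PA => i c /=.
by rewrite (ord1 i); exact: H.
Qed.

Lemma cvg_rV3_coord (u : nat -> 'rV[R]_3) (v : 'rV[R]_3) c :
  u @ \oo --> v -> (fun N => u N 0 c) @ \oo --> v 0 c.
Proof.
move=> uv; apply: (@continuous_cvg _ _ _ _ _ _ (fun M : 'rV[R]_3 => M 0 c)) => //.
exact: coord_continuous.
Qed.

Lemma cvg_dot (u w : nat -> 'rV[R]_3) (u' w' : 'rV[R]_3) :
  u @ \oo --> u' -> w @ \oo --> w' -> (fun N => dot (u N) (w N)) @ \oo --> dot u' w'.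
Proof.
move=> uu ww; under eq_cvg => N do rewrite dotE; rewrite dotE.
by apply: cvgD; [apply: cvgD|]; apply: cvgM; exact: cvg_rV3_coord.
Qed.

Lemma cvg_cross (x : 'rV[R]_3) (w : nat -> 'rV[R]_3) (w' : 'rV[R]_3) :
  w @ \oo --> w' -> (fun N => cross x (w N)) @ \oo --> cross x w'.
Proof.
move=> ww; apply: cvg_rV3 => c; rewrite mxE.
under eq_cvg => N do rewrite mxE.
by apply: cvgB; apply: cvgMl_tmp; exact: cvg_rV3_coord.
Qed.

Variables (n : nat) (h : nat -> R).

Lemma cvg_stiff (U : nat -> nat -> 'rV[R]_3) (u : nat -> 'rV[R]_3) :
  (forall i, (i <= n)%N -> U ^~ i @ \oo --> u i) ->
  (fun N => stiff n h (U N) (U N)) @ \oo --> stiff n h u u.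
Proof.
move=> Uu; apply: cvg_sumr => i; apply: cvgMr_tmp.
have d : (fun N => U N i.+1 - U N i) @ \oo --> u i.+1 - u i.
  by apply: cvgB; apply: Uu => //; exact: ltnW.
exact: cvg_dot.
Qed.

Lemma cvg_torque_form a (U : nat -> nat -> 'rV[R]_3) (u v : nat -> 'rV[R]_3) :
  (forall i, (i <= n)%N -> U ^~ i @ \oo --> u i) ->
  (fun N => torque_form n h a (U N) v) @ \oo --> torque_form n h a u v.
Proof.
move=> Uu; apply: cvg_sumr => i; apply: cvgMr_tmp; apply: cvg_dot; last exact: cvg_cst.
by apply: cvg_cross; apply: cvgB; apply: Uu => //; exact: ltnW.
Qed.

End limits.

Section measurability.
Context d (T : measurableType d) {R : realType}.
Implicit Types u v : T -> 'rV[R]_3.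

Definition coord_measurable u := forall c, measurable_fun setT (fun w => u w 0 c).

Lemma coord_measurable_dot u v : coord_measurable u -> coord_measurable v ->
  measurable_fun setT (fun w => dot (u w) (v w)).
Proof.
by move=> mu mv; apply: measurable_sum => i; exact: measurable_funM.
Qed.

Lemma coord_measurable_cst (x : 'rV[R]_3) : coord_measurable (fun=> x).
Proof. by move=> c; exact: measurable_cst. Qed.

Lemma coord_measurableD u v : coord_measurable u -> coord_measurable v ->
  coord_measurable (fun w => u w + v w).
Proof.
move=> mu mv c; under eq_fun do rewrite mxE.
exact: measurable_funD.
Qed.

Lemma coord_measurableB u v : coord_measurable u -> coord_measurable v ->
  coord_measurable (fun w => u w - v w).
Proof.
move=> mu mv c; under eq_fun do rewrite !mxE.
exact: measurable_funB.
Qed.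

Lemma coord_measurableZ (s : R) u : coord_measurable u ->
  coord_measurable (fun w => s *: u w).
Proof.
move=> mu c; under eq_fun do rewrite !mxE.
exact: measurable_funM.
Qed.

Lemma coord_measurable_cross u v : coord_measurable u -> coord_measurable v ->
  coord_measurable (fun w => cross (u w) (v w)).
Proof.
move=> mu mv c; under eq_fun do rewrite mxE.
by apply: measurable_funB; exact: measurable_funM.
Qed.

Variables (n : nat) (h : nat -> R).
Implicit Types a b : nat -> T -> 'rV[R]_3.

Lemma measurable_stiff a b : (forall i, (i <= n)%N -> coord_measurable (a i)) ->
  (forall i, (i <= n)%N -> coord_measurable (b i)) ->
  measurable_fun setT (fun w => stiff n h (a ^~ w) (b ^~ w)).
Proof.
move=> ma mb.
apply: measurable_sum => i; apply: measurable_funM => //.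
by apply: coord_measurable_dot; apply: coord_measurableB; (apply: ma || apply: mb) => //; exact: ltnW.
Qed.

Lemma measurable_trap (f : nat -> T -> R) : (forall i, (i <= n)%N -> measurable_fun setT (f i)) ->
  measurable_fun setT (fun w => trap n h (f ^~ w)).
Proof.
move=> mf; apply: measurable_sum => i; apply: measurable_funM => //; apply: measurable_funM => //.
by apply: measurable_funD; apply: mf => //; exact: ltnW.
Qed.

Lemma measurable_torque_form a b (u : nat -> 'rV[R]_3) :
  (forall i, (i <= n)%N -> coord_measurable (a i)) ->
  (forall i, (i <= n)%N -> coord_measurable (b i)) ->
  measurable_fun setT (fun w => torque_form n h (a ^~ w) u (b ^~ w)).
Proof.
move=> ma mb; apply: measurable_sum => i; apply: measurable_funM => //.
apply: coord_measurable_dot.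
  apply: coord_measurable_cross; last exact: coord_measurable_cst.
  by apply: coord_measurableZ; apply: coord_measurableD; apply: ma => //; exact: ltnW.
by apply: coord_measurableB; apply: mb => //; exact: ltnW.
Qed.

Lemma coord_measurable_nodal_laplacian b i :
  (forall i, (i <= n)%N -> coord_measurable (b i)) ->
  coord_measurable (fun w => nodal_laplacian n h (b ^~ w) i).
Proof.
move=> mb c; under eq_fun do rewrite mxE.
have H := @measurable_stiff b (fun j _ => nodal_unit i c j) mb
  (fun j _ => coord_measurable_cst (nodal_unit i c j)).
by apply: measurable_funM => //; exact: measurable_funN H.
Qed.

End measurability.

Section sub_sigma_algebra.
Context d (Omega : measurableType d) {R : realType}.

(** Adaptedness becomes ordinary measurability for the type carrying the sub-sigma-algebra, where
    the closure properties of measurable functions apply. *)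
Lemma rv_measurableP (F : set (set Omega)) (sF : sigma_algebra setT F) (f : Omega -> R) :
  rv_measurable F f <-> measurable_fun setT (f : g_sigma_algebraType F -> R).
Proof.
have E : forall A : set Omega, (measurable (A : set (g_sigma_algebraType F))) = F A.
  by move=> A; rewrite -[in RHS](sigma_algebra_id sF).
split=> H.
  by move=> _ B mB; rewrite setTI E; exact: H.
by move=> B mB; rewrite -E -[_ @^-1` _]setTI; exact: H.
Qed.

End sub_sigma_algebra.

(** * Pathwise energy inequality *)

Lemma cvgn_of_normed_bound (R : realType) (a : nat -> R) (B : R) :
  (forall N, \sum_(l < N) `|a l| <= B) ->
  cvgn (fun N => \sum_(0 <= l < N) a l).
Proof.
move=> aB; apply: (@normed_cvg R R^o a).
apply: nondecreasing_is_cvgn.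
  by apply: nondecreasing_series => k _ _; exact: normr_ge0.
by exists B => _ [N _ <-]; have := aB N; rewrite -(big_mkord xpredT (fun l => `|a l|)).
Qed.

Section noise.
Context {R : realType} (L : R) (L_gt0 : 0 < L) (Th : mesh L).
Notation n := (nelt Th).
Notation z := (node Th).
Notation h := (fun i : nat => node Th i.+1 - node Th i).
Variables (Omega : Type) (g : nat -> R -> 'rV[R]_3) (beta : nat -> R -> Omega -> R).
Hypothesis smooth_g : forall l, smooth_datum L (g l).
Notation c := (fun l => sobolev_const L * Hnorm L 3 (g l)).
Variables (t t' : R) (w : Omega).
Notation D := (fun l => increment (beta l) t t' w).

Lemma noise_weight_ge0 l : 0 <= c l.
Proof. by rewrite mulr_ge0 ?sqrtr_ge0// (le_trans ler01)// sobolev_const_ge1. Qed.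

Variable B : R.
Hypothesis noise_bound : forall N, \sum_(l < N) c l * `|D l| <= B.

Lemma noise_increment_cvg i : (i <= n)%N ->
  (fun N => \sum_(l < N) D l *: g l (z i)) @ \oo --> noise_increment Th g beta t t' w (z i).
Proof.
move=> iN.
pose S N : 'rV[R]_3 := \sum_(l < N) D l *: g l (z i).
have Sc N k : S N 0 k = \sum_(0 <= l < N) D l * g l (z i) 0 k.
  by rewrite /S summxE big_mkord; apply: eq_bigr => l _; rewrite mxE.
have cvgS k : cvgn (fun N => S N 0 k).
  have -> : (fun N => S N 0 k) = (fun N => \sum_(0 <= l < N) D l * g l (z i) 0 k).
    by apply/funext => N; exact: Sc.
  apply: (@cvgn_of_normed_bound _ (fun l => D l * g l (z i) 0 k) B) => N; apply: le_trans (noise_bound N).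
  apply: ler_sum => l _; rewrite normrM mulrC ler_wpM2r//.
  have c0 := noise_weight_ge0 l.
  rewrite -(@ler_pXn2r _ 2)// ?nnegrE// real_normK ?num_real//.
  apply: (le_trans (coord_sqr_le_dot _ _)); apply: sobolev_sup => //.
  exact: node_in.
have SV : S @ \oo --> (\row_k limn (fun N => S N 0 k) : 'rV[R]_3).
  by apply: cvg_rV3 => k; rewrite mxE; exact: cvgS.
suff -> : noise_increment Th g beta t t' w (z i) = \row_k limn (fun N => S N 0 k) by exact: SV.
rewrite /noise_increment; apply: cvg_lim => //; apply: cvg_trans SV.
apply: near_eq_cvg; apply: nearW => N; rewrite /S big_mkord.
by apply: eq_bigr => l _; rewrite interp_node.
Qed.

(** Linearity in the noise exhibits the martingale term as a series of Brownian increments with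
    coefficients fixed at the beginning of the step. *)
Lemma noise_increment_torque (a v : nat -> 'rV[R]_3) :
  (fun N => \sum_(l < N) D l * torque_form n h a (g l \o z) v) @ \oo -->
  torque_form n h a (noise_increment Th g beta t t' w \o z) v.
Proof.
pose U N i := \sum_(l < N) D l *: g l (z i).
have := @cvg_torque_form _ n h a U (noise_increment Th g beta t t' w \o z) v
  (fun i iN => noise_increment_cvg iN).
have E N : torque_form n h a (U N) v = \sum_(l < N) D l * torque_form n h a (g l \o z) v.
  elim: N => [|N IH].
    rewrite big_ord0 /torque_form big1// => i _; rewrite /U !big_ord0 subrr.
    have -> : cross (2^-1 *: (a i + a i.+1)) 0 = 0 :> 'rV[R]_3.
      by apply/rowP => k; rewrite !mxE !mulr0 subrr.
    by rewrite dot0l mul0r.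
  transitivity (torque_form n h a (U N) v + D N * torque_form n h a (g N \o z) v).
    rewrite -torque_formZl -torque_formDl.
    by apply: eq_bigr => i _ /=; rewrite /U !big_ord_recr.
  by rewrite IH [RHS]big_ord_recr.
by under eq_fun do rewrite E.
Qed.

Hypothesis B_ge0 : 0 <= B.

Lemma noise_increment_sup i : (i <= n)%N ->
  dot (noise_increment Th g beta t t' w (z i)) (noise_increment Th g beta t t' w (z i))
  <= B ^+ 2.
Proof.
move=> iN; have C := cvg_dot (noise_increment_cvg iN) (noise_increment_cvg iN).
rewrite -(cvg_lim (@norm_hausdorff _ _) C).
apply: limr_le; first by apply/cvg_ex; eexists; exact: C.
apply: nearW => N.
apply: (@le_trans _ _ ((\sum_(l < N) c l * `|D l|) ^+ 2)).
  apply: (@minkowski_sum _ _ (@dot R) _ _ _ _ N D c (fun l => g l (z i))).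
  - exact: dotC.
  - exact: dotDl.
  - exact: dotZl.
  - exact: dot_ge0.
  - exact: noise_weight_ge0.
  - by move=> l; apply: sobolev_sup => //; exact: node_in.
by apply: lerXn2r; rewrite ?nnegrE// sumr_ge0// => l _; rewrite mulr_ge0// noise_weight_ge0.
Qed.

Lemma noise_increment_stiff :
  stiff n h (noise_increment Th g beta t t' w \o z) (noise_increment Th g beta t t' w \o z)
  <= B ^+ 2.
Proof.
pose U N i := \sum_(l < N) D l *: g l (z i).
have C := @cvg_stiff _ n h U (noise_increment Th g beta t t' w \o z)
  (fun i iN => noise_increment_cvg iN).
rewrite -(cvg_lim (@norm_hausdorff _ _) C).
apply: limr_le; first by apply/cvg_ex; eexists; exact: C.
apply: nearW => N.
apply: (@le_trans _ _ ((\sum_(l < N) c l * `|D l|) ^+ 2)).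
  have -> : U N = \sum_(l < N) D l *: (g l \o z).
    by apply/funext => i; rewrite fct_sumE.
  apply: (@minkowski_sum _ _ (stiff n h) _ _ _ _ N D c (fun l => g l \o z)).
  - exact: stiffC.
  - by move=> u v v'; exact: stiffDl.
  - by move=> s u v; exact: stiffZl.
  - by apply: stiff_ge0 => i; exact: elt_gt0.
  - exact: noise_weight_ge0.
  - by move=> l; exact: sobolev_stiff.
by apply: lerXn2r; rewrite ?nnegrE// sumr_ge0// => l _; rewrite mulr_ge0// noise_weight_ge0.
Qed.

End noise.

Section scheme_step.
Context {R : realType} (L : R) (L_gt0 : 0 < L) (Th : mesh L).
Notation n := (nelt Th).
Notation z := (node Th).
Notation h := (fun i : nat => node Th i.+1 - node Th i).
Variables (Omega : Type) (m : nat -> Omega -> R -> 'rV[R]_3) (j : nat) (w : Omega).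
Variables (alpha kappa k : R) (u : R -> 'rV[R]_3).
Hypotheses (alpha_gt0 : 0 < alpha) (kappa_gt0 : 0 < kappa) (k_gt0 : 0 < k) (k_le1 : k <= 1).
Hypotheses (Va : in_Vh Th (m j w)) (Vb : in_Vh Th (m j.+1 w)).
Hypothesis scheme : forall phi, in_Vh Th phi ->
  hinner Th (fun x => m j.+1 w x - m j w x) phi
  + alpha * kappa * k *
    hinner Th (fun x => cross (midpoint m j w x) (midpoint_torque Th m j w x)) phi
  - kappa * k * hinner Th (midpoint_torque Th m j w) phi
  = hinner Th (fun x => cross (midpoint m j w x) (u x)) phi.
Hypothesis a_unit : forall i, (i <= n)%N -> dot (m j w (z i)) (m j w (z i)) = 1.

Let a := m j w \o z.
Let b := m j.+1 w \o z.
Let lap := nodal_laplacian n h b.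
Let mid i := 2^-1 *: (b i + a i).

Let torqueE i : (i <= n)%N -> midpoint_torque Th m j w (z i) = cross (mid i) (lap i).
Proof. by move=> iN; rewrite /midpoint_torque discrete_laplacian_node. Qed.

Lemma nodal_scheme i : (i <= n)%N ->
  (b i - a i) + (alpha * kappa * k) *: cross (mid i) (cross (mid i) (lap i))
    - (kappa * k) *: cross (mid i) (lap i) = cross (mid i) (u (z i)).
Proof.
move: i; apply: (eq_nodal (nelt_gt0 L_gt0 Th) (@elt_gt0 _ _ Th)) => chi.
have := scheme (interp_in_Vh Th (nodal_lift Th chi)).
rewrite !hinnerE => E.
transitivity (trap n h (fun i => dot (cross (midpoint m j w (z i)) (u (z i)))
    (interp Th (nodal_lift Th chi) (z i)))); last first.
  by apply: eq_trap => i iN; rewrite interp_node// nodal_liftE.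
rewrite -E -!trapZ -[X in _ = _ - X]opprK -[X in _ = _ - - X]mulN1r -trapZ opprK -!trapD.
apply: eq_trap => i iN /=; rewrite interp_node// nodal_liftE// torqueE//.
by rewrite !dotBl !dotDl !dotZl !dotNl; ring.
Qed.

Lemma hnorm_midpoint_torque : hnorm Th (midpoint_torque Th m j w) ^+ 2 =
  trap n h (fun i => dot (cross (mid i) (lap i)) (cross (mid i) (lap i))).
Proof.
rewrite sqr_sqrtr hinnerE; last first.
  by apply: trap_ge0 => [i|i _]; [exact: elt_gt0|exact: dot_ge0].
by apply: eq_trap => i iN; rewrite torqueE.
Qed.

Lemma scheme_unit i : (i <= n)%N -> dot (m j.+1 w (z i)) (m j.+1 w (z i)) = 1.
Proof. exact: (midpoint_unit nodal_scheme a_unit). Qed.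

Variable eta : R.
Hypotheses (eta_ge0 : 0 <= eta)
  (u_le : forall i, (i <= n)%N -> dot (u (z i)) (u (z i)) <= eta ^+ 2)
  (stiff_u_le : stiff n h (u \o z) (u \o z) <= eta ^+ 2).

Lemma scheme_energy :
  stiff n h b b + 2^-1 * stiff n h (b \- a) (b \- a)
    + alpha * kappa * (k * hnorm Th (midpoint_torque Th m j w) ^+ 2)
  <= stiff n h a a + 2 * torque_form n h a (u \o z) a
    + energy_const L alpha kappa * eta ^+ 2 * (1 + stiff n h a a).
Proof.
rewrite hnorm_midpoint_torque mulrA.
apply: (midpoint_energy_step (@elt_gt0 _ _ Th) (sum_elt Th) L_gt0 alpha_gt0 kappa_gt0 k_gt0
  k_le1 _ nodal_scheme a_unit eta_ge0 u_le stiff_u_le).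
by move=> chi; exact: (nodal_laplacianP (nelt_gt0 L_gt0 Th) (@elt_gt0 _ _ Th)).
Qed.

End scheme_step.

(** * The maximal bound *)

Fixpoint running_max (R : realType) (u : nat -> R) (j : nat) : R :=
  if j is j'.+1 then Num.max (running_max u j') (u j) else u 0%N.

Lemma running_max_ge (R : realType) (u : nat -> R) (i j : nat) : (i <= j)%N ->
  u i <= running_max u j.
Proof.
elim: j => [|j IH]; first by rewrite leqn0 => /eqP ->.
by rewrite leq_eqVlt le_max => /predU1P[->|/IH ->//]; rewrite lexx orbT.
Qed.

Section potential_constants.
Context {R : realType} (p : R).
Hypothesis p_ge2 : 2 <= p.

Lemma pot_a_ge1 : 1 <= pot_a p.
Proof.
have p1 : 0 < p - 1 by have := p_ge2; lra.
rewrite /pot_a ler_pdivlMr//; lra.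
Qed.

Lemma pot_K_gt0 : 0 < pot_K p.
Proof.
have a0 := lt_le_trans ltr01 pot_a_ge1.
by rewrite mulr_gt0// powR_gt0// mulr_gt0.
Qed.

Lemma pot_K_ge0 : 0 <= pot_K p. Proof. exact: ltW pot_K_gt0. Qed.

Lemma pot_const_ge0 (N : nat) (C : R) : 0 <= C -> 0 <= pot_const p N C.
Proof.
have p0 : 0 <= p by exact: le_trans p_ge2.
move=> C0; have K0 := pot_K_ge0; apply: mulr_ge0 => //; apply: addr_ge0.
  by apply: mulr_ge0 => //; exact: mulr_ge0.
apply: mulr_ge0.
  apply: mulr_ge0 => //; apply: addr_ge0; first by rewrite mulr_ge0// sqr_ge0.
  by apply: exprn_ge0; rewrite addr_ge0// mulr_ge0.
by rewrite addr_ge0// exprn_ge0// mulr_ge0// addr_ge0.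
Qed.

Lemma pot_diag_le (s : R) : 0 < s -> pot p s s <= pot_K p * s `^ p.
Proof.
move=> s0; rewrite /pot gerDr -mulrA (powRB1M p_ge2 (ltW s0)) subr_le0.
by rewrite ler_peMl ?powR_ge0// pot_a_ge1.
Qed.

Definition growth_rate (N : nat) (K C : R) : R := pot_const p N C *
  (K ^+ 2 * gauss_moment 1 + K ^+ (N.*2).*2 * gauss_moment N.*2).

(** The factor 2 compares the power of the maximum with the potential, the exponential is the
    discrete Gronwall factor, and [pot_K p] bounds the initial potential. *)
Definition doob_const (N : nat) (K C T : R) : R :=
  2 * (expR (growth_rate N K C * T) * pot_K p).

Lemma doob_const_gt0 (N : nat) (K C T : R) : 0 < doob_const N K C T.
Proof. by rewrite mulr_gt0// mulr_gt0 ?expR_gt0 ?pot_K_gt0. Qed.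

End potential_constants.

Section maximal_bound.
Context d (Omega : measurableType d) {R : realType} (P : probability Omega R).
Variables (p : R) (N : nat).
Hypotheses (p_ge2 : 2 <= p) (p_leN : p <= N%:R).
Variables (J : nat) (F : nat -> set (set Omega)) (c : nat -> R).
Variables (D : nat -> nat -> Omega -> R) (k K C x0 : R).
Hypothesis sF : forall j, (j <= J)%N -> sigma_algebra setT (F j).
Hypothesis FM : forall j, (j <= J)%N -> F j `<=` measurable.
Hypothesis F_mono : forall i j, (i <= j)%N -> (j <= J)%N -> F i `<=` F j.
Hypotheses (c_ge0 : forall l, 0 <= c l) (K_ge0 : 0 <= K).
Hypothesis sum_c : forall n, \sum_(l < n) c l <= K.
Hypotheses (k_gt0 : 0 < k) (k_le1 : k <= 1) (C_ge0 : 0 <= C) (x0_ge0 : 0 <= x0).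
Hypothesis FD : forall j l, (j < J)%N -> rv_measurable (F j.+1) (D j l).
Hypothesis lawD : forall j l (B : set R), (j < J)%N -> measurable B ->
  P (D j l @^-1` B) = normal_prob 0 (Num.sqrt k) B.
Hypothesis indep : forall j l (A : set Omega) (B : set R), (j < J)%N -> F j A ->
  measurable B -> (P (A `&` D j l @^-1` B) = P A * P (D j l @^-1` B))%E.
Variable G : set Omega.
Hypothesis FG : F 0%N G.
Hypothesis D_fin : forall j w, (j < J)%N -> G w -> (noise_esum c (D j) w < +oo)%E.
Variables (X M : nat -> Omega -> R) (b : nat -> nat -> Omega -> R).
Hypothesis FX : forall j, (j <= J)%N -> rv_measurable (F j) (X j).
Hypothesis X_ge0 : forall j w, 0 <= X j w.
Hypothesis X0 : forall w, G w -> X 0%N w = x0.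
Hypothesis Fb : forall j l, (j < J)%N -> rv_measurable (F j) (b j l).
Hypothesis b_le : forall j l w, (j < J)%N -> G w -> `|b j l w| <= c l * (1 + X j w).
Hypothesis M_cvg : forall j w, (j < J)%N -> G w ->
  (fun n => \sum_(l < n) b j l w * D j l w) @ \oo --> M j w.

Notation eta := (fun j => noise_size c (D j)).

(* Unlike 1 + X j, its increments are explicit: a martingale part and a nonnegative
   part. *)
Definition majorant (j : nat) (w : Omega) : R :=
  1 + X 0%N w + \sum_(i < j) (2 * (\1_G w * M i w) + C * eta i w ^+ 2 * (1 + X i w)).

Hypothesis majorant_ge : forall j w, (j <= J)%N -> G w -> 1 + X j w <= majorant j w.

Notation S := (fun j w => running_max (majorant ^~ w) j).

Definition potential (j : nat) (w : Omega) : R := \1_G w * pot p (S j w) (majorant j w).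

Notation mfun j f := (measurable_fun setT (f : g_sigma_algebraType (F j) -> R)).

Let mfun_mono i j (f : Omega -> R) : (i <= j)%N -> (j <= J)%N -> mfun i f -> mfun j f.
Proof.
move=> ij jJ mf; have iJ := leq_trans ij jJ.
move/(rv_measurableP (sF iJ)): mf => mf; apply/(rv_measurableP (sF jJ)) => B mB.
by apply: F_mono ij jJ _ _; exact: mf.
Qed.

Let mfun_measurable j (f : Omega -> R) : (j <= J)%N -> mfun j f -> measurable_fun setT f.
Proof.
by move=> jJ /(rv_measurableP (sF jJ)) Ff; exact: (rv_measurable_fun (FM jJ) Ff).
Qed.

Let mindic j : (j <= J)%N -> mfun j (\1_G : Omega -> R).
Proof.
move=> jJ; apply: measurable_indic.
by apply: sub_sigma_algebra; apply: F_mono FG.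
Qed.

(** This is the reason for the indicator in [majorant]: the series converges to [M j] on [G], and
    off [G] the product is zero. *)
Let mM j : (j < J)%N -> mfun j.+1 (fun w => \1_G w * M j w).
Proof.
move=> jJ.
apply: (@measurable_fun_cvg _ (g_sigma_algebraType (F j.+1)) R setT (fun n w => \sum_(l < n) (\1_G w * b j l w) * D j l w)).
  move=> n; apply: measurable_sum => l; apply: measurable_funM; last first.
    by apply/(rv_measurableP (sF jJ)); exact: FD.
  apply: measurable_funM; first exact: mindic.
  apply: (@mfun_mono j) => //.
  by apply/(rv_measurableP (sF (ltnW jJ))); exact: Fb.
move=> w _; rewrite indicE; have [Gw|Gw] := boolP (w \in G).
  rewrite mul1r; under eq_fun do under eq_bigr do rewrite mul1r.
  by apply: M_cvg => //; exact: set_mem.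
rewrite mul0r; under eq_fun do under eq_bigr do rewrite !mul0r.
under eq_fun do rewrite big1//.
exact: cvg_cst.
Qed.

Let meta j : (j < J)%N -> mfun j.+1 (eta j).
Proof.
move=> jJ; apply: measurable_noise_size => // l.
by apply/(rv_measurableP (sF jJ)); exact: FD.
Qed.

Let mX i j : (i <= j)%N -> (j <= J)%N -> mfun j (X i).
Proof.
move=> ij jJ; apply: (mfun_mono ij jJ).
by apply/(rv_measurableP (sF (leq_trans ij jJ))); apply: FX; exact: leq_trans jJ.
Qed.

Let mR j : (j <= J)%N -> mfun j (majorant j).
Proof.
move=> jJ; apply: measurable_funD.
  by apply: measurable_funD => //; exact: mX.
apply: measurable_sum => i; have ij : (i < j)%N by [].
have iJ := leq_trans ij jJ.
apply: measurable_funD.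
  apply: measurable_funM => //.
  by apply: (mfun_mono ij jJ); exact: mM.
apply: measurable_funM; last by apply: measurable_funD => //; exact: mX (ltnW ij) jJ.
apply: measurable_funM => //; apply: measurable_funX.
by apply: (mfun_mono ij jJ); exact: meta.
Qed.

Let mS j : (j <= J)%N -> mfun j (S j).
Proof.
elim: j => [|j IH] jJ /=; first exact: mR.
apply: measurable_maxr; last exact: mR.
by apply: (@mfun_mono j) => //; apply: IH; exact: ltnW.
Qed.

Let mpow j q (f : Omega -> R) : mfun j f -> mfun j (fun w => f w `^ q).
Proof. by move=> mf; exact: measurableT_comp (measurable_powR q) mf. Qed.

Let mPhi j : (j <= J)%N -> mfun j (potential j).
Proof.
move=> jJ; apply: measurable_funM; first exact: mindic.
apply: measurable_funD; last first.
  by apply: measurable_funM => //; apply: mpow; exact: mR.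
apply: measurable_funB; first by apply: mpow; exact: mS.
apply: measurable_funM; last exact: mR.
by apply: measurable_funM => //; apply: mpow; exact: mS.
Qed.

Let majorant_gt0 j w : (j <= J)%N -> G w -> 0 < majorant j w.
Proof.
by move=> jJ Gw; apply: lt_le_trans (majorant_ge jJ Gw); rewrite ltr_pwDl.
Qed.

Let majorant_le_max j w : majorant j w <= S j w.
Proof. exact: (@running_max_ge _ (majorant ^~ w)). Qed.

Let indic_good w : G w -> \1_G w = 1 :> R.
Proof. by move=> Gw; rewrite indicE mem_set. Qed.

Let indic_bad w : ~ G w -> \1_G w = 0 :> R.
Proof. by move=> Gw; rewrite indicE memNset. Qed.

Lemma potential_ge j w : (j <= J)%N -> G w -> S j w `^ p <= 2 * potential j w.
Proof.
move=> jJ Gw; rewrite /potential indic_good// mul1r mulrC -ler_pdivrMr//.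
by apply: pot_ge => //; exact: majorant_gt0.
Qed.

Let potential_ge0 j w : (j <= J)%N -> 0 <= potential j w.
Proof.
move=> jJ; have [Gw|Gw] := pselect (G w); last by rewrite /potential indic_bad// mul0r.
by rewrite -(pmulr_rge0 _ (ltr0n R 2)) (le_trans _ (potential_ge jJ Gw))// powR_ge0.
Qed.

Let M_le j w : (j < J)%N -> G w -> `|M j w| <= eta j w * (1 + X j w).
Proof.
move=> jJ Gw; have cM : (fun n => `|\sum_(l < n) b j l w * D j l w|) @ \oo --> `|M j w|.
  by apply: cvg_norm; exact: M_cvg.
rewrite -(cvg_lim (@norm_hausdorff _ _) cM).
apply: limr_le; first by apply/cvg_ex; eexists; exact: cM.
have X1 : 0 <= 1 + X j w by rewrite addr_ge0.
apply: nearW => n; apply: (le_trans (ler_norm_sum _ _ _)).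
apply: (@le_trans _ _ ((\sum_(l < n) c l * `|D j l w|) * (1 + X j w))).
  rewrite mulr_suml; apply: ler_sum => l _.
  by rewrite normrM mulrAC ler_wpM2r //; exact: b_le.
by apply: ler_wpM2r => //; apply: noise_size_ge => //; exact: D_fin.
Qed.

Notation growth := (growth_rate p N K C).

Let growth_ge0 : 0 <= growth.
Proof.
apply: mulr_ge0; first exact: pot_const_ge0.
by rewrite addr_ge0// mulr_ge0 ?exprn_ge0 ?gauss_moment_ge0.
Qed.

Let potential_step j : (j < J)%N -> P.-integrable setT (EFin \o potential j) ->
  (\int[P]_w (potential j.+1 w)%:E <= (1 + growth * k)%:E * \int[P]_w (potential j w)%:E)%E.
Proof.
move=> jJ iY; have jJ' := ltnW jJ.
(* The coefficient of [D j l] in the linear term of [pot_step], built from quantities at time j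
   only. *)
pose e l w := pot_coef p (S j w) (majorant j w) * (2 * (\1_G w * b j l w)).
pose M' w := \1_G w * (pot_coef p (S j w) (majorant j w) * (2 * M j w)).
have a0 := le_trans ler01 (pot_a_ge1 p_ge2); have K0 := pot_K_ge0 p_ge2.
have p0 : 0 <= p by exact: le_trans p_ge2.
(* 4 is the 2 of [pot_coef_le] times the 2 in front of [M j]. *)
have C1 : 0 <= 4 * (pot_K p * p + pot_a p).
  by apply: mulr_ge0 => //; apply: addr_ge0 => //; exact: mulr_ge0.
apply: (expectation_step (FM jJ') c_ge0 K_ge0 sum_c k_gt0 (D := D j) _ _ _
  (Y := potential j) _ _ _ iY (e := e) (M := M') _ C1) => //.
- by move=> l _ B mB; rewrite setTI; apply: (FM jJ); exact: FD.
- by move=> l B mB; exact: lawD.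
- by move=> l A B FA mB; exact: indep.
- by apply/(rv_measurableP (sF jJ')); exact: mPhi.
- by move=> w; exact: potential_ge0.
- move=> w; have [Gw _|Gw] := pselect (G w); first exact: D_fin.
  by rewrite /potential indic_bad// mul0r eqxx.
- move=> l; apply/(rv_measurableP (sF jJ')); apply: measurable_funM.
    apply: measurable_funB; apply: measurable_funM => //; apply: mpow; [exact: mR|exact: mS].
  apply: measurable_funM => //; apply: measurable_funM; first exact: mindic.
  by apply/(rv_measurableP (sF jJ')); exact: Fb.
- move=> l w; have [Gw|Gw] := pselect (G w); last first.
    by rewrite /e /potential indic_bad// !mul0r !mulr0 normr0.
  rewrite /e /potential indic_good// !mul1r normrM normrM (@ger0_norm _ 2)//.
  have H := pot_coef_le p_ge2 (majorant_gt0 jJ' Gw) (majorant_le_max j w).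
  have bR : `|b j l w| <= c l * majorant j w.
    by apply: (le_trans (b_le l jJ Gw)); rewrite ler_wpM2l// majorant_ge.
  apply: (@le_trans _ _ (`|pot_coef p (S j w) (majorant j w)| * (2 * (c l * majorant j w)))).
    by apply: ler_wpM2l => //; apply: ler_wpM2l.
  have := ler_wpM2l (c_ge0 l) H; lra.
- move=> w; have [Gw|Gw] := pselect (G w); last first.
    rewrite /M' indic_bad// mul0r /e.
    under eq_fun do under eq_bigr do rewrite indic_bad// mul0r !mulr0 mul0r.
    by under eq_fun do rewrite big1//; exact: cvg_cst.
  rewrite /M' indic_good// mul1r /e mulrA.
  rewrite [X in X @ _](_ : _ = fun n => pot_coef p (S j w) (majorant j w) * 2 *
      \sum_(l < n) b j l w * D j l w).
    by apply: cvgMl_tmp; exact: M_cvg.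
  apply/funext => n; rewrite mulr_sumr; apply: eq_bigr => l _.
  by rewrite indic_good// mul1r !mulrA.
- by rewrite double_gt0 -(ltr_nat R) (lt_le_trans _ p_leN)// (lt_le_trans _ p_ge2).
- exact: pot_const_ge0.
- by apply: (mfun_measurable jJ); exact: mPhi.
- by move=> w; exact: potential_ge0.
- move=> w; have [Gw|Gw] := pselect (G w); last first.
    by rewrite /M' /potential indic_bad// !mul0r !mulr0 !addr0.
  have E : majorant j.+1 w = majorant j w + 2 * M j w + C * eta j w ^+ 2 * (1 + X j w).
    by rewrite /majorant big_ord_recr/= !addrA indic_good// mul1r.
  rewrite /M' /potential indic_good// !mul1r /= E.
  apply: pot_step => //.
  + by rewrite ltr_pwDl.
  + exact: majorant_ge.
  + exact: noise_size_ge0.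
  + exact: M_le.
  + by rewrite -E; exact: majorant_gt0.
Qed.

Let potential0 w : 0 <= potential 0%N w <= pot_K p * (1 + x0) `^ p.
Proof.
rewrite potential_ge0//=; have [Gw|Gw] := pselect (G w); last first.
  by rewrite /potential indic_bad// mul0r mulr_ge0 ?powR_ge0 ?pot_K_ge0.
rewrite /potential indic_good// mul1r /= /majorant big_ord0 addr0 X0//.
by apply: pot_diag_le => //; rewrite ltr_pwDl.
Qed.

(** Integrability and the bound are proved together: the one-step estimate presupposes that the
    current potential is integrable, which the bound of the previous step provides. *)
Let potential_bound j : (j <= J)%N -> P.-integrable setT (EFin \o potential j) /\
  (\int[P]_w (potential j w)%:E <=
    ((1 + growth * k) ^+ j * (pot_K p * (1 + x0) `^ p))%:E)%E.
Proof.
have g1 : 0 <= 1 + growth * k by rewrite addr_ge0// mulr_ge0 ?growth_ge0// ltW.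
have B j' r : (j' <= J)%N -> (\int[P]_w (potential j' w)%:E <= r%:E)%E ->
    P.-integrable setT (EFin \o potential j').
  move=> jJ H; apply/integrableP; split.
    by apply/measurable_EFinP; apply: (mfun_measurable jJ); exact: mPhi.
  apply: le_lt_trans (ltry r); apply: le_trans H.
  by under eq_integral do rewrite /= ger0_norm ?potential_ge0//.
elim: j => [|j IH] jJ.
  suff H : (\int[P]_w (potential 0 w)%:E <= (pot_K p * (1 + x0) `^ p)%:E)%E.
    by rewrite expr0 mul1r; split => //; exact: B H.
  apply: (@le_trans _ _ (\int[P]_w (pot_K p * (1 + x0) `^ p)%:E)%E).
    apply: ge0_le_integral => //.
    - by move=> w _; rewrite lee_fin potential_ge0.
    - by apply/measurable_EFinP; apply: (mfun_measurable jJ); exact: mPhi.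
    - by move=> w _; rewrite lee_fin; case/andP: (potential0 w).
  by rewrite integral_cst// [X in (_ * X)%E](_ : _ = 1%E) ?mule1//; exact: probability_setT.
have [iY H] := IH (ltnW jJ).
suff H' : (\int[P]_w (potential j.+1 w)%:E <=
    ((1 + growth * k) ^+ j.+1 * (pot_K p * (1 + x0) `^ p))%:E)%E by split => //; exact: B H'.
apply: (le_trans (potential_step jJ iY)); rewrite exprS -mulrA EFinM.
by apply: lee_wpmul2l H; rewrite lee_fin.
Qed.

Lemma measurable_running_majorant : measurable_fun setT (fun w => \1_G w * S J w `^ p).
Proof.
apply: (mfun_measurable (leqnn J)); apply: measurable_funM; first exact: mindic.
by apply: mpow; exact: mS.
Qed.

Lemma doob_maximal_bound :
  (\int[P]_w (\1_G w * S J w `^ p)%:E <= (doob_const p N K C (k * J%:R) * (1 + x0) `^ p)%:E)%E.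
Proof.
have [_ H] := potential_bound (leqnn J).
have mfT := @mfun_measurable J _ (leqnn J).
apply: (@le_trans _ _ (\int[P]_w (2%:E * (potential J w)%:E))%E).
  apply: ge0_le_integral => //.
  - by move=> w _; rewrite lee_fin mulr_ge0// powR_ge0.
  - by apply/measurable_EFinP; exact: measurable_running_majorant.
  - by apply/measurable_EFinP; apply: measurable_funM => //; apply: mfT; exact: mPhi.
  - move=> w _; rewrite -EFinM lee_fin; have [Gw|Gw] := pselect (G w).
      by rewrite indic_good// mul1r potential_ge.
    by rewrite indic_bad// mul0r mulr_ge0// potential_ge0.
rewrite ge0_integralZl_EFin//; first last.
- by apply/measurable_EFinP; apply: mfT; exact: mPhi.
- by move=> w _; rewrite lee_fin potential_ge0.
apply: (le_trans (lee_wpmul2l _ H)); first by rewrite lee_fin.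
rewrite -EFinM lee_fin /doob_const -(mulrA 2) -(mulrA (expR _)) ler_wpM2l//.
apply: ler_wpM2r; first by rewrite mulr_ge0 ?powR_ge0 ?(pot_K_ge0 p_ge2).
(* Discrete Gronwall: (1 + q k)^J <= exp (q k J), where q is the growth rate. *)
rewrite mulrA expRM_natr; apply: lerXn2r; rewrite ?nnegrE ?expR_ge0 ?expR_ge1Dx//.
by rewrite addr_ge0// mulr_ge0// ltW.
Qed.

End maximal_bound.

(** * Moments of the scheme *)

Lemma energy_const_ge0 (R : realType) (L alpha kappa : R) : 0 < L -> 0 < alpha ->
  0 < kappa -> 0 <= energy_const L alpha kappa.
Proof.
move=> L0 a0 k0; have e0 : 0 <= energy_eps L alpha kappa.
  rewrite /energy_eps invr_ge0 addr_ge0// ?divr_ge0 ?mulr_ge0 ?addr_ge0 ?sqr_ge0// ltW//.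
by rewrite /energy_const !addr_ge0 ?invr_ge0 ?mulr_ge0.
Qed.

Lemma powR1D_le_add (R : realType) (p x : R) : 0 <= p -> 0 <= x ->
  (1 + x) `^ p <= 2 `^ p * (1 + x `^ p).
Proof.
move=> p0 x0; rewrite mulrDr mulr1.
have [x1|/ltW x1] := leP x 1.
  apply: (@le_trans _ _ (2 `^ p)); last by rewrite lerDl mulr_ge0 ?powR_ge0.
  by apply: ge0_ler_powR; rewrite ?nnegrE ?addr_ge0//; lra.
apply: (@le_trans _ _ (2 `^ p * x `^ p)); last by rewrite lerDr powR_ge0.
by rewrite -powRM//; apply: ge0_ler_powR; rewrite ?nnegrE ?addr_ge0 ?mulr_ge0//; lra.
Qed.

Lemma measurable_bigmaxr d (T : measurableType d) (R : realType) (I : Type) (s : seq I)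
    (f : I -> T -> R) : (forall i, measurable_fun setT (f i)) ->
  measurable_fun setT (fun w => \big[Num.max/0]_(i <- s) f i w).
Proof.
move=> mf; elim: s => [|i s IH].
  by under eq_fun do rewrite big_nil; exact: measurable_cst.
by under eq_fun do rewrite big_cons; exact: measurable_maxr.
Qed.

Lemma le_sqr1D (R : realFieldType) (x : R) : 0 <= x -> x <= (1 + x) ^+ 2.
Proof. move=> x0; nra. Qed.

Lemma ler_telescope (R : realFieldType) (x x' s a r u v : R) :
  1 + x + s <= r -> x' + a <= x + u + v -> 1 + x' + (s + a) <= r + u + v.
Proof. lra. Qed.

Section scheme_estimate.
Context d (Omega : measurableType d) {R : realType} (P : probability Omega R).
Variables (p T alpha kappa Gamma L : R) (N : nat).
Hypotheses (p_ge2 : 2 <= p) (p_leN : p <= N%:R).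
Hypotheses (T_gt0 : 0 < T) (alpha_gt0 : 0 < alpha) (kappa_gt0 : 0 < kappa) (L_gt0 : 0 < L).
Variables (F : R -> set (set Omega)) (beta : nat -> R -> Omega -> R).
Variables (m0 : R -> 'rV[R]_3) (g : nat -> R -> 'rV[R]_3) (Th : mesh L) (J : nat).
Variable m : nat -> Omega -> R -> 'rV[R]_3.
Hypotheses (filt : filtration T F) (usual : usual_conditions P T F).
Hypothesis brown : forall l, brownian_motion P T F (beta l).
Hypothesis m0_unit : forall x, x \in `[0, L] -> dot (m0 x) (m0 x) = 1.
Hypothesis smooth_g : forall l, smooth_datum L (g l).
Hypothesis sum_g : (\sum_(0 <= l <oo) (Hnorm L 3 (g l))%:E)%E = Gamma%:E.
Hypotheses (J_gt0 : (0 < J)%N) (k_le1 : T / J%:R <= 1).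
Hypothesis sol : midpoint_solution P T alpha kappa F beta g m0 Th J m.

Notation n := (nelt Th).
Notation z := (node Th).
Notation h := (fun i : nat => node Th i.+1 - node Th i).
Notation k := (T / J%:R).
Notation t := (fun j : nat => j%:R * k).
Notation c := (fun l => sobolev_const L * Hnorm L 3 (g l)).
Notation D := (fun j l => increment (beta l) (t j) (t j.+1)).
Notation K := (sobolev_const L * `|Gamma|).
Notation C := (energy_const L alpha kappa).
Notation Ft := (fun j => F (t j)).
Notation noise j w := (noise_increment Th g beta (t j) (t j.+1) w).

Let X j w := stiff n h (m j w \o z) (m j w \o z).
Let b j l w := torque_form n h (m j w \o z) (g l \o z) (m j w \o z).
Let M j w := torque_form n h (m j w \o z) (noise j w \o z) (m j w \o z).
Let x0 := stiff n h (interp Th m0 \o z) (interp Th m0 \o z).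
Let delta j w := stiff n h ((m j.+1 w \o z) \- (m j w \o z)) ((m j.+1 w \o z) \- (m j w \o z)).
Let theta j w := hnorm Th (midpoint_torque Th m j w) ^+ 2.

(* A null set being F_0-measurable, multiplying by the indicator of this event does
   not affect adaptedness. *)
Definition good : set Omega := [set w |
  [/\ forall x, x \in `[0, L] -> m 0%N w x = interp Th m0 x,
      forall j, (j < J)%N -> forall phi, in_Vh Th phi ->
        hinner Th (fun x => m j.+1 w x - m j w x) phi
        + alpha * kappa * k *
          hinner Th (fun x => cross (midpoint m j w x) (midpoint_torque Th m j w x)) phi
        - kappa * k * hinner Th (midpoint_torque Th m j w) phi
        = hinner Th (fun x => cross (midpoint m j w x) (noise j w x)) phi
    & forall j, (j < J)%N -> (noise_esum c (D j) w < +oo)%E]].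

Let J0 : 0 < J%:R :> R. Proof. by rewrite ltr0n. Qed.

Let k_gt0 : 0 < k. Proof. exact: divr_gt0. Qed.

Let kJ : k * J%:R = T. Proof. by rewrite divfK// gt_eqF. Qed.

Let t_ge0 j : 0 <= t j. Proof. by rewrite mulr_ge0// ltW. Qed.

Let t_mono i j : (i <= j)%N -> t i <= t j.
Proof. by move=> ij; rewrite ler_wpM2r ?ler_nat// ltW. Qed.

Let t_leT j : (j <= J)%N -> t j <= T.
Proof. by move=> jJ; apply: (le_trans (t_mono jJ)); rewrite mulrC kJ. Qed.

Let t_in j : (j <= J)%N -> t j \in `[0, T].
Proof. by move=> jJ; rewrite in_itv/= t_ge0 t_leT. Qed.

Let t_lt j : t j < t j.+1.
Proof. by rewrite ltr_pM2r// ltr_nat. Qed.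

Let t_step j : t j.+1 - t j = k.
Proof. by rewrite -mulrBl -natrB// subSnn mul1r. Qed.

Let sF j : (j <= J)%N -> sigma_algebra setT (Ft j).
Proof. by move=> jJ; case: filt => H _; case: (H _ (t_in jJ)). Qed.

Let FM j : (j <= J)%N -> Ft j `<=` measurable.
Proof. by move=> jJ; case: filt => H _; case: (H _ (t_in jJ)). Qed.

Let F_mono i j : (i <= j)%N -> (j <= J)%N -> Ft i `<=` Ft j.
Proof. by move=> ij jJ; case: filt => _; apply; [exact: t_ge0|exact: t_mono|exact: t_leT]. Qed.

Let c_ge0 l : 0 <= c l. Proof. exact: noise_weight_ge0. Qed.

Let sob_ge0 : 0 <= sobolev_const L.
Proof. by rewrite (le_trans ler01)// sobolev_const_ge1. Qed.

Let K_ge0 : 0 <= K. Proof. by rewrite mulr_ge0. Qed.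

Let sum_c q : \sum_(l < q) c l <= K.
Proof.
rewrite -mulr_sumr ler_wpM2l// (le_trans _ (ler_norm _))//.
rewrite -lee_fin -sum_g -sumEFin -(big_mkord xpredT (fun l => (Hnorm L 3 (g l))%:E)).
by apply: nneseries_lim_ge => l _ _; rewrite lee_fin sqrtr_ge0.
Qed.

Let FD j l : (j < J)%N -> rv_measurable (Ft j.+1) (D j l).
Proof.
move=> jJ; have [mb _ _ _ _] := brown l.
apply/(rv_measurableP (sF jJ)); apply: measurable_funB.
  by apply/(rv_measurableP (sF jJ)); apply: mb; exact: t_in.
apply/(rv_measurableP (sF jJ)) => B mB; apply: (F_mono (leqnSn j) jJ).
by apply: mb => //; exact: t_in (ltnW jJ).
Qed.

Let lawD j l (B : set R) : (j < J)%N -> measurable B ->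
  P (D j l @^-1` B) = normal_prob 0 (Num.sqrt k) B.
Proof.
move=> jJ mB; have [_ _ _ law _] := brown l.
by rewrite law ?t_step//; exact: t_leT.
Qed.

Let indep j l (A : set Omega) (B : set R) : (j < J)%N -> Ft j A ->
  measurable B -> (P (A `&` D j l @^-1` B) = P A * P (D j l @^-1` B))%E.
Proof.
move=> jJ FA mB; have [_ _ _ _ ind] := brown l.
by apply: ind => //; exact: t_leT.
Qed.

Let mD j l : (j < J)%N -> measurable_fun setT (D j l).
Proof. by move=> jJ; apply: (rv_measurable_fun (FM jJ)); exact: FD. Qed.

Let good_ae : P.-negligible (~` good).
Proof.
have [_ _ init eqn] := sol.
have fin : {ae P, forall w, forall j, (j < J)%N -> (noise_esum c (D j) w < +oo)%E}.
  apply: ae_foralln => j; have [jJ|_] := ltnP j J; last by apply: aeW.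
  have jJ' := ltnW jJ.
  have := noise_esum_finite (P := P) (sF jJ') (FM jJ') c_ge0 sum_c k_gt0
    (fun l => mD l jJ) (fun l B => @lawD j l B jJ) (fun l A B => @indep j l A B jJ).
  by apply: filterS.
have : {ae P, forall w, good w} by apply: filterS3 init eqn fin => w ? ? ?; split.
by [].
Qed.

Let F_good : Ft 0%N good.
Proof.
have t0 : t 0%N = 0 by exact: mul0r.
have [_ FC _] := sF (leq0n J); rewrite -[good]setCK -setTD; apply: FC.
by rewrite /= t0; case: usual => null _; exact: null.
Qed.

Let Vm j w : (j <= J)%N -> in_Vh Th (m j w).
Proof. by case: sol => V _ _ _ jJ; exact: V. Qed.

(** Unit length is claimed at the nodes only: the initial interpolant has it there, and each step
    preserves it there. *)
Let good_unit j w i : good w -> (j <= J)%N -> (i <= n)%N ->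
  dot (m j w (z i)) (m j w (z i)) = 1.
Proof.
move=> [init eqn _]; elim: j i => [|j IH] i jJ iN.
  by rewrite init ?node_in// interp_node// m0_unit// node_in.
apply: (scheme_unit L_gt0 (Vm w jJ) (eqn _ jJ)) => // i' i'N.
exact: IH (ltnW jJ) i'N.
Qed.

Let noise_le j w q : good w -> (j < J)%N ->
  \sum_(l < q) c l * `|D j l w| <= noise_size c (D j) w.
Proof. by move=> [_ _ fin] jJ; apply: noise_size_ge => //; exact: fin. Qed.

Let good_energy j w : good w -> (j < J)%N ->
  X j.+1 w + (2^-1 * delta j w + alpha * kappa * (k * theta j w)) <=
  X j w + 2 * M j w + C * noise_size c (D j) w ^+ 2 * (1 + X j w).
Proof.
move=> Gw jJ; rewrite addrA; have e0 := noise_size_ge0 (c := c) (D j) c_ge0 w.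
have eqn := let: And3 _ E _ := Gw in E.
apply: (scheme_energy L_gt0 alpha_gt0 kappa_gt0 k_gt0 k_le1 (Vm w jJ) (eqn _ jJ) _ e0).
- by move=> i iN; exact: good_unit (ltnW jJ) iN.
- by move=> i iN; apply: noise_increment_sup => // q; exact: noise_le.
- by apply: noise_increment_stiff => // q; exact: noise_le.
Qed.

Notation Rm := (majorant c D C good X M).

Let X_ge0 j w : 0 <= X j w.
Proof. by apply: stiff_ge0 => i; exact: elt_gt0. Qed.

Let delta_ge0 j w : 0 <= delta j w.
Proof. by apply: stiff_ge0 => i; exact: elt_gt0. Qed.

Let theta_ge0 j w : 0 <= theta j w. Proof. exact: sqr_ge0. Qed.

(** The accumulated dissipation is kept on the left, so that a bound on the majorant controls the
    gradient and both sums at once. *)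
Let energy_le j w : good w -> (j <= J)%N ->
  1 + X j w + \sum_(i < j) (2^-1 * delta i w + alpha * kappa * (k * theta i w)) <= Rm j w.
Proof.
move=> Gw; elim: j => [|j IH] jJ; first by rewrite /majorant !big_ord0.
have -> : Rm j.+1 w = Rm j w + 2 * M j w + C * noise_size c (D j) w ^+ 2 * (1 + X j w).
  by rewrite /majorant big_ord_recr/= !addrA indicE mem_set// mul1r.
rewrite big_ord_recr; exact: ler_telescope (IH (ltnW jJ)) (good_energy Gw jJ).
Qed.

Let majorant_ge j w : (j <= J)%N -> good w -> 1 + X j w <= Rm j w.
Proof.
move=> jJ Gw; apply: le_trans (energy_le Gw jJ); rewrite lerDl sumr_ge0// => i _.
have ak0 := ltW (mulr_gt0 alpha_gt0 kappa_gt0).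
by apply: addr_ge0; apply: mulr_ge0 => //; exact: mulr_ge0 (ltW k_gt0) _.
Qed.

Let X0 w : good w -> X 0%N w = x0.
Proof.
move=> [init _ _]; apply: eq_bigr => i _ /=.
by rewrite !init// node_in// ltnW.
Qed.

Let coord_m j i : (j <= J)%N -> (i <= n)%N ->
  coord_measurable (fun w : g_sigma_algebraType (Ft j) => m j w (z i)).
Proof.
move=> jJ iN a; have [_ mm _ _] := sol.
by apply/(rv_measurableP (sF jJ)); apply: mm => //; exact: node_in.
Qed.

Let FX j : (j <= J)%N -> rv_measurable (Ft j) (X j).
Proof.
move=> jJ; apply/(rv_measurableP (sF jJ)).
by apply: (@measurable_stiff _ (g_sigma_algebraType (Ft j)) R n h (fun i w => m j w (z i)) (fun i w => m j w (z i)));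
  move=> i iN; exact: coord_m.
Qed.

Let Fb j l : (j < J)%N -> rv_measurable (Ft j) (b j l).
Proof.
move=> jJ; apply/(rv_measurableP (sF (ltnW jJ))).
by apply: (@measurable_torque_form _ (g_sigma_algebraType (Ft j)) R n h (fun i w => m j w (z i)) (fun i w => m j w (z i)));
  move=> i iN; exact: coord_m (ltnW jJ) iN.
Qed.

Let b_le j l w : (j < J)%N -> good w -> `|b j l w| <= c l * (1 + X j w).
Proof.
move=> jJ Gw; have X1 : 0 <= 1 + X j w by rewrite addr_ge0.
have cX := mulr_ge0 (c_ge0 l) X1.
rewrite -(@ler_pXn2r _ 2)// real_normK ?num_real//.
apply: (le_trans (torque_form_le (@elt_gt0 _ _ Th) _ _ ler01 _)).
  by move=> i iN; rewrite good_unit// ltnW.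
rewrite mul1r exprMn; apply: ler_pM => //.
- by apply: stiff_ge0 => i; exact: elt_gt0.
- exact: X_ge0.
- exact: sobolev_stiff.
- exact: (le_sqr1D (X_ge0 j w)).
Qed.

Let M_cvg j w : (j < J)%N -> good w ->
  (fun q => \sum_(l < q) b j l w * D j l w) @ \oo --> M j w.
Proof.
move=> jJ Gw; rewrite [X in X @ _](_ : _ = fun q => \sum_(l < q) D j l w * b j l w).
  by apply: noise_increment_torque => // q; exact: noise_le.
by apply/funext => q; apply: eq_bigr => l _; rewrite mulrC.
Qed.

Let D_fin j w : (j < J)%N -> good w -> (noise_esum c (D j) w < +oo)%E.
Proof. by move=> jJ [_ _ fin]; exact: fin. Qed.

Let x0_ge0 : 0 <= x0.
Proof. by apply: stiff_ge0 => i; exact: elt_gt0. Qed.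

Notation S w := (running_max (Rm ^~ w) J).

Let mS : measurable_fun setT (fun w => \1_good w * S w `^ p).
Proof.
exact: (measurable_running_majorant p (D := D) C sF FM F_mono c_ge0 FD F_good FX Fb M_cvg).
Qed.

Let S_moment :
  (\int[P]_w (\1_good w * S w `^ p)%:E <= (doob_const p N K C T * (1 + x0) `^ p)%:E)%E.
Proof.
have := doob_maximal_bound p_ge2 p_leN sF FM F_mono c_ge0 K_ge0 sum_c k_gt0 k_le1
  (energy_const_ge0 L_gt0 alpha_gt0 kappa_gt0) x0_ge0 FD lawD indep F_good D_fin FX X_ge0 X0
  Fb b_le M_cvg majorant_ge.
by rewrite kJ.
Qed.

Let S_ge1 w : good w -> 1 <= S w.
Proof.
move=> Gw; apply: le_trans (running_max_ge (Rm ^~ w) (leq0n J)).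
by apply: le_trans (majorant_ge (leq0n J) Gw); rewrite lerDl.
Qed.

Let X_le j w : good w -> (j <= J)%N -> X j w <= S w.
Proof.
move=> Gw jJ; apply: le_trans (running_max_ge (Rm ^~ w) jJ).
by apply: le_trans (majorant_ge jJ Gw); rewrite lerDr.
Qed.

Let dissipation_le w : good w ->
  2^-1 * \sum_(j < J) delta j w + alpha * kappa * \sum_(j < J) k * theta j w <= S w.
Proof.
move=> Gw; apply: le_trans (running_max_ge (Rm ^~ w) (leqnn J)).
apply: le_trans (energy_le Gw (leqnn J)).
by rewrite big_split/= -!mulr_sumr lerDr addr_ge0.
Qed.

Let ak_gt0 : 0 < alpha * kappa. Proof. exact: mulr_gt0. Qed.

Let sum_delta_ge0 w : 0 <= \sum_(j < J) delta j w.
Proof. exact: sumr_ge0. Qed.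

Let sum_theta_ge0 w : 0 <= \sum_(j < J) k * theta j w.
Proof. by apply: sumr_ge0 => j _; exact: mulr_ge0 (ltW k_gt0) _. Qed.

Let delta_le w : good w -> \sum_(j < J) delta j w <= 2 * S w.
Proof.
move=> Gw; rewrite -ler_pdivrMl//; apply: le_trans (dissipation_le Gw).
by rewrite lerDl; exact: mulr_ge0 (ltW ak_gt0) _.
Qed.

Let theta_le w : good w -> \sum_(j < J) k * theta j w <= (alpha * kappa)^-1 * S w.
Proof.
move=> Gw; rewrite ler_pdivlMl//.
by apply: le_trans (dissipation_le Gw); rewrite lerDr mulr_ge0.
Qed.

Let coord_mT j i : (j <= J)%N -> (i <= n)%N -> coord_measurable (fun w => m j w (z i)).
Proof.
move=> jJ iN a; apply: (rv_measurable_fun (FM jJ)).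
by apply/(rv_measurableP (sF jJ)); exact: (coord_m jJ iN).
Qed.

Let mX j : (j <= J)%N -> measurable_fun setT (X j).
Proof. by move=> jJ; apply: (rv_measurable_fun (FM jJ)); exact: FX. Qed.

Let mdelta j : (j < J)%N -> measurable_fun setT (delta j).
Proof.
move=> jJ; pose d' i w := m j.+1 w (z i) - m j w (z i).
by apply: (@measurable_stiff _ _ _ n h d' d') => i iN;
  apply: coord_measurableB; apply: coord_mT => //; exact: ltnW.
Qed.

Let mtheta j : (j < J)%N -> measurable_fun setT (theta j).
Proof.
move=> jJ; pose tau i w := cross (2^-1 *: (m j.+1 w (z i) + m j w (z i)))
  (nodal_laplacian n h (m j.+1 w \o z) i).
have -> : theta j = fun w => trap n h (fun i => dot (tau i w) (tau i w)).
  by apply/funext => w; apply: hnorm_midpoint_torque => //; exact: Vm.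
apply: (@measurable_trap _ _ _ n h (fun i w => dot (tau i w) (tau i w))) => i iN.
suff H : coord_measurable (tau i) by exact: coord_measurable_dot.
apply: coord_measurable_cross.
  by apply: coord_measurableZ; apply: coord_measurableD; apply: coord_mT => //; exact: ltnW.
apply: (@coord_measurable_nodal_laplacian _ _ _ n h (fun i w => m j.+1 w (z i))) => i' i'N.
exact: coord_mT.
Qed.

Let mpow q (f : Omega -> R) : measurable_fun setT f -> measurable_fun setT (fun w => f w `^ q).
Proof. by move=> mf; exact: measurableT_comp (measurable_powR q) mf. Qed.

Let p_ge0 : 0 <= p. Proof. exact: le_trans p_ge2. Qed.

Let gradE j w : (j <= J)%N -> L2norm L (derive1 (m j w)) `^ (2 * p) = X j w `^ p.
Proof.
move=> jJ; rewrite /L2norm (L2inner_derive1 (Vm w jJ) (Vm w jJ)) powRrM.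
by rewrite powR_mulrn ?sqrtr_ge0// sqr_sqrtr//; exact: X_ge0.
Qed.

Let increment_gradE j w : (j < J)%N ->
  L2norm L (derive1 (fun x => m j.+1 w x - m j w x)) ^+ 2 = delta j w.
Proof.
move=> jJ; have V := in_VhB (Vm w jJ) (Vm w (ltnW jJ)).
by rewrite /L2norm (L2inner_derive1 V V) sqr_sqrtr//; exact: delta_ge0.
Qed.

Let moment_le (f : Omega -> R) (r : R) : 0 <= r -> (forall w, 0 <= f w) ->
  measurable_fun setT f -> (forall w, good w -> f w <= r * S w `^ p) ->
  ('E_P[f] <= (r * (doob_const p N K C T * (1 + x0) `^ p))%:E)%E.
Proof.
move=> r0 f0 mf fS; rewrite unlock.
have S0 w : (0 <= (\1_good w * S w `^ p)%:E)%E by rewrite lee_fin mulr_ge0// powR_ge0.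
apply: (@le_trans _ _ (\int[P]_w (r%:E * (\1_good w * S w `^ p)%:E))%E).
  apply: ae_ge0_le_integral => //.
  - by move=> w _; rewrite lee_fin.
  - exact/measurable_EFinP.
  - by move=> w _; rewrite mule_ge0.
  - by apply/measurable_EFinP; apply: measurable_funM.
  - have : {ae P, forall w, good w} by exact: good_ae.
    apply: filterS => w Gw _; rewrite -EFinM lee_fin indicE mem_set// mul1r.
    exact: fS.
rewrite ge0_integralZl_EFin//; last exact/measurable_EFinP.
by rewrite EFinM; apply: lee_wpmul2l S_moment; rewrite lee_fin.
Qed.

Let initial_moment :
  ('E_P[(fun w => L2norm L (derive1 (m 0%N w)) `^ (2 * p))%R] = (x0 `^ p)%:E)%E.
Proof.
rewrite unlock; under eq_integral do rewrite gradE//.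
transitivity (\int[P]_w (x0 `^ p)%:E)%E.
  apply: ae_eq_integral => //.
    by apply/measurable_EFinP; apply: mpow; exact: mX.
  have : {ae P, forall w, good w} by exact: good_ae.
  by apply: filterS => w Gw _; rewrite X0.
by rewrite integral_cst// [X in (_ * X)%E](_ : _ = 1%E) ?mule1//; exact: probability_setT.
Qed.

Lemma scheme_moments :
  ('E_P[(fun w => \big[Num.max/0]_(j < J.+1)
           L2norm L (derive1 (m j w)) `^ (2 * p))%R]
   + 'E_P[(fun w => (\sum_(j < J)
           L2norm L (derive1 (fun x => m j.+1 w x - m j w x)) ^+ 2) `^ p)%R]
   + 'E_P[(fun w => (\sum_(j < J)
           T / J%:R * hnorm Th (midpoint_torque Th m j w) ^+ 2) `^ p)%R]
   <= ((1 + 2 `^ p + (alpha * kappa)^-1 `^ p) * (doob_const p N K C T * 2 `^ p))%:E *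
      (1 + 'E_P[(fun w => L2norm L (derive1 (m 0%N w)) `^ (2 * p))%R]))%E.
Proof.
have grad : ('E_P[(fun w => \big[Num.max/0%R]_(j < J.+1)
    L2norm L (derive1 (m j w)) `^ (2 * p))%R] <=
    (1 * (doob_const p N K C T * (1 + x0) `^ p))%:E)%E.
  apply: moment_le => //.
  - by move=> w; exact: bigmax_ge_id.
  - apply: measurable_bigmaxr => j; have jJ : (j <= J)%N by rewrite -ltnS.
    by under eq_fun do rewrite gradE//; apply: mpow; exact: mX.
  - move=> w Gw; rewrite mul1r; apply/bigmax_leP; split=> [|j _]; first exact: powR_ge0.
    have jJ : (j <= J)%N by rewrite -ltnS.
    rewrite gradE//; apply: ge0_ler_powR; rewrite ?nnegrE ?X_ge0//.
      by rewrite (le_trans ler01)// S_ge1.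
    exact: X_le.
have incr : ('E_P[(fun w => (\sum_(j < J)
    L2norm L (derive1 (fun x => m j.+1 w x - m j w x)) ^+ 2) `^ p)%R] <=
    (2 `^ p * (doob_const p N K C T * (1 + x0) `^ p))%:E)%E.
  have -> : (fun w => (\sum_(j < J)
      L2norm L (derive1 (fun x => m j.+1 w x - m j w x)) ^+ 2) `^ p)%R =
      (fun w => (\sum_(j < J) delta j w) `^ p).
    by apply/funext => w; congr (_ `^ _); apply: eq_bigr => j _; exact: increment_gradE.
  apply: moment_le => [|w||w Gw]; rewrite ?powR_ge0//.
    by apply: mpow; apply: measurable_sum => j; exact: mdelta.
  have S0 := le_trans ler01 (S_ge1 Gw).
  by rewrite -powRM//; apply: ge0_ler_powR; rewrite ?nnegrE ?mulr_ge0// delta_le.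
have torque : ('E_P[(fun w => (\sum_(j < J)
    T / J%:R * hnorm Th (midpoint_torque Th m j w) ^+ 2) `^ p)%R] <=
    ((alpha * kappa)^-1 `^ p * (doob_const p N K C T * (1 + x0) `^ p))%:E)%E.
  apply: moment_le => [|w||w Gw]; rewrite ?powR_ge0//.
    apply: mpow; apply: measurable_sum => j; apply: measurable_funM => //.
    exact: mtheta.
  have S0 := le_trans ler01 (S_ge1 Gw); have ak0 := ltW ak_gt0.
  rewrite -powRM ?invr_ge0//; apply: ge0_ler_powR; rewrite ?nnegrE ?mulr_ge0 ?invr_ge0//.
    exact: sum_theta_ge0.
  exact: theta_le.
apply: (le_trans (leeD (leeD grad incr) torque)).
have := ltW (doob_const_gt0 p_ge2 N K C T); move: (doob_const _ _ _ _ _) => W W0.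
rewrite initial_moment -!EFinD -EFinM lee_fin -!mulrDl -!mulrA.
apply: ler_wpM2l; first by rewrite !addr_ge0 ?powR_ge0.
by apply: ler_wpM2l => //; exact: powR1D_le_add.
Qed.

End scheme_estimate.

Theorem proposition3p4 (R : realType) (p T alpha kappa Gamma L rho : R)
    (hp : 2 <= p) (hT : 0 < T) (halpha : 0 < alpha) (hkappa : 0 < kappa)
    (hL : 0 < L) :
  exists2 C : R, 0 < C &
  forall (d : measure_display) (Omega : measurableType d)
    (P : probability Omega R) (F : R -> set (set Omega))
    (beta : nat -> R -> Omega -> R)
    (m0 : R -> 'rV[R]_3) (g : nat -> R -> 'rV[R]_3)
    (Th : mesh L) (J : nat) (m : nat -> Omega -> R -> 'rV[R]_3),
  filtration T F ->
  usual_conditions P T F ->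
  (forall l, brownian_motion P T F (beta l)) ->
  independent_processes P T beta ->
  smooth_datum L m0 ->
  (forall x, x \in `[0, L] -> dot (m0 x) (m0 x) = 1) ->
  (forall l, smooth_datum L (g l)) ->
  (\sum_(0 <= l <oo) (Hnorm L 3 (g l))%:E)%E = Gamma%:E ->
  quasi_uniform rho Th ->
  (0 < J)%N ->
  T / J%:R <= 1 ->
  midpoint_solution P T alpha kappa F beta g m0 Th J m ->
  ('E_P[(fun w => \big[Num.max/0]_(j < J.+1)
           L2norm L (derive1 (m j w)) `^ (2 * p))%R]
   + 'E_P[(fun w => (\sum_(j < J)
           L2norm L (derive1 (fun x => m j.+1 w x - m j w x)) ^+ 2) `^ p)%R]
   + 'E_P[(fun w => (\sum_(j < J)
           T / J%:R * hnorm Th (midpoint_torque Th m j w) ^+ 2) `^ p)%R]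
   <= C%:E * (1 + 'E_P[(fun w => L2norm L (derive1 (m 0%N w)) `^ (2 * p))%R]))%E.
Proof.
have p0 : 0 <= p by exact: le_trans hp.
(* The exponent [p] is real; an integer above it gives access to the even moments of the noise. *)
pose N := Num.bound p; have pN : p <= N%:R by rewrite ltW// archi_boundP.
exists ((1 + 2 `^ p + (alpha * kappa)^-1 `^ p) *
  (doob_const p N (sobolev_const L * `|Gamma|) (energy_const L alpha kappa) T * 2 `^ p)).
  apply: mulr_gt0; first by rewrite -addrA ltr_pwDl// addr_ge0 ?powR_ge0.
  by apply: mulr_gt0; [exact: doob_const_gt0|exact: powR_gt0].
move=> d Omega P F beta m0 g Th J m filt usual brown _ _ m0_unit smooth_g sum_g _ J0 k1 sol.
exact: (scheme_moments hp pN hT halpha hkappa hL filt usual brown m0_unit smooth_g sum_g J0 k1 sol).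
Qed.
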